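(* Let $G$ be a finite group, $P$ a collection of primes and $L\leq G$ a $P$-perfect subgroup. The Green ring $A(-)_{(P)}[e_L^{-1}]$ inherits norms $\tilde{N}_K^H$ for all $K \leq H\leq G$ if and only if $L=1$ is the trivial group. In this case, the norm maps equip $A(-)_{(P)}[e_1^{-1}]$ with the structure of a Tambara functor.
   Context: $\mathbb{Z}_{(P)}=\mathbb{Z}[p^{-1}\mid p\notin P]$. For $H\leq G$, $A(H)$ is the Burnside ring of finite $H$-sets and $A(H)_{(P)}=A(H)\otimes\mathbb{Z}_{(P)}$. $R^G_H$ is restriction, and $N_K^H\colon A(K)_{(P)}\to A(H)_{(P)}$ is the multiplicative norm of the Tambara functor $A(-)_{(P)}$, extending co-induction $X\mapsto\mathrm{Map}_K(H,X)$ of finite $K$-sets. For $Q\leq G$ the mark $\phi^Q\colon A(G)_{(P)}\to\mathbb{Z}_{(P)}$ is the ring homomorphism with $\phi^Q([S])=|S^Q|$. For a finite group $Q$, $O^P(Q)$ is the unique minimal normal subgroup such that $Q/O^P(Q)$ is a solvable group whose order is divisible only by primes in $P$; $Q$ is $P$-perfect if $Q=O^P(Q)$. By Dress, conjugacy classes of $P$-perfect subgroups $L\le G$ correspond bijectively to primitive idempotents $e_L\in A(G)_{(P)}$, where $\phi^Q(e_L)=1$ if $O^P(Q)$ is conjugate in $G$ to $L$, and $0$ otherwise. $A(-)_{(P)}[e_L^{-1}]$ is the levelwise localization, with value $A(H)_{(P)}[R^G_H(e_L)^{-1}]$ at $H\leq G$; it is a Green ring (Mackey functor with commutative ring values, restrictions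 ring maps, transfers module maps over the target). It inherits the norm $\tilde N_K^H$ (from $A(-)_{(P)}$) if there is a map of multiplicative monoids $\tilde N_K^H\colon A(K)_{(P)}[e_L^{-1}]\to A(H)_{(P)}[e_L^{-1}]$ whose precomposition with the localization map of $A(K)_{(P)}$ equals $N_K^H$ followed by the localization map of $A(H)_{(P)}$. A Tambara functor is a product-preserving functor from the category of bispans of finite $G$-sets (morphisms: isomorphism classes of diagrams $X \leftarrow Y \to Z \to W$, encoding a restriction, then a norm, then a transfer) to sets, whose values are abelian groups under the addition induced by transfers along fold maps. Equivalently, it is a Green ring with compatible multiplicative norms satisfying Tambara's axioms. *)

(* Defs.v *)
From HB Require Import structures.
From mathcomp Require Import all_boot all_order all_algebra all_fingroup.
From mathcomp Require Import all_solvable.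
From mathcomp Require Import generic_quotient.
From mathcomp Require Import boolp ring.
From mathcomp Require classical_sets.

Set Implicit Arguments.
Unset Strict Implicit.
Unset Printing Implicit Defensive.

Import GRing.Theory GroupScope.
Local Open Scope quotient_scope.

(** ** Finite G-sets
    Following [action.v], groups act on the right; x |-> x^-1 translates this
    into the left-handed convention.  Only the restriction of [gaction] to the
    acting group is meaningful: morphisms, isomorphisms and fixed points never
    look at it elsewhere. *)

Section MkAct.
Variables (gT : finGroupType) (H : {group gT}) (X : Type).
Variable f : X -> gT -> X.

Definition mkact_fun x a := if a \in H then f x a else x.

Hypothesis f1 : forall x, f x 1 = x.
Hypothesis fM : forall x, {in H &, forall a b, f x (a * b) = f (f x a) b}.

Fact mkact_subproof : is_action H mkact_fun.
Proof.
split=> [a x y|x a b Ha Hb]; rewrite /mkact_fun; last by rewrite groupM // Ha Hb fM.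
case: ifP => // Ha /(congr1 (f ^~ a^-1)).
by rewrite -!fM ?groupV // mulgV !f1.
Qed.

Definition mkact : action H X := Action mkact_subproof.

Lemma mkactE x a : a \in H -> mkact x a = f x a.
Proof. by move=> Ha; rewrite /= /mkact_fun Ha. Qed.
End MkAct.

Record gset (gT : finGroupType) (H : {group gT}) := GSet {
  gcar :> finType;
  gaction : action H gcar }.
Arguments GSet {gT H} gcar gaction.
Arguments gaction {gT H} g.

Definition gact gT (H : {group gT}) (X : gset H) : X -> gT -> X := gaction X.
Arguments gact {gT H} X x a : simpl never.

Section GSets.
Variables (gT : finGroupType) (H : {group gT}).
Implicit Types X Y Z : gset H.

Lemma gact1 X x : gact X x 1 = x.
Proof. exact: act1. Qed.

Lemma gactM X x : {in H &, forall a b, gact X x (a * b) = gact X (gact X x a) b}.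
Proof. by move=> a b Ha Hb; rewrite /gact actMin. Qed.

Lemma gactV X x a : a \in H -> gact X (gact X x a) a^-1 = x.
Proof. by move=> Ha; rewrite -gactM ?groupV // mulgV gact1. Qed.

Lemma gactVK X x a : a \in H -> gact X (gact X x a^-1) a = x.
Proof. by move=> Ha; rewrite -gactM ?groupV // mulVg gact1. Qed.

Definition equivariant X Y (f : X -> Y) :=
  forall x a, a \in H -> f (gact X x a) = gact Y (f x) a.

Record gmap X Y := GMap { gfun :> X -> Y; gmapP : equivariant gfun }.

Definition giso X Y := exists f : gmap X Y, bijective f.

Program Definition gid X : gmap X X := @GMap X X id _.
Next Obligation. by []. Qed.

Program Definition gcomp X Y Z (g : gmap Y Z) (f : gmap X Y) : gmap X Z :=
  @GMap X Z (g \o f) _.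
Next Obligation. by move=> x a Ha /=; rewrite !gmapP. Qed.

Definition gempty : gset H :=
  GSet void (mkact (f := fun x _ => x) (fun=> erefl) (fun _ _ _ _ _ => erefl)).

Definition gpoint : gset H :=
  GSet unit (mkact (f := fun x _ => x) (fun=> erefl) (fun _ _ _ _ _ => erefl)).

Section Sum.
Variables X Y : gset H.
Definition gsum_fun (p : X + Y) a : X + Y :=
  match p with inl x => inl (gact X x a) | inr y => inr (gact Y y a) end.
Fact gsum1 p : gsum_fun p 1 = p.
Proof. by case: p => z /=; rewrite gact1. Qed.
Fact gsumM p : {in H &, forall a b, gsum_fun p (a * b) = gsum_fun (gsum_fun p a) b}.
Proof. by move=> a b Ha Hb; case: p => z /=; rewrite gactM. Qed.
Definition gsum : gset H := GSet (X + Y)%type (mkact gsum1 gsumM).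
Lemma gsumE p a : a \in H -> gact gsum p a = gsum_fun p a.
Proof. exact: mkactE. Qed.

Fact ginl_subproof : @equivariant X gsum inl.
Proof. by move=> x a Ha; rewrite gsumE. Qed.
Fact ginr_subproof : @equivariant Y gsum inr.
Proof. by move=> x a Ha; rewrite gsumE. Qed.
Definition ginl := GMap ginl_subproof.
Definition ginr := GMap ginr_subproof.
End Sum.

Definition gcopair_fun X Y Z (f : X -> Z) (g : Y -> Z) (p : gsum X Y) : Z :=
  match p with inl x => f x | inr y => g y end.
Fact gcopair_subproof X Y Z (f : gmap X Z) (g : gmap Y Z) :
  equivariant (gcopair_fun f g).
Proof. by case=> x a Ha; rewrite gsumE //= gmapP. Qed.
Definition gfold X : gmap (gsum X X) X := GMap (gcopair_subproof (gid X) (gid X)).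

Fact ginit_subproof X : @equivariant gempty X (of_void X).
Proof. by case. Qed.
Definition ginit X : gmap gempty X := GMap (@ginit_subproof X).

Section Prod.
Variables X Y : gset H.
Definition gprod_fun (p : X * Y) a : X * Y := (gact X p.1 a, gact Y p.2 a).
Fact gprod1 p : gprod_fun p 1 = p.
Proof. by case: p => x y; rewrite /gprod_fun /= !gact1. Qed.
Fact gprodM p : {in H &, forall a b, gprod_fun p (a * b) = gprod_fun (gprod_fun p a) b}.
Proof. by move=> a b Ha Hb; rewrite /gprod_fun /= !gactM. Qed.
Definition gprod : gset H := GSet (X * Y)%type (mkact gprod1 gprodM).
Lemma gprodE p a : a \in H -> gact gprod p a = (gact X p.1 a, gact Y p.2 a).
Proof. exact: mkactE. Qed.

Fact gfst_subproof : @equivariant gprod X fst.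
Proof. by move=> x a Ha; rewrite gprodE. Qed.
Fact gsnd_subproof : @equivariant gprod Y snd.
Proof. by move=> x a Ha; rewrite gprodE. Qed.
Definition gfst := GMap gfst_subproof.
Definition gsnd := GMap gsnd_subproof.
End Prod.

Section Sub.
Variables (X : gset H) (p : pred X).
Hypothesis pinv : forall x a, a \in H -> p x -> p (gact X x a).
Definition gsub_fun (u : {x | p x}) a : {x | p x} := insubd u (gact X (val u) a).
Lemma val_gsub u a : a \in H -> val (gsub_fun u a) = gact X (val u) a.
Proof. by move=> Ha; rewrite val_insubd pinv //; exact: valP. Qed.
Fact gsub1 u : gsub_fun u 1 = u.
Proof. by apply: val_inj; rewrite val_gsub // gact1. Qed.
Fact gsubM u : {in H &, forall a b, gsub_fun u (a * b) = gsub_fun (gsub_fun u a) b}.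
Proof. by move=> a b Ha Hb; apply: val_inj; rewrite !val_gsub ?groupM // gactM. Qed.
Definition gsub : gset H := GSet {x | p x} (mkact gsub1 gsubM).
Lemma gsubE u a : a \in H -> val (gact gsub u a) = gact X (val u) a.
Proof. by move=> Ha; rewrite -val_gsub //; congr (val _); exact: mkactE. Qed.

Fact gval_subproof : @equivariant gsub X val.
Proof. exact: gsubE. Qed.
Definition gval : gmap gsub X := GMap gval_subproof.
End Sub.

(** Partial maps from Y to X, with the conjugation action. *)
Section PFun.
Variables X Y : gset H.
Definition gpfun_fun (s : {ffun Y -> option X}) a : {ffun Y -> option X} :=
  [ffun y => omap (fun x => gact X x a) (s (gact Y y a^-1))].
Fact gpfun1 s : gpfun_fun s 1 = s.
Proof.
apply/ffunP => y; rewrite ffunE invg1 gact1.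
by case: (s y) => //= x; rewrite gact1.
Qed.
Fact gpfunM s : {in H &, forall a b, gpfun_fun s (a * b) = gpfun_fun (gpfun_fun s a) b}.
Proof.
move=> a b Ha Hb; apply/ffunP => y; rewrite !ffunE invMg gactM ?groupV //.
by case: (s _) => //= x; rewrite gactM.
Qed.
Definition gpfun : gset H := GSet {ffun Y -> option X} (mkact gpfun1 gpfunM).
Lemma gpfunE s a y : a \in H ->
  gact gpfun s a y = omap (fun x => gact X x a) (s (gact Y y a^-1)).
Proof.
move=> Ha; have -> : gact gpfun s a = gpfun_fun s a by exact: mkactE.
by rewrite ffunE.
Qed.
End PFun.

End GSets.

(** ** Bispans and Tambara functors *)

Section Bispans.
Variables (gT : finGroupType) (G : {group gT}).
Implicit Types X Y Z W V A : gset G.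

Section Pullback.
Variables (X Y Z : gset G) (f : gmap X Z) (g : gmap Y Z).
Fact gpull_subproof (p : gprod X Y) a :
  a \in G -> f p.1 == g p.2 -> f (gact _ p a).1 == g (gact _ p a).2.
Proof. by move=> Ga /eqP Efg; rewrite gprodE //= !gmapP // Efg. Qed.
Definition gpull : gset G := gsub gpull_subproof.
Definition gpull1 : gmap gpull X := gcomp (gfst X Y) (gval gpull_subproof).
Definition gpull2 : gmap gpull Y := gcomp (gsnd X Y) (gval gpull_subproof).
End Pullback.

(** For [p : A -> Y] and [n : Y -> Z], the dependent product [gdprod p n] over Z
    has as fibre over z the sections of p over [n^-1(z)]; a section is encoded as
    a partial map from Y to A that is undefined off [n^-1(z)].  [gdeval p n] is
    the pullback of [gdprod p n] along n, whose points (y, (z, s)) are recorded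
    together with the value a of the section s at y (this forces n y = z), and
    [gdeval_ev] is the evaluation map. *)
Section DependentProduct.
Variables (A Y Z : gset G) (p : gmap A Y) (n : gmap Y Z).

Definition is_section (u : gprod Z (gpfun A Y)) : bool :=
  [forall y, if u.2 y is Some a then (n y == u.1) && (p a == y) else n y != u.1].

Fact gdprod_subproof u a : a \in G -> is_section u -> is_section (gact _ u a).
Proof.
move=> Ga /forallP us; apply/forallP => y; rewrite gprodE //= gpfunE //.
have GVa : a^-1 \in G by rewrite groupV.
have nE : (n y == gact Z u.1 a) = (n (gact Y y a^-1) == u.1).
  rewrite gmapP //; apply/eqP/eqP => [->|<-]; first by rewrite gactV.
  by rewrite gactVK.
have := us (gact Y y a^-1); case: (u.2 _) => [x|] /=; rewrite nE //.
case/andP=> -> /eqP px /=; by rewrite gmapP // px gactVK.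
Qed.

Definition gdprod : gset G := gsub gdprod_subproof.
Definition gdprod_base : gmap gdprod Z :=
  gcomp (gfst Z (gpfun A Y)) (gval gdprod_subproof).

Definition is_value (v : gprod (gprod Y gdprod) A) : bool :=
  (val v.1.2).2 v.1.1 == Some v.2.

Fact gdeval_subproof v a : a \in G -> is_value v -> is_value (gact _ v a).
Proof.
move=> Ga /eqP Ev; rewrite /is_value !gprodE //=.
have /= -> := gsubE (pinv := gdprod_subproof) v.1.2 Ga.
by rewrite gprodE //= gpfunE // gactV // Ev.
Qed.

Definition gdeval : gset G := gsub gdeval_subproof.
Definition gdeval_ev : gmap gdeval A := gcomp (gsnd _ _) (gval gdeval_subproof).
Definition gdeval_sec : gmap gdeval gdprod :=
  gcomp (gsnd _ _) (gcomp (gfst _ _) (gval gdeval_subproof)).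
End DependentProduct.

(** The diagram X <-r- Y -n-> Z -t-> W. *)
Record bispan X W := Bispan {
  bsY : gset G;
  bsZ : gset G;
  bs_res : gmap bsY X;
  bs_nm : gmap bsY bsZ;
  bs_tr : gmap bsZ W }.

Definition bispan_iso X W (b c : bispan X W) :=
  exists (f : gmap (bsY b) (bsY c)) (g : gmap (bsZ b) (bsZ c)),
    [/\ bijective f, bijective g,
        bs_res c \o f =1 bs_res b,
        bs_nm c \o f =1 g \o bs_nm b
      & bs_tr c \o g =1 bs_tr b].

Definition bispan_R X Y (f : gmap Y X) : bispan X Y := Bispan f (gid Y) (gid Y).
Definition bispan_N X Y (f : gmap X Y) : bispan X Y := Bispan (gid X) f (gid Y).
Definition bispan_T X Y (f : gmap X Y) : bispan X Y := Bispan (gid X) (gid X) f.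
Definition bispan_id X : bispan X X := bispan_R (gid X).

(** The composite of X <- Y -> Z -> W with W <- Y' -> Z' -> V is
    X <- Y x_Z E -> D -> V, where D is the dependent product along Y' -> Z' of
    the projection Z x_W Y' -> Y', and E = Y' x_Z' D evaluates to Z x_W Y'. *)
Definition bispan_comp X W V (b : bispan X W) (c : bispan W V) : bispan X V :=
  let pr1 := gpull1 (bs_tr b) (bs_res c) in
  let pr2 := gpull2 (bs_tr b) (bs_res c) in
  let ev := gdeval_ev pr2 (bs_nm c) in
  Bispan
    (gcomp (bs_res b) (gpull1 (bs_nm b) (gcomp pr1 ev)))
    (gcomp (gdeval_sec pr2 (bs_nm c)) (gpull2 (bs_nm b) (gcomp pr1 ev)))
    (gcomp (bs_tr c) (gdprod_base pr2 (bs_nm c))).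

(** A product-preserving functor from bispans to sets.  The empty G-set is
    terminal for bispans and the disjoint union, with the restrictions along the
    two inclusions as projections, is the product.  [tf_sum] and [tf_zero]
    describe the commutative monoid structure carried by each value because of
    transfers along fold maps; [tf_opp] makes it a group. *)
Record tambara := Tambara {
  tf_obj :> gset G -> Type;
  tf_map : forall X W, bispan X W -> tf_obj X -> tf_obj W;
  tf_iso : forall X W (b c : bispan X W),
    bispan_iso b c -> tf_map b =1 tf_map c;
  tf_id : forall X, tf_map (bispan_id X) =1 id;
  tf_comp : forall X W V (b : bispan X W) (c : bispan W V),
    tf_map (bispan_comp b c) =1 tf_map c \o tf_map b;
  tf_terminal : exists z : tf_obj (gempty G), forall z', z' = z;
  tf_product : forall X Y (x : tf_obj X) (y : tf_obj Y),
    exists! z : tf_obj (gsum X Y),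
      tf_map (bispan_R (ginl X Y)) z = x /\ tf_map (bispan_R (ginr X Y)) z = y;
  tf_opp : forall X (x : tf_obj X),
    exists (z : tf_obj (gsum X X)) (z0 : tf_obj (gempty G)),
      tf_map (bispan_R (ginl X X)) z = x /\
      tf_map (bispan_T (gfold X)) z = tf_map (bispan_T (ginit X)) z0 }.

Section TambaraTheory.
Variable F : tambara.

Definition tf_R X Y (f : gmap Y X) : F X -> F Y := tf_map (bispan_R f).
Definition tf_N X Y (f : gmap X Y) : F X -> F Y := tf_map (bispan_N f).
Definition tf_T X Y (f : gmap X Y) : F X -> F Y := tf_map (bispan_T f).

Definition tf_is_sum X (x y s : F X) :=
  exists z : F (gsum X X),
    [/\ tf_R (ginl X X) z = x, tf_R (ginr X X) z = y & tf_T (gfold X) z = s].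

Definition tf_is_prod X (x y s : F X) :=
  exists z : F (gsum X X),
    [/\ tf_R (ginl X X) z = x, tf_R (ginr X X) z = y & tf_N (gfold X) z = s].
End TambaraTheory.

End Bispans.

(** ** The orbits H\G *)
Section Orbits.
Variables (gT : finGroupType) (G : {group gT}).

Section Coset.
Variable H : {group gT}.
Definition gcosets_car : finType := {C : {set gT} | C \in rcosets H G}.
Definition gcosets_fun (C : gcosets_car) a : gcosets_car := insubd C (val C :* a).
Lemma val_gcosets C a : a \in G -> val (gcosets_fun C a) = val C :* a.
Proof.
move=> Ga; rewrite val_insubd.
case: C => /= C /rcosetsP[x Gx ->]; rewrite -rcosetM ifT //.
by apply/rcosetsP; exists (x * a) => //; rewrite groupM.
Qed.
Fact gcosets1 C : gcosets_fun C 1 = C.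
Proof. by apply: val_inj; rewrite val_gcosets // rcoset1. Qed.
Fact gcosetsM C :
  {in G &, forall a b, gcosets_fun C (a * b) = gcosets_fun (gcosets_fun C a) b}.
Proof. by move=> a b Ga Gb; apply: val_inj; rewrite !val_gcosets ?groupM // rcosetM. Qed.
Definition gcosets : gset G := GSet gcosets_car (mkact gcosets1 gcosetsM).
Lemma gcosetsE C a : a \in G -> val (gact gcosets C a) = val C :* a.
Proof. by move=> Ga; rewrite -val_gcosets //; congr (val _); exact: mkactE. Qed.
End Coset.

Section Proj.
Variables (K H : {group gT}) (sKH : K \subset H).
Fact gproj_mem (C : gcosets K) : H * val C \in rcosets H G.
Proof.
case: C => /= C /rcosetsP[x Gx ->]; apply/rcosetsP; exists x => //.
by rewrite mulgA (mulGSid sKH).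
Qed.
Definition gproj_fun (C : gcosets K) : gcosets H := Sub (H * val C) (gproj_mem C).
Fact gproj_subproof : equivariant gproj_fun.
Proof.
move=> C a Ga; apply: val_inj; rewrite gcosetsE //= gcosetsE //.
by rewrite mulgA.
Qed.
(** Kx |-> Hx *)
Definition gproj : gmap (gcosets K) (gcosets H) := GMap gproj_subproof.
End Proj.

Section Conj.
Variables (H : {group gT}) (g : gT) (Gg : g \in G).
Fact gshift_mem (C : gcosets H) : g^-1 *: val C \in rcosets (H :^ g) G.
Proof.
case: C => /= C /rcosetsP[x Gx ->]; apply/rcosetsP; exists (g^-1 * x).
  by rewrite groupM ?groupV.
by rewrite conjsgE -!mulgA mulg_set1 mulKVg.
Qed.
Definition gshift_fun (C : gcosets H) : gcosets (H :^ g) :=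
  Sub (g^-1 *: val C) (gshift_mem C).
Fact gshift_subproof : equivariant gshift_fun.
Proof.
move=> C a Ga; apply: val_inj; rewrite gcosetsE //= gcosetsE //.
by rewrite mulgA.
Qed.
(** Hx |-> g^-1 H x = H^g (g^-1 x) *)
Definition gshift : gmap (gcosets H) (gcosets (H :^ g)) := GMap gshift_subproof.
End Conj.
End Orbits.

(** ** Restriction, induction, co-induction and conjugation of finite G-sets
    These are used for K \subset H only; [gres] is a dummy otherwise. *)
Section ChangeOfGroup.
Variables (gT : finGroupType) (K H : {group gT}).

Section Res.
Variable X : gset H.
Definition gres_fun (x : X) a := if K \subset H then gact X x a else x.
Fact gres1 x : gres_fun x 1 = x.
Proof. by rewrite /gres_fun gact1 if_same. Qed.
Fact gresM x : {in K &, forall a b, gres_fun x (a * b) = gres_fun (gres_fun x a) b}.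
Proof.
move=> a b Ka Kb; rewrite /gres_fun; case: ifP => // sKH.
by rewrite gactM // (subsetP sKH).
Qed.
Definition gres : gset K := GSet X (mkact gres1 gresM).
Lemma gresE x a : K \subset H -> a \in K -> gact gres x a = gact X x a.
Proof.
by move=> sKH Ka; transitivity (gres_fun x a); [exact: mkactE | rewrite /gres_fun sKH].
Qed.
End Res.

Implicit Type X : gset K.

(** Induction: the set X x_K H of classes of pairs (x, h) modulo
    (xk, h) ~ (x, kh) for k \in K. *)
Section Ind.
Variable X : gset K.
Definition ind_orbit (p : X * subg_of H) : {set X * subg_of H} :=
  [set (gact X p.1 (sgval k), k^-1 * p.2) | k : subg_of H & sgval k \in K].
Definition gind_car : finType := {O | O \in codom ind_orbit}.
Definition gind_shift (O : {set X * subg_of H}) a : {set X * subg_of H} :=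
  [set (q.1, q.2 * subg H a) | q in O].
Fact gind_mem (O : gind_car) a : gind_shift (val O) a \in codom ind_orbit.
Proof.
case: O => /= O /codomP[p ->].
apply/codomP; exists (p.1, p.2 * subg H a); rewrite /gind_shift /ind_orbit -imset_comp.
by apply: eq_imset => k /=; rewrite mulgA.
Qed.
Definition gind_fun (O : gind_car) a : gind_car := Sub (gind_shift (val O) a) (gind_mem O a).
Fact gind1 O : gind_fun O 1 = O.
Proof.
apply: val_inj => /=; rewrite -[RHS]imset_id; apply: eq_imset => -[x h] /=.
by rewrite (morph1 (subg H)) mulg1.
Qed.
Fact gindM O : {in H &, forall a b, gind_fun O (a * b) = gind_fun (gind_fun O a) b}.
Proof.
move=> a b Ha Hb; apply: val_inj => /=; rewrite /gind_shift -imset_comp.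
by apply: eq_imset => -[x h] /=; rewrite morphM // mulgA.
Qed.
Definition gind : gset H := GSet gind_car (mkact gind1 gindM).
End Ind.

(** Co-induction Map_K(H, X): the f : H -> X with f (hk) = f(h)k, on which a in H
    acts by (fa)(h) = f(ah). *)
Section Coind.
Variable X : gset K.
Definition is_Kmap (f : {ffun subg_of H -> X}) :=
  [forall h, forall k, (sgval k \in K) ==> (f (h * k) == gact X (f h) (sgval k))].
Definition gcoind_car : finType := {f | is_Kmap f}.
Definition gcoind_shift (f : {ffun subg_of H -> X}) a : {ffun subg_of H -> X} :=
  [ffun h => f (subg H a * h)].
Fact gcoind_mem (f : gcoind_car) a : is_Kmap (gcoind_shift (val f) a).
Proof.
apply/forallP => h; apply/forallP => k; apply/implyP => Kk; rewrite !ffunE mulgA.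
by have /forallP/(_ (subg H a * h))/forallP/(_ k)/implyP := valP f; apply.
Qed.
Definition gcoind_fun (f : gcoind_car) a : gcoind_car :=
  Sub (gcoind_shift (val f) a) (gcoind_mem f a).
Fact gcoind1 f : gcoind_fun f 1 = f.
Proof. by apply/val_inj/ffunP => h; rewrite ffunE (morph1 (subg H)) mul1g. Qed.
Fact gcoindM f : {in H &, forall a b, gcoind_fun f (a * b) = gcoind_fun (gcoind_fun f a) b}.
Proof.
by move=> a b Ha Hb; apply/val_inj/ffunP => h; rewrite !ffunE morphM // mulgA.
Qed.
Definition gcoind : gset H := GSet gcoind_car (mkact gcoind1 gcoindM).
End Coind.
End ChangeOfGroup.

Section Conjugation.
Variables (gT : finGroupType) (H : {group gT}) (g : gT) (X : gset H).
Definition gconj_fun (x : X) a := gact X x (a ^ g^-1).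
Fact gconj1 x : gconj_fun x 1 = x.
Proof. by rewrite /gconj_fun conj1g gact1. Qed.
Fact gconjM x :
  {in H :^ g &, forall a b, gconj_fun x (a * b) = gconj_fun (gconj_fun x a) b}.
Proof. by move=> a b Ha Hb; rewrite /gconj_fun conjMg gactM // -mem_conjg. Qed.
(** X with H^g acting through conjugation H^g -> H. *)
Definition gconj : gset (H :^ g) := GSet X (mkact gconj1 gconjM).
End Conjugation.

(** ** The semiring of isomorphism classes of finite H-sets *)
Section IsoClasses.
Variables (gT : finGroupType) (H : {group gT}).
Implicit Types X Y Z : gset H.

Lemma giso_refl X : giso X X.
Proof. by exists (gid X); exists id. Qed.

Lemma giso_sym X Y : giso X Y -> giso Y X.
Proof.
move=> [f [g fK gK]]; have gP : equivariant (g : Y -> X).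
  by move=> y a Ha; rewrite -{1}[y]gK -gmapP // fK.
by exists (GMap gP); exists f.
Qed.

Lemma giso_trans X Y Z : giso X Y -> giso Y Z -> giso X Z.
Proof. by move=> [f bf] [g bg]; exists (gcomp g f); exact: bij_comp. Qed.

Lemma gisoI X Y (f : X -> Y) : bijective f -> equivariant f -> giso X Y.
Proof. by move=> bf ef; exists (GMap ef). Qed.

(** The H-sets on the finite types ['I_n] represent all isomorphism classes
    while forming a small type. *)
Definition small_gset := {n : nat & action H 'I_n}.
Definition gset_of (u : small_gset) : gset H := GSet 'I_(tag u) (tagged u).

Section Small.
Variable X : gset H.
Definition gsmall_fun (i : 'I_#|X|) a := enum_rank (gact X (enum_val i) a).
Fact gsmall1 i : gsmall_fun i 1 = i.
Proof. by rewrite /gsmall_fun gact1 enum_valK. Qed.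
Fact gsmallM i : {in H &, forall a b, gsmall_fun i (a * b) = gsmall_fun (gsmall_fun i a) b}.
Proof. by move=> a b Ha Hb; rewrite /gsmall_fun gactM // enum_rankK. Qed.
Definition gsmall : small_gset := Tagged (fun n => action H 'I_n) (mkact gsmall1 gsmallM).
Lemma gsmall_iso : giso X (gset_of gsmall).
Proof.
apply: (@gisoI X (gset_of gsmall) enum_rank); first by exists enum_val; [exact: enum_rankK | exact: enum_valK].
move=> x a Ha; rewrite -[x in LHS]enum_rankK -/(gsmall_fun _ _).
by symmetry; exact: mkactE.
Qed.
End Small.

Definition small_iso : rel {classic small_gset} :=
  fun u v => `[< giso (gset_of u) (gset_of v) >].
Fact small_iso_refl : reflexive small_iso.
Proof. by move=> u; apply/asboolP/giso_refl. Qed.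
Fact small_iso_sym : symmetric small_iso.
Proof. by move=> u v; apply/asbool_equiv_eq; split; exact: giso_sym. Qed.
Fact small_iso_trans : transitive small_iso.
Proof. by move=> v u w /asboolP uv /asboolP vw; apply/asboolP/(giso_trans uv). Qed.
Canonical small_iso_equiv := EquivRel small_iso small_iso_refl small_iso_sym small_iso_trans.

Definition gclasses := {eq_quot small_iso}.
HB.instance Definition _ := Choice.on gclasses.

Definition gcls X : gclasses := \pi_gclasses (gsmall X : {classic small_gset}).
Definition gset_repr (x : gclasses) : gset H := gset_of (repr x).

Lemma gclsP X Y : gcls X = gcls Y <-> giso X Y.
Proof.
split=> [/eqmodP/asboolP XY|XY].
  exact: giso_trans (gsmall_iso X) (giso_trans XY (giso_sym (gsmall_iso Y))).
apply/eqmodP/asboolP.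
exact: giso_trans (giso_sym (gsmall_iso X)) (giso_trans XY (gsmall_iso Y)).
Qed.

Lemma gset_reprK x : gcls (gset_repr x) = x.
Proof.
rewrite -[RHS]reprK; apply/eqmodP/asboolP/giso_sym; exact: gsmall_iso.
Qed.

Lemma gclsK X : giso (gset_repr (gcls X)) X.
Proof. by apply/gclsP; rewrite gset_reprK. Qed.

Lemma gclsW (P : gclasses -> Prop) : (forall X, P (gcls X)) -> forall x, P x.
Proof. by move=> PX x; rewrite -[x]gset_reprK. Qed.

Lemma gsum_iso X X' Y Y' : giso X X' -> giso Y Y' -> giso (gsum X Y) (gsum X' Y').
Proof.
move=> [f [f' fK f'K]] [g [g' gK g'K]].
refine (@gisoI (gsum X Y) (gsum X' Y') (fun p => match p with inl x => inl (f x) | inr y => inr (g y) end) _ _).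
  exists (fun p => match p with inl x => inl (f' x) | inr y => inr (g' y) end);
  by case=> z; rewrite ?fK ?f'K ?gK ?g'K.
by case=> z a Ha; rewrite !gsumE //= gmapP.
Qed.

Lemma gprod_iso X X' Y Y' : giso X X' -> giso Y Y' -> giso (gprod X Y) (gprod X' Y').
Proof.
move=> [f [f' fK f'K]] [g [g' gK g'K]].
refine (@gisoI (gprod X Y) (gprod X' Y') (fun p => (f p.1, g p.2)) _ _).
  exists (fun p => (f' p.1, g' p.2)); by case=> x y /=; rewrite ?fK ?f'K ?gK ?g'K.
by case=> x y a Ha; rewrite !gprodE //= !gmapP.
Qed.

Definition gcls_add x y := gcls (gsum (gset_repr x) (gset_repr y)).
Definition gcls_mul x y := gcls (gprod (gset_repr x) (gset_repr y)).

Lemma gcls_addE X Y : gcls_add (gcls X) (gcls Y) = gcls (gsum X Y).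
Proof. by apply/gclsP/gsum_iso; exact: gclsK. Qed.
Lemma gcls_mulE X Y : gcls_mul (gcls X) (gcls Y) = gcls (gprod X Y).
Proof. by apply/gclsP/gprod_iso; exact: gclsK. Qed.

Fact gcls_addA : associative gcls_add.
Proof.
elim/gclsW => X; elim/gclsW => Y; elim/gclsW => Z; rewrite !gcls_addE; apply/gclsP.
refine (@gisoI (gsum X (gsum Y Z)) (gsum (gsum X Y) Z) (fun p : X + (Y + Z) => match p with
  | inl x => inl (inl x) | inr (inl y) => inl (inr y) | inr (inr z) => inr z end) _ _).
  exists (fun p : X + Y + Z => match p with
    | inl (inl x) => inl x | inl (inr y) => inr (inl y) | inr z => inr (inr z) end).
    by do 2?case.
  by do 2?case.
by case=> [x|[y|z]] a Ha; do 4?[rewrite gsumE //=].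
Qed.

Fact gcls_addC : commutative gcls_add.
Proof.
elim/gclsW => X; elim/gclsW => Y; rewrite !gcls_addE; apply/gclsP.
refine (@gisoI (gsum X Y) (gsum Y X) (fun p : X + Y => match p with inl x => inr x | inr y => inl y end) _ _).
  by exists (fun p : Y + X => match p with inl x => inr x | inr y => inl y end); case.
by case=> ? a Ha; rewrite !gsumE.
Qed.

Fact gcls_add0 : left_id (gcls (gempty H)) gcls_add.
Proof.
elim/gclsW => X; rewrite gcls_addE; apply/gclsP/giso_sym.
refine (@gisoI X (gsum (gempty H) X) (inr : X -> void + X) _ _); last by move=> x a Ha; rewrite gsumE.
by exists (fun p : void + X => match p with inl v => of_void X v | inr x => x end) => //; case=> // -[].
Qed.

Fact gcls_mulA : associative gcls_mul.
Proof.
elim/gclsW => X; elim/gclsW => Y; elim/gclsW => Z; rewrite !gcls_mulE; apply/gclsP.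
refine (@gisoI (gprod X (gprod Y Z)) (gprod (gprod X Y) Z) (fun p : X * (Y * Z) => ((p.1, p.2.1), p.2.2)) _ _).
  by exists (fun p : X * Y * Z => (p.1.1, (p.1.2, p.2))); [case=> ? [] | case=> -[]].
by case=> x [y z] a Ha; rewrite !gprodE //= gprodE.
Qed.

Fact gcls_mulC : commutative gcls_mul.
Proof.
elim/gclsW => X; elim/gclsW => Y; rewrite !gcls_mulE; apply/gclsP.
refine (@gisoI (gprod X Y) (gprod Y X) (fun p : X * Y => (p.2, p.1)) _ _).
  by exists (fun p : Y * X => (p.2, p.1)); case.
by case=> x y a Ha; rewrite !gprodE.
Qed.

Fact gcls_mul1 : left_id (gcls (gpoint H)) gcls_mul.
Proof.
elim/gclsW => X; rewrite gcls_mulE; apply/gclsP.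
refine (@gisoI (gprod (gpoint H) X) X (snd : unit * X -> X) _ _); last by case=> u x a Ha; rewrite gprodE.
by exists (pair tt) => //; case=> -[].
Qed.

Fact gcls_mulD : left_distributive gcls_mul gcls_add.
Proof.
elim/gclsW => X; elim/gclsW => Y; elim/gclsW => Z.
rewrite gcls_addE !gcls_mulE gcls_addE; apply/gclsP.
refine (@gisoI (gprod (gsum X Y) Z) (gsum (gprod X Z) (gprod Y Z)) (fun p : (X + Y) * Z => match p.1 with
   inl x => inl (x, p.2) | inr y => inr (y, p.2) end) _ _).
  by exists (fun p : X * Z + Y * Z => match p with
    inl q => (inl q.1, q.2) | inr q => (inr q.1, q.2) end); case=> -[].
by case=> -[] w z a Ha; rewrite gprodE //= !gsumE //= gprodE.
Qed.

Fact gcls_mul0 : left_zero (gcls (gempty H)) gcls_mul.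
Proof.
elim/gclsW => X; rewrite gcls_mulE; apply/gclsP.
refine (@gisoI (gprod (gempty H) X) (gempty H) (fst : void * X -> void) _ _); last by case=> -[].
by exists (of_void (void * X)); [case=> -[] | case].
Qed.

HB.instance Definition _ := GRing.isNmodule.Build gclasses gcls_addA gcls_addC gcls_add0.
HB.instance Definition _ := GRing.Nmodule_isComPzSemiRing.Build gclasses
  gcls_mulA gcls_mulC gcls_mul1 gcls_mulD gcls_mul0.

End IsoClasses.

Local Open Scope ring_scope.

(** ** Group completion of a commutative semiring *)
Section Grothendieck.
Variable S : comPzSemiRingType.

Definition groth_rel : rel (S * S) :=
  fun x y => `[< exists c, x.1 + y.2 + c = y.1 + x.2 + c >].
Fact groth_rel_refl : reflexive groth_rel.
Proof. by move=> x; apply/asboolP; exists 0. Qed.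
Fact groth_rel_sym : symmetric groth_rel.
Proof. by move=> x y; apply/asbool_equiv_eq; split=> -[c Ec]; exists c. Qed.
Fact groth_rel_trans : transitive groth_rel.
Proof.
move=> y x z /asboolP[c Ec] /asboolP[d Ed]; apply/asboolP.
exists (c + d + y.1 + y.2).
transitivity ((x.1 + y.2 + c) + (y.1 + z.2 + d)); first by ring.
by rewrite Ec Ed; ring.
Qed.
Canonical groth_equiv := EquivRel groth_rel groth_rel_refl groth_rel_sym groth_rel_trans.

Definition groth := {eq_quot groth_rel}.
HB.instance Definition _ := Choice.on groth.

(** The formal difference [a - b]. *)
Definition gdiff (a b : S) : groth := \pi_groth (a, b).
Definition groth_in (a : S) : groth := gdiff a 0.

Lemma gdiffP a b a' b' :
  gdiff a b = gdiff a' b' <-> exists c, a + b' + c = a' + b + c.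
Proof. by split=> [/eqmodP/asboolP|E]; last by apply/eqmodP/asboolP. Qed.

Lemma grothW (P : groth -> Prop) : (forall a b, P (gdiff a b)) -> forall x, P x.
Proof. by move=> Pg x; rewrite -[x]reprK; case: (repr x). Qed.

Lemma gdiff_repr (x : groth) : gdiff (repr x).1 (repr x).2 = x.
Proof. by rewrite -[RHS]reprK; case: (repr x). Qed.

Lemma gdiff_repr_ex a b :
  exists c, (repr (gdiff a b)).1 + b + c = a + (repr (gdiff a b)).2 + c.
Proof. by apply/gdiffP; rewrite gdiff_repr. Qed.

Definition groth_add (x y : groth) : groth :=
  gdiff ((repr x).1 + (repr y).1) ((repr x).2 + (repr y).2).
Definition groth_opp (x : groth) : groth := gdiff (repr x).2 (repr x).1.
Definition groth_mul (x y : groth) : groth :=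
  gdiff ((repr x).1 * (repr y).1 + (repr x).2 * (repr y).2)
        ((repr x).1 * (repr y).2 + (repr x).2 * (repr y).1).

Lemma groth_addE a b a' b' :
  groth_add (gdiff a b) (gdiff a' b') = gdiff (a + a') (b + b').
Proof.
rewrite /groth_add; apply/gdiffP.
have [c Ec] := gdiff_repr_ex a b; have [d Ed] := gdiff_repr_ex a' b'.
move: (repr (gdiff a b)) (repr (gdiff a' b')) Ec Ed => p q Ec Ed; exists (c + d).
transitivity ((p.1 + b + c) + (q.1 + b' + d)); first by ring.
by rewrite Ec Ed; ring.
Qed.

Lemma groth_oppE a b : groth_opp (gdiff a b) = gdiff b a.
Proof.
rewrite /groth_opp; apply/gdiffP; have [c Ec] := gdiff_repr_ex a b.
by exists c; rewrite [_ + a]addrC [b + _]addrC.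
Qed.

Lemma groth_mulE a b a' b' :
  groth_mul (gdiff a b) (gdiff a' b') = gdiff (a * a' + b * b') (a * b' + b * a').
Proof.
rewrite /groth_mul; have [c Ec] := gdiff_repr_ex a b.
have [d Ed] := gdiff_repr_ex a' b'; move: (repr (gdiff a b)) (repr (gdiff a' b')) Ec Ed => p q Ec Ed.
transitivity (gdiff (a * q.1 + b * q.2) (a * q.2 + b * q.1)); apply/gdiffP.
  exists (c * (q.1 + q.2)).
  transitivity ((p.1 + b + c) * q.1 + (a + p.2 + c) * q.2); first by ring.
  transitivity ((a + p.2 + c) * q.1 + (p.1 + b + c) * q.2); first by rewrite Ec.
  by ring.
exists (d * (a + b)).
transitivity (a * (q.1 + b' + d) + b * (a' + q.2 + d)); first by ring.
transitivity (a * (a' + q.2 + d) + b * (q.1 + b' + d)); first by rewrite Ed.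
by ring.
Qed.

Fact groth_addA : associative groth_add.
Proof.
by elim/grothW=> a b; elim/grothW=> a' b'; elim/grothW=> a2 b2; rewrite !groth_addE !addrA.
Qed.
Fact groth_addC : commutative groth_add.
Proof.
by elim/grothW=> a b; elim/grothW=> a' b'; rewrite !groth_addE [a + _]addrC [b + _]addrC.
Qed.
Fact groth_add0 : left_id (gdiff 0 0) groth_add.
Proof. by elim/grothW=> a b; rewrite groth_addE !add0r. Qed.
Fact groth_addN : left_inverse (gdiff 0 0) groth_opp groth_add.
Proof.
elim/grothW=> a b; rewrite groth_oppE groth_addE; apply/gdiffP.
by exists 0; rewrite !addr0 add0r addrC.
Qed.
HB.instance Definition _ := GRing.isZmodule.Build groth groth_addA groth_addC groth_add0 groth_addN.

Fact groth_mulA : associative groth_mul.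
Proof.
elim/grothW=> a b; elim/grothW=> a' b'; elim/grothW=> a2 b2.
by rewrite !groth_mulE; congr gdiff; ring.
Qed.
Fact groth_mulC : commutative groth_mul.
Proof. by elim/grothW=> a b; elim/grothW=> a' b'; rewrite !groth_mulE; congr gdiff; ring. Qed.
Fact groth_mul1 : left_id (gdiff 1 0) groth_mul.
Proof. by elim/grothW=> a b; rewrite groth_mulE; congr gdiff; ring. Qed.
Fact groth_mulD : left_distributive groth_mul groth_add.
Proof.
elim/grothW=> a b; elim/grothW=> a' b'; elim/grothW=> a2 b2.
by rewrite groth_addE !groth_mulE groth_addE; congr gdiff; ring.
Qed.
HB.instance Definition _ := GRing.Zmodule_isComPzRing.Build groth
  groth_mulA groth_mulC groth_mul1 groth_mulD.

Lemma gdiffE a b : gdiff a b = groth_in a - groth_in b.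
Proof.
rewrite /groth_in -[- _]/(groth_opp _) groth_oppE.
by symmetry; apply: etrans (groth_addE _ _ _ _) _; rewrite addr0 add0r.
Qed.

End Grothendieck.

(** The extension of an additive map to group completions. *)
Definition groth_lift (S : comPzSemiRingType) (V : zmodType) (f : S -> V) (x : groth S) : V :=
  f (repr x).1 - f (repr x).2.

Lemma groth_liftE (S : comPzSemiRingType) (V : zmodType) (f : S -> V) a b :
  {morph f : u v / u + v} -> groth_lift f (gdiff a b) = f a - f b.
Proof.
move=> fD; rewrite /groth_lift; have [c] := gdiff_repr_ex a b.
move/(congr1 f); rewrite !fD => /addIr E.
by apply/eqP; rewrite subr_eq addrAC -E addrK.
Qed.

(** ** Localization of a commutative ring
    The denominators are the values of a multiplicative family [den] indexed by I;
    naming denominators by their index lets maps such as transfers, which do not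
    commute with products, act on numerators while keeping the index. *)
Record denominators (R : comPzRingType) (I : Type) := Denominators {
  den :> I -> R;
  den1 : I;
  denM : I -> I -> I;
  den1E : den den1 = 1;
  denME : forall i j, den (denM i j) = den i * den j }.

Section Localization.
Variables (R : comPzRingType) (I : Type) (d : denominators R I).

Definition loc_rel : rel (R * {classic I}) :=
  fun x y => `[< exists k, d k * (x.1 * d y.2) = d k * (y.1 * d x.2) >].
Fact loc_rel_refl : reflexive loc_rel.
Proof. by move=> x; apply/asboolP; exists (den1 d). Qed.
Fact loc_rel_sym : symmetric loc_rel.
Proof. by move=> x y; apply/asbool_equiv_eq; split=> -[c Ec]; exists c. Qed.
Fact loc_rel_trans : transitive loc_rel.
Proof.
move=> y x z /asboolP[k Ek] /asboolP[l El]; apply/asboolP.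
exists (denM d (denM d k l) y.2); rewrite !denME.
transitivity (d k * (x.1 * d y.2) * (d l * d z.2)); first by ring.
rewrite Ek; transitivity (d l * (y.1 * d z.2) * (d k * d x.2)); first by ring.
by rewrite El; ring.
Qed.
Canonical loc_equiv := EquivRel loc_rel loc_rel_refl loc_rel_sym loc_rel_trans.

Definition loc := {eq_quot loc_rel}.
HB.instance Definition _ := Choice.on loc.

(** The fraction [a / d i]. *)
Definition frac (a : R) (i : I) : loc := \pi_loc ((a, i) : R * {classic I}).
Definition loc_in (a : R) : loc := frac a (den1 d).

Lemma fracP a i b j :
  frac a i = frac b j <-> exists k, d k * (a * d j) = d k * (b * d i).
Proof. by split=> [/eqmodP/asboolP|E]; last by apply/eqmodP/asboolP. Qed.

Lemma locW (P : loc -> Prop) : (forall a i, P (frac a i)) -> forall x, P x.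
Proof. by move=> Pf x; rewrite -[x]reprK; case: (repr x). Qed.

Definition numer (x : loc) : R := (repr x).1.
Definition denom (x : loc) : I := (repr x).2.

Lemma frac_repr x : frac (numer x) (denom x) = x.
Proof. by rewrite -[RHS]reprK /numer /denom; case: (repr x). Qed.

Lemma frac_repr_ex a i :
  exists k, d k * (numer (frac a i) * d i) = d k * (a * d (denom (frac a i))).
Proof. by apply/fracP; rewrite frac_repr. Qed.

Definition loc_add (x y : loc) : loc :=
  frac (numer x * d (denom y) + numer y * d (denom x)) (denM d (denom x) (denom y)).
Definition loc_opp (x : loc) : loc := frac (- numer x) (denom x).
Definition loc_mul (x y : loc) : loc :=
  frac (numer x * numer y) (denM d (denom x) (denom y)).

Lemma loc_addE a i b j : loc_add (frac a i) (frac b j) = frac (a * d j + b * d i) (denM d i j).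
Proof.
rewrite /loc_add; apply/fracP.
have [k Ek] := frac_repr_ex a i; have [l El] := frac_repr_ex b j.
move: (numer (frac a i)) (numer (frac b j)) (denom (frac a i)) (denom (frac b j)) Ek El.
move=> p q s t Ek El.
exists (denM d k l); rewrite !denME.
transitivity (d k * (p * d i) * (d l * d t * d j) + d l * (q * d j) * (d k * d s * d i)).
  by ring.
by rewrite Ek El; ring.
Qed.

Lemma loc_oppE a i : loc_opp (frac a i) = frac (- a) i.
Proof.
rewrite /loc_opp; apply/fracP; have [k Ek] := frac_repr_ex a i.
by exists k; rewrite !mulNr !mulrN Ek.
Qed.

Lemma loc_mulE a i b j : loc_mul (frac a i) (frac b j) = frac (a * b) (denM d i j).
Proof.
rewrite /loc_mul; apply/fracP.
have [k Ek] := frac_repr_ex a i; have [l El] := frac_repr_ex b j.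
move: (numer (frac a i)) (numer (frac b j)) (denom (frac a i)) (denom (frac b j)) Ek El.
move=> p q s t Ek El.
exists (denM d k l); rewrite !denME.
transitivity (d k * (p * d i) * (d l * (q * d j))); first by ring.
by rewrite Ek El; ring.
Qed.

Fact loc_addA : associative loc_add.
Proof.
elim/locW=> a i; elim/locW=> b j; elim/locW=> c l; rewrite !loc_addE; apply/fracP.
by exists (den1 d); rewrite !denME; ring.
Qed.
Fact loc_addC : commutative loc_add.
Proof.
elim/locW=> a i; elim/locW=> b j; rewrite !loc_addE; apply/fracP.
by exists (den1 d); rewrite !denME; ring.
Qed.
Fact loc_add0 : left_id (loc_in 0) loc_add.
Proof.
elim/locW=> a i; rewrite loc_addE; apply/fracP.
by exists (den1 d); rewrite !denME !den1E; ring.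
Qed.
Fact loc_addN : left_inverse (loc_in 0) loc_opp loc_add.
Proof.
elim/locW=> a i; rewrite loc_oppE loc_addE; apply/fracP.
by exists (den1 d); rewrite !denME !den1E; ring.
Qed.
HB.instance Definition _ := GRing.isZmodule.Build loc loc_addA loc_addC loc_add0 loc_addN.

Fact loc_mulA : associative loc_mul.
Proof.
elim/locW=> a i; elim/locW=> b j; elim/locW=> c l; rewrite !loc_mulE; apply/fracP.
by exists (den1 d); rewrite !denME; ring.
Qed.
Fact loc_mulC : commutative loc_mul.
Proof.
elim/locW=> a i; elim/locW=> b j; rewrite !loc_mulE; apply/fracP.
by exists (den1 d); rewrite !denME; ring.
Qed.
Fact loc_mul1 : left_id (loc_in 1) loc_mul.
Proof.
elim/locW=> a i; rewrite loc_mulE; apply/fracP.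
by exists (den1 d); rewrite !denME !den1E; ring.
Qed.
Fact loc_mulD : left_distributive loc_mul loc_add.
Proof.
elim/locW=> a i; elim/locW=> b j; elim/locW=> c l.
rewrite loc_addE !loc_mulE loc_addE; apply/fracP.
by exists (den1 d); rewrite !denME; ring.
Qed.
HB.instance Definition _ := GRing.Zmodule_isComPzRing.Build loc
  loc_mulA loc_mulC loc_mul1 loc_mulD.

Lemma fracD a i b j : frac a i + frac b j = frac (a * d j + b * d i) (denM d i j).
Proof. exact: loc_addE. Qed.
Lemma fracM a i b j : frac a i * frac b j = frac (a * b) (denM d i j).
Proof. exact: loc_mulE. Qed.
End Localization.

(** The map a / d i |-> f a / d' i *)
Definition loc_map (R R' : comPzRingType) (I : Type) (d : denominators R I)
    (d' : denominators R' I) (f : R -> R') (x : loc d) : loc d' :=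
  frac d' (f (numer x)) (denom x).

Lemma loc_mapE (R R' : comPzRingType) (I : Type) (d : denominators R I)
    (d' : denominators R' I) (f : R -> R') a i :
  (forall j b, f (d j * b) = d' j * f b) -> loc_map d' f (frac d a i) = frac d' (f a) i.
Proof.
move=> fd; apply/fracP; have [k] := frac_repr_ex d a i.
rewrite [_ * d i]mulrC [a * _]mulrC => /(congr1 f); rewrite !fd => E.
by exists k; rewrite [_ * d' i]mulrC E [f a * _]mulrC.
Qed.

(** Denominators prime to P, in any ring, and powers of an element. *)
Section Denominators.
Variable R : comPzRingType.

Section PrimeTo.
Variable P : nat_pred.
Definition prime_to := {s : nat | P^'.-nat s}.
Definition prime_to1 : prime_to := Sub 1%N (isT : P^'.-nat 1%N).
Fact prime_toM_subproof (s t : prime_to) : P^'.-nat (val s * val t)%N.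
Proof. by rewrite pnatM !(valP (_ : prime_to)). Qed.
Definition prime_toM s t : prime_to := Sub (val s * val t)%N (prime_toM_subproof s t).
Definition Pden : denominators R prime_to :=
  @Denominators R prime_to (fun s => (val s)%:R) prime_to1 prime_toM erefl
    (fun s t => natrM _ _ _).
End PrimeTo.

Definition powers (x : R) : denominators R nat :=
  @Denominators R nat (fun i => x ^+ i) 0%N addn (expr0 x) (exprD x).
End Denominators.
Arguments Pden R P : clear implicits.

(** [Zloc P] is Z_(P); localizing a ring at the integers prime to P is tensoring
    it with Z_(P). *)
Definition Zloc (P : nat_pred) := loc (Pden int P).

(** ** Burnside rings *)
Section Burnside.
Variable gT : finGroupType.
Implicit Types G H K L Q : {group gT}.

Definition burnside H := groth (gclasses H).
Definition bset H (X : gset H) : burnside H := groth_in (gcls X).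

Definition burnside_map H K (Phi : gset H -> gset K) : burnside H -> burnside K :=
  groth_lift (fun x => bset (Phi (gset_repr x))).
Definition bres K H : burnside H -> burnside K := burnside_map (gres K (H := H)).
Definition btr K H : burnside K -> burnside H := burnside_map (gind H (K := K)).
Definition bconj H g : burnside H -> burnside (H :^ g) := burnside_map (gconj g (H := H)).
Definition bmark H Q : burnside H -> int :=
  groth_lift (fun x => #|'Fix_(gaction (gset_repr x : gset H))(Q)|%:Z).

(** Co-induction extends uniquely to a polynomial map of degree n = |H : K| on
    formal differences: t |-> [Map_K(H, x + t y)] is polynomial of degree at most
    n in t >= 0, and its value at t = -1, obtained from the vanishing of the
    (n+1)-st finite difference, is taken as the norm of x - y. *)
Definition coind_cls K H (x : gclasses K) : burnside H := bset (gcoind H (gset_repr x)).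
Definition bnorm K H (u : burnside K) : burnside H :=
  let: (x, y) := repr u in
  \sum_(j < #|H : K|.+1) (-1) ^+ j * coind_cls H (x + y *+ j) *+ 'C(#|H : K|.+1, j.+1).

Section Localized.
Variable P : nat_pred.

Definition burnsideP H := loc (Pden (burnside H) P).
Definition bPset H (X : gset H) : burnsideP H := loc_in _ (bset X).
Definition bPres K H : burnsideP H -> burnsideP K := loc_map _ (bres K (H := H)).
Definition bPtr K H : burnsideP K -> burnsideP H := loc_map _ (btr H (K := K)).
Definition bPconj H g : burnsideP H -> burnsideP (H :^ g) := loc_map _ (bconj g (H := H)).
Definition bPmark H Q : burnsideP H -> Zloc P := loc_map _ (bmark Q (H := H)).

(** N (u / s) = N u / N s, where N s is a unit of A(H)_(P) *)
Definition bPnorm K H (w : burnsideP K) : burnsideP H :=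
  classical_sets.xget 0 (fun v : burnsideP H =>
    v * loc_in _ (bnorm H ((val (denom w))%:R : burnside K)) = loc_in _ (bnorm H (numer w))).
End Localized.
End Burnside.

(** ** O^P(Q), P-perfect subgroups and Dress idempotents *)
Section Dress.
Variables (gT : finGroupType) (P : nat_pred).
Local Open Scope group_scope.
Implicit Types G H K L N Q : {group gT}.

Definition solvable_P_quotient Q N :=
  [&& N <| Q, solvable (Q / N) & P.-group (Q / N)].

Definition Presidual Q : {group gT} :=
  (\bigcap_(N : {group gT} | solvable_P_quotient Q N) N)%G.

Lemma solvable_P_quotientI Q N M :
  solvable_P_quotient Q N -> solvable_P_quotient Q M ->
  solvable_P_quotient Q (N :&: M)%G.
Proof.
move=> /and3P[nN sN pN] /and3P[nM sM pM].
have nI : N :&: M <| Q by rewrite normalI.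
have isoQ := third_isog (subsetIl N M) nI nN.
have nIN : N :&: M <| N := normalS (subsetIl N M) (normal_sub nN) nI.
have isoN : N / (N :&: M) \isog N / M.
  by rewrite setIC second_isog // (subset_trans (normal_sub nN)) ?normal_norm.
have sNM : N / M \subset Q / M by rewrite quotientS ?normal_sub.
apply/and3P; split=> //.
  rewrite (series_sol (quotient_normal (N :&: M) nN)) (isog_sol isoN) (isog_sol isoQ) sN andbT.
  exact: solvableS sNM sM.
have pNI : P.-group (N / (N :&: M)) by rewrite /pgroup (card_isog isoN) -/(pgroup _ _); exact: pgroupS sNM pM.
rewrite -(pquotient_pgroup pNI) ?normal_norm ?quotient_normal //.
by rewrite /pgroup (card_isog isoQ).
Qed.

Lemma PresidualP Q :
  solvable_P_quotient Q (Presidual Q) /\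
  forall N, solvable_P_quotient Q N -> Presidual Q \subset N.
Proof.
have minP N : solvable_P_quotient Q N -> Presidual Q \subset N.
  by move=> sN; exact: bigcap_inf.
split=> //; have [|N /mingroupP[sN minN] _] := @mingroup_exists _ (solvable_P_quotient Q) Q.
  by rewrite /solvable_P_quotient normal_refl trivg_quotient solvable1 pgroup1.
suff -> : Presidual Q = N by [].
apply/val_inj/eqP; rewrite eqEsubset minP //=; apply/bigcapsP => M sM.
by rewrite -(minN _ (solvable_P_quotientI sN sM)) ?subsetIl ?subsetIr.
Qed.

Definition P_perfect Q := Presidual Q = Q.

(** The marks of an element of A(G)_(P) determine it, so at most one e has this
    property. *)
Definition is_dress_idempotent G L (e : burnsideP P G) :=
  forall Q, Q \subset G ->
    bPmark Q e = if (Presidual Q : {set gT}) \in L :^: G then 1%R else 0%R.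
End Dress.

(** ** Green rings with norms *)
Record mackey_data (gT : finGroupType) := MackeyData {
  mk_ring :> {group gT} -> comPzRingType;
  mk_res : forall K H : {group gT}, mk_ring H -> mk_ring K;
  mk_tr : forall K H : {group gT}, mk_ring K -> mk_ring H;
  mk_conj : forall (H : {group gT}) (g : gT), mk_ring H -> mk_ring (H :^ g)%G }.

(** M, with its restrictions, transfers, conjugations and the norms N, is the
    restriction to the orbits H\G of a Tambara functor. *)
Definition is_tambara (gT : finGroupType) (G : {group gT}) (M : mackey_data gT)
    (N : forall K H : {group gT}, M K -> M H) :=
  exists (F : tambara G) (theta : forall H : {group gT}, M H -> F (gcosets G H)),
    [/\ forall H : {group gT}, H \subset G ->
          [/\ bijective (theta H),
              forall x y, tf_is_sum (theta H x) (theta H y) (theta H (x + y))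
            & forall x y, tf_is_prod (theta H x) (theta H y) (theta H (x * y))],
        forall (K H : {group gT}) (sKH : K \subset H), H \subset G ->
          [/\ forall x, tf_R (gproj G sKH) (theta H x) = theta K (mk_res K x),
              forall x, tf_T (gproj G sKH) (theta K x) = theta H (mk_tr H x)
            & forall x, tf_N (gproj G sKH) (theta K x) = theta H (N K H x)]
      & forall (H : {group gT}) (g : gT) (Gg : g \in G), H \subset G ->
          forall x, tf_R (gshift H Gg) (theta (H :^ g)%G (mk_conj g x)) = theta H x].

Section LocalizedBurnside.
Variables (gT : finGroupType) (P : nat_pred) (G : {group gT}) (e : burnsideP P G).
Implicit Types H K : {group gT}.

Definition eden H := powers (bPres H e).

Definition burnsideP_loc : mackey_data gT :=
  @MackeyData gT (fun H => loc (eden H))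
    (fun K H => loc_map (eden K) (@bPres gT P K H))
    (fun K H => loc_map (eden H) (@bPtr gT P K H))
    (fun H g => loc_map (eden (H :^ g)%G) (@bPconj gT P H g)).

Definition inherited_norm K H (Nt : burnsideP_loc K -> burnsideP_loc H) :=
  [/\ Nt 1 = 1, {morph Nt : x y / x * y}
    & forall x : burnsideP P K, Nt (loc_in (eden K) x) = loc_in (eden H) (bPnorm H x)].
End LocalizedBurnside.

(** ** Marks *)
Section Marks.
Local Open Scope group_scope.
Variables (gT : finGroupType) (H : {group gT}).
Implicit Types (X Y Z : gset H) (Q : {group gT}).

Definition gfix X Q := #|'Fix_(gaction X)(Q)|.

Lemma gfixP X Q x :
  reflect (forall a, a \in Q -> gact X x a = x) (x \in 'Fix_(gaction X)(Q)).
Proof. exact: afixP. Qed.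

Lemma gfix_inj X Y Q (f : gmap X Y) : Q \subset H -> injective f -> (gfix X Q <= gfix Y Q)%N.
Proof.
move=> /subsetP sQH fI; rewrite /gfix -(card_imset _ fI); apply/subset_leq_card/subsetP.
move=> _ /imsetP[x /gfixP xQ ->]; apply/gfixP => a Qa.
by rewrite -gmapP ?sQH // xQ.
Qed.

Lemma gfix_iso X Y Q : Q \subset H -> giso X Y -> gfix X Q = gfix Y Q.
Proof.
move=> sQH XY; have [f fb] := XY; have [g gb] := giso_sym XY.
by apply/eqP; rewrite eqn_leq (gfix_inj sQH (bij_inj fb)) (gfix_inj sQH (bij_inj gb)).
Qed.

Lemma gfix_sum X Y Q : Q \subset H -> gfix (gsum X Y) Q = (gfix X Q + gfix Y Q)%N.
Proof.
move=> /subsetP sQH; rewrite /gfix -!sum1_card big_sumType /=.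
congr (_ + _)%N; apply: eq_bigl => x.
  by apply/(@gfixP (gsum X Y) Q (inl x))/gfixP => xQ a Qa; have := xQ a Qa;
    rewrite gsumE ?sQH //=; first [by case | by move=> ->].
by apply/(@gfixP (gsum X Y) Q (inr x))/gfixP => xQ a Qa; have := xQ a Qa;
  rewrite gsumE ?sQH //=; first [by case | by move=> ->].
Qed.

Lemma gfix_prod X Y Q : Q \subset H -> gfix (gprod X Y) Q = (gfix X Q * gfix Y Q)%N.
Proof.
move=> /subsetP sQH; rewrite /gfix -cardsX; apply: eq_card => -[x y]; rewrite in_setX /=.
apply/(@gfixP (gprod X Y) Q (x, y))/andP => [xy | [/gfixP xQ /gfixP yQ] a Qa].
  by split; apply/gfixP => a Qa; have := xy a Qa; rewrite gprodE ?sQH // => -[].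
by rewrite gprodE ?sQH //= xQ ?yQ.
Qed.

Lemma gfix_empty Q : gfix (gempty H) Q = 0%N.
Proof. by apply: eq_card0; case. Qed.

Lemma gfix_point Q : Q \subset H -> gfix (gpoint H) Q = 1%N.
Proof.
move=> /subsetP sQH; rewrite /gfix -[RHS]card_unit; apply: eq_card => -[].
by transitivity true => //; apply/(@gfixP (gpoint H) Q tt) => a Qa; case: (gact _ _ _).
Qed.

(** Finite H-sets with the same marks are isomorphic. *)
Section SplitOrbit.
Variables (X : gset H) (x : X).
Fact orbit_inv (y : X) a : a \in H -> y \in orbit (gaction X) H x ->
  gact X y a \in orbit (gaction X) H x.
Proof.
move=> Ha /orbitP[b Hb <-]; apply/orbitP; exists (b * a); first exact: groupM.
exact: gactM.
Qed.
Fact orbitC_inv (y : X) a : a \in H -> y \notin orbit (gaction X) H x ->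
  gact X y a \notin orbit (gaction X) H x.
Proof.
move=> Ha; apply: contra => yO; rewrite -[y](gactV y Ha).
by apply: orbit_inv; rewrite ?groupV.
Qed.
Definition gorbit := gsub orbit_inv.
Definition gorbitC := gsub orbitC_inv.

Lemma gorbit_split : giso (gsum gorbit gorbitC) X.
Proof.
refine (@gisoI _ _ (gsum gorbit gorbitC) X
  (fun p => match p with inl u => val u | inr u => val u end) _ _); last first.
  by case=> u a Ha; rewrite gsumE //= gsubE.
apply: inj_card_bij.
  move=> [u|u] [v|v] /= uv; try by congr (_ _); apply: val_inj.
    by have := valP v; rewrite /= -uv (valP u).
  by have := valP u; rewrite /= uv (valP v).
rewrite card_sum !card_sig -(cardC (mem (orbit (gaction X) H x))).
by apply: eq_leq; congr (_ + _)%N; apply: eq_card.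
Qed.
End SplitOrbit.

Definition gstab X x := [set a in H | gact X x a == x].
Fact gstab_group_set X x : group_set (@gstab X x).
Proof.
apply/group_setP; split; first by rewrite inE group1 gact1 eqxx.
move=> a b; rewrite !inE => /andP[Ha /eqP xa] /andP[Hb /eqP xb].
by rewrite groupM // gactM // xa xb eqxx.
Qed.
Canonical gstab_group X x := Group (@gstab_group_set X x).

Lemma gstab_sub X x : @gstab X x \subset H.
Proof. by apply/subsetP => a; rewrite inE => /andP[]. Qed.

Lemma gorbit_iso X Y x y : @gstab X x = @gstab Y y -> giso (gorbit x) (gorbit y).
Proof.
move=> Exy.
have xP (u : gorbit x) : exists a, (a \in H) && (gact X x a == val u).
  by have /orbitP[a Ha /eqP ua] := valP u; exists a; rewrite Ha.
pose s u := xchoose (xP u).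
have Hs u : s u \in H by have /andP[] := xchooseP (xP u).
have xs u : gact X x (s u) = val u by have /andP[_ /eqP] := xchooseP (xP u).
have stabP a b : a \in H -> b \in H ->
    (gact X x a == gact X x b) = (gact Y y a == gact Y y b).
  move=> Ha Hb; have HaVb : a * b^-1 \in H by rewrite groupM ?groupV.
  have E Z (z : Z) : (gact Z z a == gact Z z b) = (a * b^-1 \in gstab z).
    rewrite inE HaVb gactM ?groupV //; apply/eqP/eqP => [->|{2}<-]; first exact: gactV.
    by rewrite gactVK.
  by rewrite !E Exy.
have yO u : gact Y y (s u) \in orbit (gaction Y) H y by exact: mem_orbit.
pose f u : gorbit y := Sub (gact Y y (s u)) (yO u).
refine (@gisoI _ _ _ _ f _ _); last first.
  move=> u a Ha; apply: val_inj; rewrite gsubE //= -gactM //; apply/eqP.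
  by rewrite -stabP ?groupM // xs gsubE // gactM // xs.
apply: inj_card_bij.
  move=> u v /(congr1 val) /= /eqP; rewrite -stabP // !xs => /eqP; exact: val_inj.
have yP (u : gorbit y) : exists a, (a \in H) && (gact Y y a == val u).
  by have /orbitP[a Ha /eqP ua] := valP u; exists a; rewrite Ha.
have xO a : a \in H -> gact X x a \in orbit (gaction X) H x by exact: mem_orbit.
pose t u := xchoose (yP u).
have Ht u : t u \in H by have /andP[] := xchooseP (yP u).
have yt u : gact Y y (t u) = val u by have /andP[_ /eqP] := xchooseP (yP u).
apply: (@leq_card _ _ (fun u => Sub (gact X x (t u)) (xO _ (Ht u)) : gorbit x)).
move=> u v /(congr1 val) /= /eqP; rewrite stabP // !yt => /eqP; exact: val_inj.
Qed.

Lemma gset_marks X Y :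
  (forall Q, Q \subset H -> gfix X Q = gfix Y Q) -> giso X Y.
Proof.
have [n] := ubnP #|X|; elim: n X Y => // n IHn X Y leXn eqXY.
have cardE Z : #|Z| = gfix Z 1%G.
  by apply: eq_card => z; symmetry; apply/gfixP => a /set1P->; rewrite gact1.
have [x0 _|X0] := pickP (mem X); last first.
  have Y0 : #|Y| = 0%N by rewrite cardE -eqXY ?sub1G // -cardE; exact: eq_card0.
  have X0' : #|X| = 0%N by exact: eq_card0.
  have noX (x : X) : False by have := X0 x.
  refine (@gisoI _ _ X Y (fun x => match noX x return Y with end) _ _); last by move=> x; case: (noX x).
  by apply: inj_card_bij; [move=> x; case: (noX x) | rewrite Y0].
pose x := [arg max_(x > x0) #|gstab x|].
have maxx z : (#|@gstab X z| <= #|gstab x|)%N.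
  by rewrite /x; case: arg_maxnP => // u _; exact.
have stabP Z (z : Z) Q : Q \subset H -> (z \in 'Fix_(gaction Z)(Q)) = (Q \subset gstab z).
  move=> /subsetP sQH; apply/gfixP/subsetP => zQ a Qa.
    by rewrite inE sQH // zQ // eqxx.
  by have := zQ a Qa; rewrite inE => /andP[_ /eqP].
have [y yx] : exists y : Y, gstab x = gstab y.
  have : (0 < gfix Y (gstab_group x))%N.
    rewrite -eqXY ?gstab_sub //; apply/card_gt0P; exists x.
    by rewrite stabP ?gstab_sub.
  case/card_gt0P=> y; rewrite stabP ?gstab_sub // => sxy; exists y.
  have : (0 < gfix X (gstab_group y))%N.
    rewrite eqXY ?gstab_sub //; apply/card_gt0P; exists y.
    by rewrite stabP ?gstab_sub.
  case/card_gt0P=> z; rewrite stabP ?gstab_sub // => syz.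
  apply/eqP; rewrite eqEcard sxy /=.
  by apply: leq_trans (maxx z); exact: subset_leq_card.
have xy := gorbit_iso yx.
have [||f fb] := IHn (gorbitC x) (gorbitC y).
- apply: leq_trans (_ : #|X| <= n)%N => //; rewrite card_sig; apply: proper_card.
  apply/properP; split; first exact/subsetP.
  by exists x => //; rewrite inE negbK orbit_refl.
- move=> Q sQH; apply/eqP; rewrite -(eqn_add2l (gfix (gorbit x) Q)).
  rewrite {2}(gfix_iso sQH xy) -!gfix_sum // !(gfix_iso sQH (gorbit_split _)).
  by rewrite eqXY.
apply: giso_trans (giso_sym (gorbit_split x)) _.
apply: giso_trans (gorbit_split y).
by apply: gsum_iso xy _; exists f.
Qed.
End Marks.

(* Main.v *)
From HB Require Import structures.
From mathcomp Require Import all_boot all_order all_algebra all_fingroup.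
From mathcomp Require Import all_solvable.
From mathcomp Require Import generic_quotient boolp ring zify.
From mathcomp Require classical_sets.
Require Import Defs.

Set Implicit Arguments.
Unset Strict Implicit.
Unset Printing Implicit Defensive.

Import Order.TTheory GRing.Theory Num.Theory.
Local Open Scope ring_scope.

(** Necessity.  Suppose that a norm from the trivial subgroup to L exists and that
    L is not trivial.  The mark of e at the trivial subgroup is then 0, so the
    localization of A(1)_(P) is the zero ring, in which 0 = 1.  A monoid map sends
    1 to 1, while it has to send the class of 0 to the class of N(0) = 0; hence
    0 = 1 in the localization of A(L)_(P).  The mark at L, where e has mark 1,
    survives in that localization and shows that this is absurd
    ([inherited_norm_trivial]).

    Sufficiency.  For L = 1 the subgroups Q with mark 1 on e are those with trivial
    O^P(Q), that is the solvable P-groups ([Presidual_trivial]).  They form a family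
    closed under subgroups and conjugation, and the localized Burnside ring is the
    image of A(H)_(P) in the product of the marks at the members of this family
    ([loc_marks_inj]).  The mark of a norm at Q is a product of marks at subgroups
    of conjugates of Q ([bmark_norm]), so closure under subgroups is exactly what
    norms need.

    The Tambara functor is built from ghosts.  A ghost over X is a function phi of
    the finite G-sets T over X with isotropy in the family that is invariant under
    isomorphism and turns disjoint unions into products.  A G-set U over X gives
    the ghost T |-> #Hom_X(T, U), whose value on an orbit is a mark of U.  A bispan
    acts on ghosts in closed form: restriction composes T -> Y with Y -> X, the norm
    evaluates phi at the pullback of T, and the transfer sums over the lifts of
    T -> W to Z.  With these formulas functoriality is the adjunction between
    pullback and dependent product ([adjoint_maps], [ghB_comp]); no choice of orbits
    or of representatives enters.

    The functor of the theorem consists of the rational ghosts: those which on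
    orbits are differences of ghosts of G-sets, up to a denominator prime to P.  Two
    facts about them carry the proof.  Any such function on orbits extends to a
    unique ghost ([ghost_extension], [ghost_orbits]); this yields opposites
    and the values on disjoint unions, and identifies the rational ghosts over G/H with the
    localization of A(H)_(P) ([theta_bij]).  And norms preserve rational ghosts
    ([rational_ghN]): the norm of a difference A - B is the value at j = -1 of a
    polynomial whose values at j >= 0 are norms of the G-sets A + jB, and the norm
    of an integer s prime to P has powers of s as values on orbits, which makes it
    invertible.  The same two arguments compute the marks of the norm of A(-)_(P)
    ([bmark_norm], [bPnormP]), so that this norm is the norm of ghosts
    ([theta_norm]); the existence of inherited norms and the Tambara structure
    follow. *)

(** * Equivariant maps and pullbacks *)

Section FiniteSums.
Variables (I J : finType).

Lemma inj_surj_bij (f : I -> J) :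
  injective f -> (forall y, exists x, f x = y) -> bijective f.
Proof.
move=> fI fS; apply: (inj_card_bij fI).
rewrite -(card_imset _ fI); apply: subset_leq_card; apply/subsetP => y _.
by have [x <-] := fS y; apply: imset_f.
Qed.

(** Reindexing along a bijection that is only given as a relation: neither
    direction has to be defined off the summation range. *)
Lemma sum_correspondence (V : nmodType) (r : I -> J -> Prop) (p : pred I) (q : pred J)
    (F : I -> V) (F' : J -> V) :
    (forall i, p i -> exists2 j, q j & r i j) ->
    (forall j, q j -> exists2 i, p i & r i j) ->
    (forall i j j', r i j -> r i j' -> j = j') ->
    (forall i i' j, r i j -> r i' j -> i = i') ->
    (forall i j, p i -> q j -> r i j -> F i = F' j) ->
  \sum_(i | p i) F i = \sum_(j | q j) F' j.
Proof.
move=> pq qp rU rI FE.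
transitivity (\sum_(i | p i) \sum_(j | q j && `[< r i j >]) F' j).
  apply: eq_bigr => i pi; have [j qj rij] := pq i pi.
  rewrite (big_pred1 j) ?(FE i j) // => j' /=; apply/andP/eqP => [[_ /asboolP rij']|->].
    exact: rU rij' rij.
  by split=> //; apply/asboolP.
rewrite (exchange_big_dep q) => [|i j _ /andP[] //].
apply: eq_bigr => j qj; have [i pi rij] := qp j qj.
rewrite (big_pred1 i) // => i' /=; rewrite qj /=; apply/andP/eqP => [[_ /asboolP ri'j]|->].
  exact: rI ri'j rij.
by split=> //; apply/asboolP.
Qed.
End FiniteSums.

Lemma card_correspondence (I J : finType) (r : I -> J -> Prop) (p : pred I) (q : pred J) :
    (forall i, p i -> exists2 j, q j & r i j) ->
    (forall j, q j -> exists2 i, p i & r i j) ->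
    (forall i j j', r i j -> r i j' -> j = j') ->
    (forall i i' j, r i j -> r i' j -> i = i') ->
  #|p| = #|q|.
Proof.
by move=> pq qp rU rI; rewrite -!sum1_card; apply: sum_correspondence pq qp rU rI _.
Qed.

Section GMaps.
Variables (gT : finGroupType) (G : {group gT}).
Implicit Types X Y Z : gset G.

Lemma gmap_ext X Y (f g : gmap X Y) : f =1 g -> f = g.
Proof.
case: f g => f fP [g gP] /= /funext efg; case: _ / efg gP => gP.
by congr GMap; exact: Prop_irrelevance.
Qed.

(** Equivariance is decidable on finite sets, so the equivariant maps between two
    finite G-sets form a finite type and can be counted and summed over. *)
Section FiniteType.
Variables X Y : gset G.
Definition equivariantb (f : {ffun X -> Y}) :=
  [forall x, forall a in G, f (gact X x a) == gact Y (f x) a].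

Lemma equivariantbP (f : {ffun X -> Y}) : reflect (@equivariant _ _ X Y f) (equivariantb f).
Proof.
apply: (iffP forallP) => [fP x a Ga | fP x].
  by have /forallP/(_ a)/implyP/(_ Ga)/eqP := fP x.
by apply/forallP => a; apply/implyP => Ga; rewrite fP.
Qed.

Fact gmap_ffun_subproof (f : gmap X Y) : equivariantb (finfun f).
Proof. by apply/equivariantbP => x a Ga; rewrite !ffunE gmapP. Qed.
Definition gmap_ffun (f : gmap X Y) : {g | equivariantb g} := Sub _ (gmap_ffun_subproof f).
Definition ffun_gmap (g : {g | equivariantb g}) : gmap X Y :=
  GMap (elimT (equivariantbP (val g)) (valP g)).
Lemma gmap_ffunK : cancel gmap_ffun ffun_gmap.
Proof. by move=> f; apply: gmap_ext => x; rewrite /= ffunE. Qed.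

HB.instance Definition _ := Finite.copy (gmap X Y) (can_type gmap_ffunK).
End FiniteType.

Lemma gcompA X Y Z W (h : gmap Z W) (g : gmap Y Z) (f : gmap X Y) :
  gcomp h (gcomp g f) = gcomp (gcomp h g) f.
Proof. exact: gmap_ext. Qed.

Lemma gcomp1g X Y (f : gmap X Y) : gcomp (gid Y) f = f.
Proof. exact: gmap_ext. Qed.

Lemma ginv_ex X Y (f : gmap X Y) : bijective f ->
  exists g : gmap Y X, cancel f g /\ cancel g f.
Proof.
move=> [g fK gK]; have gP : equivariant (g : Y -> X).
  by move=> y a Ga; rewrite -{1}[y]gK -gmapP // fK.
by exists (GMap gP).
Qed.

(** Equivariant maps out of quotients and orbits are known on representatives only;
    a total, single-valued and equivariant relation is enough to define one. *)
Lemma gmap_surj X Y (f : X -> Y -> Prop) :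
    (forall x, exists y, f x y) -> (forall x y y', f x y -> f x y' -> y = y') ->
    (forall x y a, a \in G -> f x y -> f (gact X x a) (gact Y y a)) ->
  exists g : gmap X Y, forall x, f x (g x).
Proof.
move=> fE fU fA; have [g gP] := choice fE.
have ge : equivariant g.
  by move=> x a Ga; apply: fU (gP _) _; apply: fA.
by exists (GMap ge).
Qed.

Definition gcopair X Y Z (f : gmap X Z) (g : gmap Y Z) : gmap (gsum X Y) Z :=
  GMap (gcopair_subproof f g).

Section Pull.
Variables (X Y Z : gset G) (f : gmap X Z) (g : gmap Y Z).

Definition gpull_pt x y (e : f x = g y) : gpull f g := Sub (x, y) (introT eqP e).

Lemma gpullP (u : gpull f g) : f (gpull1 f g u) = g (gpull2 f g u).
Proof. exact/eqP/(valP u). Qed.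

Lemma gpull_inj (u v : gpull f g) :
  gpull1 f g u = gpull1 f g v -> gpull2 f g u = gpull2 f g v -> u = v.
Proof. by case: u v => -[x y] p [[x' y'] p'] /= *; apply: val_inj => /=; congr pair. Qed.

Section Lift.
Variables (W : gset G) (a : gmap W X) (b : gmap W Y).
Hypothesis ab : forall w, f (a w) = g (b w).
Fact gpull_lift_subproof : equivariant (fun w => gpull_pt (ab w)).
Proof. by move=> w c Gc; apply: gpull_inj; rewrite [RHS]gmapP //= gmapP. Qed.
Definition gpull_lift : gmap W (gpull f g) := GMap gpull_lift_subproof.
End Lift.
End Pull.

End GMaps.

(** * Ghost functions *)

(** Closure under subgroups lets the isotropy condition pass from a G-set T to every
    G-set that maps to T, in particular to pullbacks of T. *)
Record family (gT : finGroupType) := Family {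
  in_family :> {group gT} -> bool;
  familyS : forall Q R : {group gT}, Q \subset R -> in_family R -> in_family Q }.

Section Ghosts.
Variables (gT : finGroupType) (G : {group gT}) (fam : family gT).
Implicit Types X Y Z W V : gset G.

Record tset := TSet { tcar :> gset G; tsetP : forall x : tcar, fam (gstab_group x) }.
Implicit Types S T : tset.

Lemma gstabP X (x : X) a : reflect (a \in G /\ gact X x a = x) (a \in gstab x).
Proof. by rewrite inE; apply: (iffP andP) => -[Ga /eqP xa]. Qed.

Lemma gstab_gmap X Y (f : gmap X Y) x : gstab x \subset gstab (f x).
Proof.
by apply/subsetP => a /gstabP[Ga xa]; apply/gstabP; split=> //; rewrite -gmapP // xa.
Qed.

Section TsetOver.
Variables (X : gset G) (T : tset) (f : gmap X T).
Fact tover_subproof (x : X) : fam (gstab_group x).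
Proof. exact: familyS (gstab_gmap f x) (tsetP (f x)). Qed.
Definition tover := TSet tover_subproof.
End TsetOver.

Definition tpull T Y Z (s : gmap T Z) (n : gmap Y Z) : tset := tover (gpull1 s n).

Fact tsum_subproof S T (x : gsum S T) : fam (gstab_group x).
Proof.
case: x => x; [have := tsetP x | have := tsetP x]; apply: familyS; apply/subsetP => a;
  by case/gstabP=> Ga; rewrite gsumE // => -[xa]; apply/gstabP.
Qed.
Definition tsum S T := TSet (@tsum_subproof S T).

Fact tempty_subproof (x : gempty G) : fam (gstab_group x).
Proof. by case: x. Qed.
Definition tempty := TSet tempty_subproof.

(** Values are recorded on all G-sets over X, although those on orbits determine
    them in the cases of interest: norms evaluate at pullbacks of orbits, which need
    not be orbits. *)
Definition ghost X := forall T : tset, gmap T X -> rat.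

Definition iso_inv X (phi : ghost X) :=
  forall S T (f : gmap S T) (s : gmap S X) (t : gmap T X),
    bijective f -> t \o f =1 s -> phi S s = phi T t.

Definition gmultiplicative X (phi : ghost X) :=
  phi tempty (ginit X) = 1 /\
  forall S T (s : gmap S X) (t : gmap T X),
    phi (tsum S T) (gcopair s t) = phi S s * phi T t.

Definition ghR X Y (r : gmap Y X) (phi : ghost X) : ghost Y :=
  fun T t => phi T (gcomp r t).
(** For phi = #Hom_Y(-, A) this is the only possible formula: maps over Z into the
    dependent product of A are maps over Y from the pullback into A. *)
Definition ghN Y Z (n : gmap Y Z) (phi : ghost Y) : ghost Z :=
  fun T t => phi (tpull t n) (gpull2 t n).
Definition ghT Z W (t : gmap Z W) (phi : ghost Z) : ghost W :=
  fun T w => \sum_(s : gmap T Z | gcomp t s == w) phi T s.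
Definition ghB X W (b : bispan X W) (phi : ghost X) : ghost W :=
  ghT (bs_tr b) (ghN (bs_nm b) (ghR (bs_res b) phi)).

Lemma ghost_ext X (phi psi : ghost X) : (forall T t, phi T t = psi T t) -> phi = psi.
Proof.
by move=> E; apply: functional_extensionality_dep => T; apply: funext => t.
Qed.

Lemma pull_id_bij T Z (s : gmap T Z) : bijective (gpull1 s (gid Z)).
Proof.
apply: inj_surj_bij => [u v uv|t]; last by exists (@gpull_pt _ _ _ _ _ s (gid Z) t (s t) erefl).
apply: gpull_inj => //.
by have := gpullP u; have := gpullP v; rewrite uv => -> .
Qed.

Lemma ghN_id X (phi : ghost X) : iso_inv phi -> ghN (gid X) phi = phi.
Proof.
move=> phiI; apply: ghost_ext => T t; rewrite /ghN.
apply: (phiI (tpull t (gid X)) T (gpull1 t (gid X))); first exact: pull_id_bij.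
by move=> u; rewrite /= (gpullP u).
Qed.

Lemma ghT_id X (phi : ghost X) : ghT (gid X) phi = phi.
Proof.
by apply: ghost_ext => T t; rewrite /ghT (big_pred1 t) // => s; rewrite gcomp1g.
Qed.

Lemma ghR_id X (phi : ghost X) : ghR (gid X) phi = phi.
Proof. by apply: ghost_ext => T t; rewrite /ghR gcomp1g. Qed.

Section Closure.
Variables X Y : gset G.

Lemma ghR_iso_inv (r : gmap Y X) phi : iso_inv phi -> iso_inv (ghR r phi).
Proof.
by move=> phiI S T f s t fb fst; apply: phiI fb _ => x /=; rewrite -fst.
Qed.

Lemma ghR_mult (r : gmap Y X) phi : iso_inv phi -> gmultiplicative phi ->
  gmultiplicative (ghR r phi).
Proof.
move=> phiI [phi0 phiM]; split=> [|S T s t].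
  by rewrite -phi0; congr (phi _ _); apply: gmap_ext; case.
by rewrite -phiM /ghR; congr (phi _ _); apply: gmap_ext; case.
Qed.

Lemma pull_bij S T (f : gmap S T) (n : gmap X Y) (s : gmap S Y) (t : gmap T Y) :
    bijective f -> t \o f =1 s ->
  exists2 F : gmap (gpull s n) (gpull t n), bijective F & gpull2 t n \o F =1 gpull2 s n.
Proof.
move=> fb fst.
have E (u : gpull s n) : t (gcomp f (gpull1 s n) u) = n (gpull2 s n u).
  by rewrite /= -gpullP -fst.
exists (gpull_lift E) => //; apply: inj_surj_bij => [u v uv|v].
  apply: gpull_inj; first exact/(bij_inj fb)/(congr1 (gpull1 t n) uv).
  exact: (congr1 (gpull2 t n) uv).
have [g [fK gK]] := ginv_ex fb.
have e : s (g (gpull1 t n v)) = n (gpull2 t n v) by rewrite -fst /= gK gpullP.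
by exists (gpull_pt e); apply: gpull_inj => //=; rewrite gK.
Qed.

Lemma ghN_iso_inv (n : gmap X Y) phi : iso_inv phi -> iso_inv (ghN n phi).
Proof.
move=> phiI S T f s t fb fst; have [F Fb FE] := pull_bij n fb fst.
exact: (phiI (tpull s n) (tpull t n) F).
Qed.

(** Pulling back along n preserves disjoint unions. *)
Lemma ghN_mult (n : gmap X Y) phi : iso_inv phi -> gmultiplicative phi ->
  gmultiplicative (ghN n phi).
Proof.
move=> phiI [phi0 phiM]; split=> [|S T s t]; rewrite /ghN.
  rewrite -phi0; apply: (phiI (@tpull tempty _ _ (ginit Y) n) tempty (gpull1 (ginit Y) n)); last by case=> -[[]].
  by apply: inj_surj_bij; [case=> -[[]] | case].
rewrite -phiM; symmetry.
have El (u : gpull s n) : gcopair s t (gcomp (ginl S T) (gpull1 s n) u) = n (gpull2 s n u).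
  exact: gpullP.
have Er (u : gpull t n) : gcopair s t (gcomp (ginr S T) (gpull1 t n) u) = n (gpull2 t n u).
  exact: gpullP.
apply: (phiI (tsum (tpull s n) (tpull t n)) (@tpull (tsum S T) _ _ (gcopair s t) n)
   (gcopair (gpull_lift El) (gpull_lift Er))); last by case.
apply: inj_surj_bij => [|u].
  case=> u [] v uv; move: (congr1 (gpull1 _ _) uv) (congr1 (gpull2 _ _) uv) => //=.
    by case=> uv1 uv2; rewrite (gpull_inj uv1 uv2).
  by case=> uv1 uv2; rewrite (gpull_inj uv1 uv2).
have := gpullP u; case E : (gpull1 _ _ u) => [x|y] /= e.
  by exists (inl (gpull_pt e)); apply: (@gpull_inj _ _ _ _ _ (gcopair s t) n) => //=; rewrite E.
by exists (inr (gpull_pt e)); apply: (@gpull_inj _ _ _ _ _ (gcopair s t) n) => //=; rewrite E.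
Qed.

Lemma ghT_iso_inv (t : gmap X Y) phi : iso_inv phi -> iso_inv (ghT t phi).
Proof.
move=> phiI S T f s u fb fsu; have [g [fK gK]] := ginv_ex fb.
apply: (sum_correspondence (r := fun a b => gcomp b f = a)) => [a /eqP ta|b /eqP tb|a b b'|a a' b|].
- exists (gcomp a g); last by apply: gmap_ext => x /=; rewrite fK.
  by apply/eqP/gmap_ext => x /=; rewrite -[u x]/(u x) -{2}[x]gK -[u _]/((u \o f) _) fsu -ta.
- exists (gcomp b f) => //; apply/eqP/gmap_ext => x /=.
  by rewrite -fsu -tb.
- move=> <- /(congr1 (fun h : gmap _ _ => h : _ -> _)) /= E; apply: gmap_ext => x.
  by have := congr1 (@^~ (g x)) E; rewrite /= gK.
- by move=> <- <-.
by move=> a b _ _ E; apply: phiI fb _ => x; rewrite -E.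
Qed.

(** A lift on a disjoint union is a pair of lifts, and a sum over pairs of products
    is a product of sums. *)
Lemma ghT_mult (t : gmap X Y) phi : iso_inv phi -> gmultiplicative phi ->
  gmultiplicative (ghT t phi).
Proof.
move=> phiI [phi0 phiM]; split=> [|S T s u]; rewrite /ghT.
  rewrite (big_pred1 (ginit X)) // => s.
  by apply/eqP/eqP => [_|_]; apply: gmap_ext; case.
rewrite big_distrlr /= pair_big /=; symmetry.
apply: (sum_correspondence (r := fun a b => gcopair a.1 a.2 = b))
  => [[a1 a2] /= /andP[/eqP <- /eqP <-]|b /eqP E|a b b' <- //|[a1 a2] [b1 b2] c <-|].
- by exists (gcopair a1 a2) => //; apply/eqP/gmap_ext; case.
- exists (gcomp b (ginl _ _), gcomp b (ginr _ _)); last by apply: gmap_ext; case.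
  by apply/andP; split; apply/eqP/gmap_ext => x /=;
    rewrite -[LHS]/((gcomp t b) _) E.
- move=> /(congr1 (fun h : gmap _ _ => h : _ -> _)) /= E.
  congr pair; apply: gmap_ext => x; first by have := congr1 (@^~ (inl x)) E.
  by have := congr1 (@^~ (inr x)) E.
by case=> a1 a2 b /= _ _ <-; rewrite phiM.
Qed.
End Closure.

Lemma ghB_id X (phi : ghost X) : iso_inv phi -> ghB (bispan_id X) phi = phi.
Proof. by move=> phiI; rewrite /ghB /= ghT_id ghR_id ghN_id. Qed.

Lemma ghB_R X Y (r : gmap Y X) (phi : ghost X) : iso_inv phi -> ghB (bispan_R r) phi = ghR r phi.
Proof. by move=> phiI; rewrite /ghB /= ghT_id ghN_id //; exact: ghR_iso_inv. Qed.

Lemma ghB_N X Y (n : gmap X Y) (phi : ghost X) : iso_inv phi -> ghB (bispan_N n) phi = ghN n phi.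
Proof. by move=> phiI; rewrite /ghB /= ghT_id ghR_id. Qed.

Lemma ghB_T X Y (t : gmap X Y) (phi : ghost X) : iso_inv phi -> ghB (bispan_T t) phi = ghT t phi.
Proof. by move=> phiI; rewrite /ghB /= ghR_id ghN_id. Qed.

Lemma ghB_iso X W (b c : bispan X W) (phi : ghost X) : iso_inv phi -> bispan_iso b c ->
  ghB b phi = ghB c phi.
Proof.
move=> phiI [f [g [fb gb fR fN ghT_]]]; apply: ghost_ext => T t.
have [g' [gK g'K]] := ginv_ex gb.
apply: (sum_correspondence (r := fun s s' => s' = gcomp g s)) => [s /eqP <-|s /eqP <-|s ? ? -> //|s s' ? ->|].
- by exists (gcomp g s) => //; apply/eqP/gmap_ext => x /=; rewrite -ghT_.
- exists (gcomp g' s); last by apply: gmap_ext => x /=; rewrite g'K.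
  by apply/eqP/gmap_ext => x /=; rewrite -ghT_ /= g'K.
- move=> /(congr1 (fun h : gmap _ _ => h : _ -> _)) /= E; apply: gmap_ext => x.
  by have /(bij_inj gb) := congr1 (@^~ x) E.
move=> s _ _ _ ->; rewrite /ghN /ghR.
have E (u : gpull s (bs_nm b)) :
    gcomp g s (gpull1 s (bs_nm b) u) = bs_nm c (gcomp f (gpull2 s (bs_nm b)) u).
  by rewrite /= gpullP -[LHS]/((g \o bs_nm b) _) -fN.
apply: (phiI (tpull s (bs_nm b)) (tpull (gcomp g s) (bs_nm c)) (gpull_lift E)); last first.
  by move=> u /=; rewrite -[LHS]/((bs_res c \o f) _) fR.
have [f' [fK f'K]] := ginv_ex fb.
apply: inj_surj_bij => [u v /(congr1 val)[uv1 uv2]|v].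
  by apply: gpull_inj => //; apply: (bij_inj fb).
have e : s (gpull1 _ _ v) = bs_nm b (f' (gpull2 _ _ v)).
  apply: (bij_inj gb); rewrite -[RHS]/((g \o bs_nm b) _) -fN /= f'K; exact: (gpullP v).
by exists (gpull_pt e); apply: gpull_inj => //=; rewrite f'K.
Qed.
End Ghosts.

(** * The ghost functor preserves composition of bispans *)

Section Composition.
Variables (gT : finGroupType) (G : {group gT}) (fam : family gT).
Implicit Types X Y Z W V A : gset G.
Implicit Types T S : tset G fam.

(** The adjunction between pullback along n and dependent product along n.  It is
    kept as a relation because the points of a dependent product are partial maps:
    neither direction is a total function on points. *)
Section Adjunction.
Variables (A Y Z T : gset G) (p : gmap A Y) (n : gmap Y Z) (s : gmap T Z).

Definition adjoint_maps (f : gmap (gpull s n) A) (g : gmap T (gdprod p n)) :=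
  (forall t, gdprod_base p n (g t) = s t) /\
  forall u, (val (g (gpull1 s n u))).2 (gpull2 s n u) = Some (f u).

Lemma gdprod_some (d : gdprod p n) y : n y = gdprod_base p n d ->
  exists2 a, (val d).2 y = Some a & p a = y.
Proof.
move=> ny; have /forallP/(_ y) := valP d.
case: ((val d).2 y) => [a /andP[_ /eqP pa]|]; first by exists a.
by rewrite -[(val d).1]/(gdprod_base p n d) ny eqxx.
Qed.

Lemma gdprod_none (d : gdprod p n) y : n y <> gdprod_base p n d -> (val d).2 y = None.
Proof.
move=> ny; have /forallP/(_ y) := valP d.
by case: ((val d).2 y) => // a /andP[/eqP].
Qed.

Lemma gdprod_inj (d d' : gdprod p n) : gdprod_base p n d = gdprod_base p n d' ->
    (forall y, n y = gdprod_base p n d -> (val d).2 y = (val d').2 y) -> d = d'.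
Proof.
move=> e E; apply: val_inj; have pairE (U V : Type) (a b : U * V) : a.1 = b.1 -> a.2 = b.2 -> a = b.
  by case: a b => [? ?] [? ?] /= -> ->.
apply: pairE; first exact: e.
apply/ffunP => y; case: (eqVneq (n y) (gdprod_base p n d)) => [/E //|/eqP ny].
by rewrite !gdprod_none // -e.
Qed.

Lemma gdprod_act_val (d : gdprod p n) a y : a \in G ->
  (val (gact _ d a)).2 y = omap (fun x => gact A x a) ((val d).2 (gact Y y a^-1%g)).
Proof. by move=> Ga; rewrite gsubE // gprodE //= gpfunE. Qed.

Lemma adjoint_section f g : adjoint_maps f g -> forall u, p (f u) = gpull2 s n u.
Proof.
move=> [gb ge] u; have [|a] := @gdprod_some (g (gpull1 s n u)) (gpull2 s n u).
  by rewrite gb gpullP.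
by rewrite ge => -[->].
Qed.

Lemma adjoint_uniqr f g g' : adjoint_maps f g -> adjoint_maps f g' -> g = g'.
Proof.
move=> [gb ge] [gb' ge']; apply: gmap_ext => t; apply: gdprod_inj; first by rewrite gb gb'.
move=> y; rewrite gb => e.
by have := ge (gpull_pt (esym e)); have := ge' (gpull_pt (esym e)) => /= -> ->.
Qed.

Lemma adjoint_uniql f f' g : adjoint_maps f g -> adjoint_maps f' g -> f = f'.
Proof. by move=> [_ ge] [_ ge']; apply: gmap_ext => u; have := ge u; rewrite ge' => -[]. Qed.

Lemma adjoint_exl (g : gmap T (gdprod p n)) : (forall t, gdprod_base p n (g t) = s t) ->
  exists f, adjoint_maps f g.
Proof.
move=> gb; have [||u a c Gc E|f fP] := @gmap_surj _ _ (gpull s n) A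
    (fun u a => (val (g (gpull1 s n u))).2 (gpull2 s n u) = Some a).
- move=> u; have [|a] := @gdprod_some (g (gpull1 s n u)) (gpull2 s n u).
    by rewrite gb gpullP.
  by exists a.
- by move=> u a b -> [].
- by rewrite !gmapP // gdprod_act_val // gactV // E.
by exists f.
Qed.

Lemma adjoint_exr (f : gmap (gpull s n) A) : (forall u, p (f u) = gpull2 s n u) ->
  exists g, adjoint_maps f g.
Proof.
move=> fp; have [|t d d' [e E] [e' E']|t d a Ga [e E]|g gP] := @gmap_surj _ _ T (gdprod p n)
    (fun t d => gdprod_base p n d = s t /\
      forall u, gpull1 s n u = t -> (val d).2 (gpull2 s n u) = Some (f u)).
- move=> t.
  pose d := (s t, [ffun y => omap f (insub (t, y) : option (gpull s n))]) :
    gprod Z (gpfun A Y).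
  have dP : is_section p n d.
    apply/forallP => y; rewrite ffunE; case: insubP => [u _ uE|] /=.
      by rewrite fp -[gpull2 s n u]/(val u).2 uE eqxx andbT eq_sym; have := valP u; rewrite /= uE.
    by rewrite eq_sym.
  exists (Sub d dP : gdprod p n); split=> // u ut; rewrite SubK ffunE -ut.
  have -> : (gpull1 s n u, gpull2 s n u) = val u by exact/esym/surjective_pairing.
  by rewrite valK.
- apply: gdprod_inj => [|y ny]; first by rewrite e.
  have e2 : s t = n y by rewrite ny.
  by have := E (gpull_pt e2) erefl; have := E' (gpull_pt e2) erefl => /= -> ->.
- split=> [|u ut]; first by rewrite !gmapP // e.
  rewrite gdprod_act_val //; have := E (gact _ u a^-1%g).
  by rewrite !gmapP ?groupV // ut gactV // => -> //=; rewrite gactVK.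
by exists g; split=> [t|u]; [have [] := gP t | have [_ ->] := gP (gpull1 s n u)].
Qed.
End Adjunction.

Section Evaluation.
Variables (A Y Z : gset G) (p : gmap A Y) (n : gmap Y Z).

Definition gdeval_pt : gmap (gdeval p n) Y :=
  gcomp (gfst _ _) (gcomp (gfst _ _) (gval (@gdeval_subproof _ _ _ _ _ p n))).

Lemma gdevalP (e : gdeval p n) :
  (val (gdeval_sec p n e)).2 (gdeval_pt e) = Some (gdeval_ev p n e).
Proof. exact/eqP/(valP e). Qed.

Lemma gdeval_over (e : gdeval p n) : n (gdeval_pt e) = gdprod_base p n (gdeval_sec p n e).
Proof.
apply/eqP/negPn/negP => /eqP /gdprod_none; by rewrite gdevalP.
Qed.

Lemma gdeval_inj (e e' : gdeval p n) : gdeval_pt e = gdeval_pt e' ->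
  gdeval_sec p n e = gdeval_sec p n e' -> e = e'.
Proof.
move=> Ep Es; have := gdevalP e; rewrite Ep Es gdevalP => -[Ev].
by case: e e' Ep Es Ev => -[[y d] a] v [[[y' d'] a'] v'] /= *; apply: val_inj => /=; congr ((_, _), _).
Qed.

Lemma gdeval_mk y (d : gdprod p n) a : (val d).2 y = Some a ->
  exists e, [/\ gdeval_pt e = y, gdeval_sec p n e = d & gdeval_ev p n e = a].
Proof. by move=> /eqP dy; exists (Sub (y, d, a) dy). Qed.
End Evaluation.

(** On both sides phi is evaluated at pullbacks of T, and the sums are indexed by
    adjoint data: a lift of T to the dependent product is a lift s' to Z' with a map
    from the pullback T x_Z' Y' to Z over W.  For corresponding indices the
    pullbacks agree by pasting. *)
Lemma ghB_comp X W V (b : bispan X W) (c : bispan W V) (phi : ghost fam X) :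
  iso_inv phi -> ghB (bispan_comp b c) phi = ghB c (ghB b phi).
Proof.
move=> phiI; apply: ghost_ext => T v.
case: b c => [Y Z rb nb tb] [Y' Z' rc nc tc].
rewrite /ghB /ghT /ghN /ghR /=.
set pr1 := gpull1 tb rc; set pr2 := gpull2 tb rc.
pose D := gdprod pr2 nc.
(* Sort the lifts of T to the dependent product by their images in Z'. *)
rewrite (partition_big (fun s : gmap T D => gcomp (gdprod_base pr2 nc) s)
  (fun s' => gcomp tc s' == v)) /=; last by move=> s /eqP <-; apply/eqP/gmap_ext.
apply: eq_bigr => s' /eqP sv.
apply: esym. refine (sum_correspondence (r := fun (r : gmap (tpull s' nc) Z) (s : gmap T D) =>
   exists2 a : gmap (gpull s' nc) (gpull tb rc), adjoint_maps a s & gcomp pr1 a = r) _ _ _ _ _).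
- move=> r /eqP E; have aP u : tb (r u) = rc (gpull2 s' nc u).
    by rewrite -[LHS]/(gcomp tb r u) E.
  have [|s ss] := adjoint_exr (p := pr2) (n := nc) (f := gpull_lift aP); first by [].
  exists s; last by exists (gpull_lift aP) => //; apply: gmap_ext.
  have E2 : gcomp (gdprod_base pr2 nc) s = s' by apply: gmap_ext; have [] := ss.
  by rewrite E2 eqxx -sv -E2 andbT; apply/eqP/gmap_ext.
- move=> s /andP[_ /eqP E].
  have [|a sa] := adjoint_exl (p := pr2) (n := nc) (s := s') (g := s).
    by move=> t; rewrite -E.
  exists (gcomp pr1 a); last by exists a.
  apply/eqP/gmap_ext => u; rewrite -[RHS]/(rc (gpull2 s' nc u)) -(adjoint_section sa u); exact: gpullP.
- move=> r s s2 [a sa ar] [a2 sa2 ar2].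
  suff E : a = a2 by move: sa2; rewrite -E; exact: adjoint_uniqr sa.
  apply: gmap_ext => u; apply: gpull_inj.
    by rewrite -[LHS]/(gcomp pr1 a u) ar -ar2.
  by rewrite -/pr2 (adjoint_section sa) (adjoint_section sa2).
- by move=> r r2 s [a sa <-] [a2 sa2 <-]; rewrite (adjoint_uniql sa sa2).
move=> r s _ _ [a [sb se] ar].
set e1 := gpull2 nb (gcomp pr1 (gdeval_ev pr2 nc)).
set y1 := gpull1 nb (gcomp pr1 (gdeval_ev pr2 nc)).
set m := gcomp (gdeval_sec pr2 nc) e1.
have sE (w : gpull s m) : s (gpull1 s m w) = gdeval_sec pr2 nc (e1 (gpull2 s m w)).
  exact: gpullP.
have uP (w : gpull s m) :
    s' (gpull1 s m w) = nc (gcomp (gdeval_pt pr2 nc) (gcomp e1 (gpull2 s m)) w).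
  by rewrite -sb sE -gdeval_over.
have uE (w : gpull s m) : a (gpull_lift uP w) = gdeval_ev pr2 nc (e1 (gpull2 s m w)).
  have := se (gpull_lift uP w).
  by rewrite /= -/(gpull1 s m w) sE => E; have := gdevalP (e1 (gpull2 s m w)); rewrite E => -[].
have rP (w : gpull s m) : r (gpull_lift uP w) = nb (gcomp y1 (gpull2 s m) w).
  rewrite -ar -[LHS]/(pr1 (a (gpull_lift uP w))) uE.
  by have := gpullP (gpull2 s m w) => /= ->.
symmetry; apply: (phiI (tpull s m) (tpull (T := tpull s' nc) r nb) (gpull_lift rP)); last by [].
apply: inj_surj_bij => [w w' E | x].
  have Eu := congr1 (gpull1 _ _) E; have Ey := congr1 (gpull2 _ _) E.
  have Et : gpull1 s m w = gpull1 s m w' := congr1 (gpull1 _ _) Eu.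
  have Ep := congr1 (gpull2 _ _) Eu.
  apply: gpull_inj => //; apply: gpull_inj; first exact: Ey.
  by apply: gdeval_inj; [exact: Ep | rewrite -!sE Et].
set u := gpull1 r nb x; set y := gpull2 r nb x.
have [e [ep es ee]] := gdeval_mk (se u).
have nye : nb y = gcomp pr1 (gdeval_ev pr2 nc) e.
  rewrite -[RHS]/(pr1 (gdeval_ev pr2 nc e)) ee -[RHS]/(gcomp pr1 a u) ar.
  exact/esym/gpullP.
have ste : s (gpull1 s' nc u) = m (gpull_pt nye) by rewrite -[RHS]/(gdeval_sec pr2 nc e) es.
exists (gpull_pt ste); apply: gpull_inj; last by [].
by apply: gpull_inj; [| rewrite -[LHS]/(gdeval_pt pr2 nc e) ep].
Qed.
End Composition.

(** * Extrapolation *)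

Lemma size_difference (R : idomainType) (p : {poly R}) :
  (size (p - (p \Po ('X + 1%:P)))%R <= (size p).-1)%N.
Proof.
have [->|p0] := eqVneq p 0; first by rewrite comp_poly0 subr0 size_poly0.
have sX : size ('X + 1%:P : {poly R}) = 2 by rewrite size_XaddC.
have sp : size (p \Po ('X + 1%:P)) = size p by rewrite size_comp_poly2.
have : (0 < size p)%N by rewrite size_poly_gt0.
case E : (size p) => [//|m] _ /=.
apply/leq_sizeP => j; rewrite leq_eqVlt => /orP[/eqP <-|mj]; last first.
  by rewrite coefB !nth_default ?subr0 // ?sp E.
have := lead_coef_comp p (q := 'X + 1%:P); rewrite sX lead_coefXaddC expr1n mulr1 => /(_ isT).
by rewrite /lead_coef sp E /= => e; rewrite coefB e subrr.
Qed.

Lemma alternating_sumS (R : pzRingType) n (f : nat -> R) :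
  \sum_(i < n.+2) (-1) ^+ i * f i *+ 'C(n.+1, i) =
  \sum_(i < n.+1) (-1) ^+ i * (f i - f i.+1) *+ 'C(n, i).
Proof.
rewrite big_ord_recl /= bin0 mulr1n.
under eq_bigr do rewrite /bump /= add1n binS mulrnDr.
under [RHS]eq_bigr do rewrite mulrBr mulrnBl.
rewrite big_split sumrB /= addrA; congr (_ + _).
  rewrite [RHS]big_ord_recl /= bin0 mulr1n; congr (_ + _).
  by rewrite big_ord_recr /= bin_small // mulr0n addr0.
rewrite -sumrN; apply: eq_bigr => i _.
by rewrite exprS -mulrA mulN1r mulNrn.
Qed.

Lemma finite_difference (R : idomainType) n (p : {poly R}) x : (size p <= n)%N ->
  \sum_(i < n.+1) (-1) ^+ i * p.[x + i%:R] *+ 'C(n, i) = 0.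
Proof.
elim: n p x => [|n IHn] p x sp.
  move: sp; rewrite leqn0 size_poly_eq0 => /eqP ->.
  by rewrite big_ord_recl big_ord0 horner0 mulr0 mul0rn addr0.
rewrite (alternating_sumS n (fun i => p.[x + i%:R])).
rewrite -[RHS](IHn (p - (p \Po ('X + 1%:P))) x); last by have := size_difference p; lia.
apply: eq_bigr => i _; rewrite hornerD hornerN horner_comp hornerD hornerX hornerC.
by rewrite -addrA natr1.
Qed.

(** The vanishing of the difference of order n + 1 based at -1, solved for the term
    at -1. *)
Lemma extrapolate (R : idomainType) n (p : {poly R}) : (size p <= n.+1)%N ->
  p.[-1] = \sum_(j < n.+1) (-1) ^+ j * p.[j%:R] *+ 'C(n.+1, j.+1).
Proof.
move=> sp; have := finite_difference (-1) sp.
rewrite big_ord_recl /= bin0 mulr1n expr0 mul1r addr0 => /eqP; rewrite addr_eq0 => /eqP ->.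
rewrite -sumrN; apply: eq_bigr => i _; rewrite /bump /= add1n.
by rewrite exprS -mulrA mulN1r mulNrn opprK -natr1 addrCA addNr addr0.
Qed.

(** When every value of a is one of the powers s^i with i < n, the product of the
    s^i - a vanishes, and then a times this quotient is a power of s. Being an
    integral polynomial in a, the quotient stays in any subring containing a. *)
Fixpoint power_quotient (R : comPzRingType) (s : nat) (a : R) n : R :=
  if n is m.+1 then power_quotient s a m * ((s ^ m)%:R - a) + (s ^ 'C(m, 2))%:R else 0.

Lemma power_quotientE (R : comPzRingType) (s : nat) (a : R) n :
  \prod_(i < n) ((s ^ i)%:R - a) = (s ^ 'C(n, 2))%:R - a * power_quotient s a n.
Proof.
elim: n => [|n IHn]; first by rewrite big_ord0 mulr0 subr0.
by rewrite big_ord_recr /= IHn binS bin1 expnD natrM; ring.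
Qed.

(** * Orbits and the ghosts of G-sets *)

Section Orbits.
Variables (gT : finGroupType) (G : {group gT}) (fam : family gT).
Implicit Types X Y Z U V W : gset G.
Implicit Types S T : tset G fam.

Definition transitive_at X (x : X) := forall y, exists2 a, a \in G & gact X x a = y.
Definition is_orbit X := exists x : X, transitive_at x.

Lemma transitive_any X (x y : X) : transitive_at x -> transitive_at y.
Proof.
move=> tx z; have [a Ga <-] := tx z; have [b Gb <-] := tx y.
by exists (b^-1 * a)%g; rewrite ?groupM ?groupV // -gactM ?groupM ?groupV // mulKVg.
Qed.

(** A decomposition is recorded through its effect on ghosts, which is all that is
    used, and not as an isomorphism with a disjoint union. *)
Definition orbit_decomposition X S (s : gmap S X) n (o : nat -> {T : tset G fam & gmap T X}) :=
  (forall i, (i < n)%N -> is_orbit (projT1 (o i))) /\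
  forall phi : ghost fam X, iso_inv phi -> gmultiplicative phi ->
    phi S s = \prod_(i < n) phi (projT1 (o i)) (projT2 (o i)).

(** Split off the orbits one at a time; each of them uses up a point of D.  The bound
    by a set D meeting all orbits is what later bounds the degree of a norm by the
    size of a fibre, independently of T. *)
Lemma orbit_decomposition_ex X S (s : gmap S X) (D : pred S) :
    (forall x : S, exists2 a, a \in G & D (gact S x a)) ->
  exists n o, (n <= #|D|)%N /\ orbit_decomposition s n o.
Proof.
have [m] := ubnP #|S|; elim: m S s D => // m IHm S s D leSm Dmeet.
have [x _|S0] := pickP (mem S); last first.
  exists 0%N, (fun=> existT _ (tempty G fam) (ginit X)); split=> //; split=> // phi phiI phiM.
  rewrite big_ord0 -phiM.1.
  have noS (x : S) : False by have := S0 x.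
  symmetry; apply: (phiI (tempty G fam) S (ginit S)); last by case.
  by apply: inj_surj_bij; [case | move=> x; case: (noS x)].
set O : tset G fam := tover (gval (@orbit_inv _ _ S x)).
set C : tset G fam := tover (gval (@orbitC_inv _ _ S x)).
pose sO : gmap O X := gcomp s (gval (@orbit_inv _ _ S x)).
pose sC : gmap C X := gcomp s (gval (@orbitC_inv _ _ S x)).
have cardC : (#|C| < m)%N.
  apply: leq_trans (_ : #|S| <= m)%N => //; rewrite card_sig; apply: proper_card.
  apply/properP; split; first exact/subsetP.
  by exists x => //; rewrite inE negbK orbit_refl.
have [|n [o [leD [oO oP]]]] := IHm C sC (fun u => D (val u)) cardC.
  move=> u; have [a Ga Da] := Dmeet (val u); exists a => //.
  by have -> := @gsubE _ _ _ _ (@orbitC_inv _ _ S x) u a Ga.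
exists n.+1, (fun i => if i is j.+1 then o j else existT _ O sO); split; last split.
- have [a Ga Da] := Dmeet x.
  have : (#|[pred u : C | D (val u)]| <= #|[predD1 D & gact S x a]|)%N.
    rewrite -(card_image (f := val : C -> S) val_inj).
    apply: subset_leq_card; apply/subsetP => y /imageP[u Du ->]; rewrite !inE.
    apply/andP; split=> //; apply/eqP => E; have := valP u; rewrite /= E.
    by rewrite mem_orbit.
  have -> : #|D| = (1 + #|[predD1 D & gact S x a]|)%N.
    by rewrite (cardD1 (gact S x a)) -[gact S x a \in D]/(D _) Da.
  by rewrite add1n ltnS; exact: leq_trans.
- case=> [_|i]; last exact: oO.
  exists (Sub x (orbit_refl _ _ _) : gorbit x) => y.
  have /orbitP[a Ga xa] := valP y; exists a => //; apply: val_inj.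
  by rewrite gsubE.
move=> phi phiI phiM; rewrite big_ord_recl /= -(oP phi phiI phiM) -phiM.2.
symmetry; apply: (phiI (tsum O C) S
  (gcopair (gval (@orbit_inv _ _ S x)) (gval (@orbitC_inv _ _ S x)))); last by case.
apply: inj_surj_bij.
  case=> u [] v //= uv; try by congr (_ _); exact: val_inj.
    by have := valP v; rewrite /= -uv (valP u).
  by have := valP u; rewrite /= uv (valP v).
move=> y; case yO : (y \in orbit (gaction S) G x); first by exists (inl (Sub y yO)).
by exists (inr (Sub y (negbT yO))).
Qed.

Lemma orbit_decomposition_all X S (s : gmap S X) :
  exists n o, (n <= #|S|)%N /\ orbit_decomposition s n o.
Proof.
have [|n [o [len oP]]] := @orbit_decomposition_ex X S s predT; last by exists n, o.
by move=> x; exists 1%g => //; exact: group1.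
Qed.

Lemma ghost_orbits X (phi psi : ghost fam X) :
    iso_inv phi -> gmultiplicative phi -> iso_inv psi -> gmultiplicative psi ->
    (forall T t, is_orbit T -> phi T t = psi T t) -> phi = psi.
Proof.
move=> phiI phiM psiI psiM E; apply: ghost_ext => S s.
have [n [o [_ [oO oP]]]] := orbit_decomposition_all s.
by rewrite !oP //; apply: eq_bigr => i _; rewrite E //; apply: oO.
Qed.

(** ** Counting maps into a G-set over X *)
Definition over X := {U : gset G & gmap U X}.


(** The transfer of the constant ghost 1 counts lifts; seen this way, the number of
    maps inherits invariance and multiplicativity from [ghT]. *)
Definition homs X (A : over X) : ghost fam X := ghT (projT2 A) (fun _ _ => 1).

Lemma homsE X (A : over X) (T : tset G fam) (t : gmap T X) :
  homs A t = #|[pred f : gmap T (projT1 A) | gcomp (projT2 A) f == t]|%:R.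
Proof. by rewrite /homs /ghT -sum1_card natr_sum. Qed.

Lemma homs_iso_inv X (A : over X) : iso_inv (homs A).
Proof. exact: ghT_iso_inv. Qed.

Lemma homs_mult X (A : over X) : gmultiplicative (homs A).
Proof. by apply: ghT_mult => //; split=> // *; rewrite mulr1. Qed.

(** A map out of an orbit is determined by the image of the base point x, which can
    be any point over t x that is fixed by the stabilizer of x. *)
Lemma homs_orbit X (A : over X) T (t : gmap T X) x : transitive_at x ->
  homs A t = #|[pred u | (projT2 A u == t x) && (gstab x \subset gstab u)]|%:R.
Proof.
case: A => U p /= tx; rewrite homsE; congr _%:R.
apply: (card_correspondence (r := fun (f : gmap T U) u => f x = u)) => /=.
- move=> f /eqP E; exists (f x) => //; rewrite -E eqxx; exact: gstab_gmap.
- move=> u /andP[/eqP pu sxu].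
  have [||y v a Ga [b Gb [<- <-]]|f fP] := @gmap_surj _ _ T U
      (fun y v => exists2 a, a \in G & gact T x a = y /\ gact U u a = v).
  + by move=> y; have [a Ga <-] := tx y; exists (gact U u a), a.
  + move=> y v w [a Ga [ya <-]] [b Gb [yb <-]].
    have : (a * b^-1)%g \in gstab x.
      apply/gstabP; rewrite groupM ?groupV // gactM ?groupV // ya -yb.
      by rewrite gactV.
    move/(subsetP sxu)/gstabP => [_]; rewrite gactM ?groupV // => E.
    by rewrite -{2}E gactVK.
  + by exists (b * a)%g; rewrite ?groupM // !gactM.
  exists f; first by apply/eqP/gmap_ext => y /=; have [a Ga [<- <-]] := fP y; rewrite !gmapP // pu.
  have [a Ga [xa ua]] := fP x; rewrite -ua.
  by have /gstabP[] : a \in gstab u by apply: (subsetP sxu); apply/gstabP.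
- by move=> f u v -> ->.
move=> f g u fx gx; apply: gmap_ext => y; have [a Ga <-] := tx y.
by rewrite !gmapP // fx gx.
Qed.

Definition oone X : over X := existT _ X (gid X).
Definition ozero X : over X := existT _ (gempty G) (ginit X).
Definition oadd X (A B : over X) : over X := existT _ _ (gcopair (projT2 A) (projT2 B)).
Definition omuln X (A : over X) n : over X := iter n (oadd A) (ozero X).
Definition omul X (A B : over X) : over X :=
  existT _ (gpull (projT2 A) (projT2 B)) (gcomp (projT2 A) (gpull1 (projT2 A) (projT2 B))).

Lemma homs_one X T (t : gmap T X) : homs (oone X) t = 1.
Proof.
by rewrite homsE (eq_card1 (x := t)) // => s; rewrite inE /= gcomp1g.
Qed.

Lemma homs_zero X T (t : gmap T X) : is_orbit T -> homs (ozero X) t = 0.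
Proof. by move=> [x tx]; rewrite (homs_orbit _ _ tx) eq_card0 //; case. Qed.

Lemma homs_add X (A B : over X) T (t : gmap T X) : is_orbit T ->
  homs (oadd A B) t = homs A t + homs B t.
Proof.
move=> [x tx]; rewrite !(homs_orbit _ _ tx) -natrD; congr _%:R.
rewrite -!sum1_card big_sumType /=; congr (_ + _)%N; apply: eq_bigl => u;
  rewrite !inE; congr (_ && _); apply/eq_subset_r => a; apply/gstabP/gstabP => -[Ga E];
  by split=> //; move: E; rewrite gsumE //=; first [by case | by move=> ->].
Qed.

Lemma homs_muln X (A : over X) n T (t : gmap T X) : is_orbit T ->
  homs (omuln A n) t = homs A t *+ n.
Proof.
move=> tO; elim: n => [|n IHn]; first by rewrite homs_zero.
by rewrite /omuln iterS homs_add // IHn mulrS.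
Qed.

Lemma homs_mul X (A B : over X) T (t : gmap T X) : homs (omul A B) t = homs A t * homs B t.
Proof.
case: A B => [U p] [V q]; rewrite /homs /ghT big_distrlr /= pair_big /=.
apply: (sum_correspondence (r := fun f gh => gcomp (gpull1 p q) f = gh.1 /\ gcomp (gpull2 p q) f = gh.2)).
- move=> f /eqP E; exists (gcomp (gpull1 p q) f, gcomp (gpull2 p q) f) => //=.
  rewrite gcompA E eqxx; apply/eqP/gmap_ext => x /=.
  by rewrite -gpullP -[LHS]/(gcomp (gcomp p (gpull1 p q)) f x) E.
- move=> [g h] /= /andP[/eqP gt /eqP ht].
  have E x : p (g x) = q (h x) by rewrite -[LHS]/(gcomp p g x) gt -ht.
  by exists (gpull_lift E); [apply/eqP; rewrite -gt; exact: gmap_ext | split; exact: gmap_ext].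
- by move=> f [g h] [g' h'] /= [<- <-] [<- <-].
- move=> f f' gh [<- <-] [E1 E2]; apply: gmap_ext => x; apply: gpull_inj.
    by rewrite -[RHS]/(gcomp _ f' x) E1.
  by rewrite -[RHS]/(gcomp _ f' x) E2.
by move=> *; rewrite mulr1.
Qed.

(** The universal properties of composition, pullback and dependent product say that
    the operations on ghosts extend those on G-sets over X. *)
Definition otr X Y (f : gmap X Y) (A : over X) : over Y := existT _ _ (gcomp f (projT2 A)).
Definition ores X Y (f : gmap Y X) (A : over X) : over Y :=
  existT _ (gpull f (projT2 A)) (gpull1 f (projT2 A)).
Definition onm X Y (f : gmap X Y) (A : over X) : over Y :=
  existT _ _ (gdprod_base (projT2 A) f).

Lemma homs_tr X Y (f : gmap X Y) (A : over X) : homs (otr f A) = ghT f (homs A).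
Proof.
apply: ghost_ext => T t; rewrite /homs /ghT /=.
rewrite (partition_big (fun s => gcomp (projT2 A) s) (fun s => gcomp f s == t)) /=.
  apply: eq_bigr => s /eqP E; apply: eq_bigl => g.
  apply/andP/idP => [[]//|/eqP gs]; split; last exact/eqP.
  by rewrite -gcompA gs E.
by move=> s; rewrite gcompA.
Qed.

Lemma homs_res X Y (f : gmap Y X) (A : over X) : homs (ores f A) = ghR f (homs A).
Proof.
apply: ghost_ext => T t; rewrite /homs /ghR /ghT.
case: A => U p /=.
apply: (sum_correspondence
  (r := fun g h => gcomp (gpull2 f p) g = h /\ gcomp (gpull1 f p) g = t)) => //.
- move=> g /eqP E; exists (gcomp (gpull2 f p) g) => //; apply/eqP/gmap_ext => x /=.
  by rewrite -[RHS]/(f (t x)) -E -[LHS]/(p (gpull2 f p (g x))) -gpullP.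
- move=> h /eqP E.
  have E' x : f (t x) = p (h x) by rewrite -[RHS]/(gcomp p h x) E.
  by exists (gpull_lift E'); [apply/eqP | split]; exact: gmap_ext.
- by move=> g h h' [<- _] [<- _].
move=> g g' h [E1 E2] [E1' E2']; apply: gmap_ext => x; apply: gpull_inj.
  by rewrite -[LHS]/(gcomp _ g x) E2 -E2'.
by rewrite -[LHS]/(gcomp _ g x) E1 -E1'.
Qed.

Lemma homs_nm X Y (f : gmap X Y) (A : over X) : homs (onm f A) = ghN f (homs A).
Proof.
apply: ghost_ext => T t; rewrite /homs /ghN /ghT.
case: A => U p /=; symmetry.
apply: (sum_correspondence (r := fun (g : gmap (tpull t f) U) h => @adjoint_maps _ _ U X Y T p f t g h)) => //.
- move=> g /eqP E; have [|h hg] := adjoint_exr (p := p) (n := f) (f := g).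
    by move=> u; rewrite -[LHS]/(gcomp p g u) E.
  by exists h => //; apply/eqP/gmap_ext; have [] := hg.
- move=> h /eqP E; have [|g gh] := adjoint_exl (p := p) (n := f) (s := t) (g := h).
    by move=> u; rewrite -E.
  by exists g => //; apply/eqP/gmap_ext => u; exact: (adjoint_section gh).
- by move=> g h h'; exact: adjoint_uniqr.
by move=> g g' h; exact: adjoint_uniql.
Qed.
End Orbits.

(** * Rational ghosts *)

Section Rational.
Variables (gT : finGroupType) (G : {group gT}) (fam : family gT) (P : nat_pred).
Implicit Types X Y Z U V W : gset G.
Implicit Types S T : tset G fam.

(** Only the values on orbits are compared: on a G-set with several orbits the
    multiplicative ghost of a difference is not a difference of ghosts. *)
Definition integral X (f : ghost fam X) :=
  exists A B : over X, forall T (t : gmap T X), is_orbit T -> f T t = homs A t - homs B t.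

Definition rational X (f : ghost fam X) :=
  exists s : nat, P^'.-nat s /\ integral (fun T t => s%:R * f T t).

Section Integral.
Variable X : gset G.
Implicit Types f g : ghost fam X.

Lemma integral_homs (A : over X) : integral (homs A).
Proof. by exists A, (ozero X) => T t tO; rewrite homs_zero // subr0. Qed.

Lemma integral_eq f g : (forall T t, is_orbit T -> f T t = g T t) -> integral f -> integral g.
Proof. by move=> E [A [B fE]]; exists A, B => T t tO; rewrite -E ?fE. Qed.

Lemma integralD f g : integral f -> integral g -> integral (fun T t => f T t + g T t).
Proof.
move=> [A [B fE]] [A' [B' gE]]; exists (oadd A A'), (oadd B B') => T t tO.
by rewrite fE // gE // !homs_add //; ring.
Qed.

Lemma integralN f : integral f -> integral (fun T t => - f T t).
Proof. by move=> [A [B fE]]; exists B, A => T t tO; rewrite fE // opprB. Qed.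

Lemma integralM f g : integral f -> integral g -> integral (fun T t => f T t * g T t).
Proof.
move=> [A [B fE]] [A' [B' gE]].
exists (oadd (omul A A') (omul B B')), (oadd (omul A B') (omul B A')) => T t tO.
by rewrite fE // gE // !homs_add // !homs_mul; ring.
Qed.

Lemma integral_nat n : integral (X := X) (fun T t => n%:R).
Proof.
apply: integral_eq (integral_homs (omuln (oone X) n)) => T t tO.
by rewrite homs_muln // homs_one.
Qed.

Lemma integral_int (z : int) : integral (X := X) (fun T t => z%:~R).
Proof.
case: z => n; first exact: integral_nat.
apply: integral_eq (integralN (integral_nat n.+1)) => T t tO.
by rewrite NegzE mulrNz.
Qed.

Lemma integral_sum (I : Type) (r : seq I) (F : I -> ghost fam X) :
  (forall i, integral (F i)) -> integral (fun T t => \sum_(i <- r) F i T t).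
Proof.
move=> FI; elim: r => [|i r IHr].
  by apply: integral_eq (integral_nat 0) => T t _; rewrite big_nil.
by apply: integral_eq (integralD (FI i) IHr) => T t _; rewrite big_cons.
Qed.

Lemma integral_power_quotient f s n :
  integral f -> integral (fun T t => power_quotient s (f T t) n).
Proof.
move=> fI; elim: n => [|n IHn]; first exact: (integral_nat 0).
exact (integralD (integralM IHn (integralD (integral_nat (s ^ n)) (integralN fI)))
  (integral_nat (s ^ 'C(n, 2)))).
Qed.

Lemma rational_eq f g : (forall T t, is_orbit T -> f T t = g T t) -> rational f -> rational g.
Proof.
move=> E [s [Ps fI]]; exists s; split=> //.
by apply: integral_eq fI => T t tO; rewrite E.
Qed.

Lemma integral_rational f : integral f -> rational f.
Proof. by move=> fI; exists 1%N; split=> //; apply: integral_eq fI => T t _; rewrite mul1r. Qed.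

Lemma rationalD f g : rational f -> rational g -> rational (fun T t => f T t + g T t).
Proof.
move=> [s [Ps fI]] [r [Pr gI]]; exists (s * r)%N; split; first by rewrite pnatM Ps.
apply: integral_eq (integralD (integralM (integral_nat r) fI) (integralM (integral_nat s) gI)).
by move=> T t _ /=; rewrite natrM; ring.
Qed.

Lemma rationalN f : rational f -> rational (fun T t => - f T t).
Proof.
move=> [s [Ps fI]]; exists s; split=> //.
by apply: integral_eq (integralN fI) => T t _; rewrite mulrN.
Qed.

Lemma pnat_gt0 s : P^'.-nat s -> (s%:R : rat) != 0.
Proof. by move=> /andP[]; rewrite pnatr_eq0 -lt0n. Qed.
End Integral.

Lemma integral_ghR X Y (r : gmap Y X) (f : ghost fam X) : integral f -> integral (ghR r f).
Proof.
move=> [A [B fE]]; exists (ores r A), (ores r B) => T t tO.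
by rewrite !homs_res /ghR fE.
Qed.

Lemma integral_ghT X Y (r : gmap X Y) (f : ghost fam X) : integral f -> integral (ghT r f).
Proof.
move=> [A [B fE]]; exists (otr r A), (otr r B) => T t tO.
by rewrite !homs_tr /ghT -sumrB; apply: eq_bigr => s _; exact: fE.
Qed.

Lemma rational_ghR X Y (r : gmap Y X) (f : ghost fam X) : rational f -> rational (ghR r f).
Proof.
by move=> [s [Ps fI]]; exists s; split=> //; apply: integral_eq (integral_ghR r fI).
Qed.

Lemma rational_ghT X Y (r : gmap X Y) (f : ghost fam X) : rational f -> rational (ghT r f).
Proof.
move=> [s [Ps fI]]; exists s; split=> //; apply: integral_eq (integral_ghT r fI) => T t _.
by rewrite /ghT mulr_sumr.
Qed.

(** ** Extension of differences by extrapolation *)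

(** On a G-set with n orbits o_i the number of maps into A + jB is the product of the
    u(o_i) + v(o_i) j, a polynomial in j of degree at most n. *)
Lemma homs_extrapolate X (u v : ghost fam X) (C : nat -> over X) S (t : gmap S X) n o N :
    (forall j T (t : gmap T X), is_orbit T -> homs (C j) t = u T t + v T t *+ j) ->
    orbit_decomposition t n o -> (n <= N)%N ->
  \sum_(j < N.+1) (-1) ^+ j * homs (C j) t *+ 'C(N.+1, j.+1) =
  \prod_(i < n) (u (projT1 (o i)) (projT2 (o i)) - v (projT1 (o i)) (projT2 (o i))).
Proof.
move=> CE [oO oP] nN.
pose p := \prod_(i < n) ((u (projT1 (o i)) (projT2 (o i)))%:P +
  v (projT1 (o i)) (projT2 (o i)) *: 'X).
have sp : (size p <= N.+1)%N.
  rewrite -ltnS; apply: leq_ltn_trans (size_prod_leq _ _) _.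
  rewrite cardT size_enum_ord.
  have : (\sum_(i < n) size ((u (projT1 (o i)) (projT2 (o i)))%:P +
      v (projT1 (o i)) (projT2 (o i)) *: 'X)%R <= \sum_(i < n) 2)%N.
    apply: leq_sum => i _; apply: leq_trans (size_polyD _ _) _.
    rewrite geq_max (leq_trans (size_polyC_leq1 _)) //=.
    by rewrite (leq_trans (size_scale_leq _ _)) // size_polyX.
  rewrite sum_nat_const card_ord -ltnS => h.
  by apply: leq_ltn_trans (leq_sub2r n h) _; lia.
transitivity p.[-1].
  rewrite (extrapolate sp); apply: eq_bigr => j _; congr (_ * _ *+ _).
  rewrite oP; [|exact: homs_iso_inv|exact: homs_mult].
  rewrite horner_prod; apply: eq_bigr => i _.
  rewrite CE; last exact: oO.
  by rewrite !hornerE mulr_natr.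
by rewrite horner_prod; apply: eq_bigr => i _; rewrite !hornerE mulrN1.
Qed.

Lemma homs_difference X (A B : over X) S (t : gmap S X) n o N :
    orbit_decomposition t n o -> (n <= N)%N ->
  \sum_(j < N.+1) (-1) ^+ j * homs (oadd A (omuln B j)) t *+ 'C(N.+1, j.+1) =
  \prod_(i < n) (homs A (projT2 (o i)) - homs B (projT2 (o i))).
Proof.
move=> od nN; apply: (@homs_extrapolate X (homs A) (homs B) (fun j => oadd A (omuln B j))
  S t n o N _ od nN) => j T u uO.
by rewrite homs_add // homs_muln.
Qed.

Lemma homs_const X s S (t : gmap S X) n o : orbit_decomposition t n o ->
  homs (omuln (oone X) s) t = s%:R ^+ n.
Proof.
move=> [oO oP]; rewrite oP; [|exact: homs_iso_inv|exact: homs_mult].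
rewrite -[n in RHS]card_ord -prodr_const; apply: eq_bigr => i _.
by rewrite homs_muln ?homs_one //; exact: oO.
Qed.

Lemma orbit_decomposition_sum X S T (s : gmap S X) (t : gmap T X) n o m o' :
    orbit_decomposition s n o -> orbit_decomposition t m o' ->
  @orbit_decomposition _ _ _ X (tsum S T) (gcopair s t) (n + m)
    (fun i => if (i < n)%N then o i else o' (i - n)%N).
Proof.
move=> [oO oP] [oO' oP']; split=> [i|phi phiI phiM].
  by case: ifP => [lt _|ge lt]; [exact: oO | apply: oO'; lia].
rewrite phiM.2 (oP _ phiI phiM) (oP' _ phiI phiM) big_split_ord /=.
by congr (_ * _); apply: eq_bigr => i _; rewrite ?ltn_ord // ltnNge leq_addr /= addKn.
Qed.

Lemma orbit_decomposition_orbit X S (s : gmap S X) : is_orbit S ->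
  orbit_decomposition s 1 (fun=> existT _ S s).
Proof. by move=> sO; split=> // phi _ _; rewrite big_ord1. Qed.

Definition wf_ghost X (phi : ghost fam X) :=
  [/\ iso_inv phi, gmultiplicative phi & rational phi].

(** The extension is the product of the values of f over the orbits.  Extrapolation
    expresses this product through numbers of maps, hence without a choice of a
    decomposition, which makes invariance evident. *)
Lemma ghost_extension X (f : ghost fam X) : rational f ->
  exists2 phi, wf_ghost phi & forall T t, is_orbit T -> phi T t = f T t.
Proof.
move=> fR; have [s [Ps [A [B fE]]]] := fR; have s0 := pnat_gt0 Ps.
pose phi : ghost fam X := fun S t =>
  (\sum_(j < #|S|.+1) (-1) ^+ j * homs (oadd A (omuln B j)) t *+ 'C(#|S|.+1, j.+1))
  / homs (omuln (oone X) s) t.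
have phiE S (t : gmap S X) n o : orbit_decomposition t n o -> (n <= #|S|)%N ->
    phi S t = \prod_(i < n) f (projT1 (o i)) (projT2 (o i)).
  move=> od nS; rewrite /phi (homs_difference _ _ od nS) (homs_const s od).
  rewrite -[n in s%:R ^+ n]card_ord -prodr_const -prodf_div; apply: eq_bigr => i _.
  rewrite -fE; last by apply: od.1.
  by rewrite [_ * f _ _]mulrC mulfK.
have phiO T (t : gmap T X) : is_orbit T -> phi T t = f T t.
  move=> tO; rewrite (phiE _ _ _ _ (orbit_decomposition_orbit t tO)) ?big_ord1 //.
  by have [x _] := tO; apply/card_gt0P; exists x.
exists phi => //; split; last by apply: rational_eq fR => T t tO; rewrite phiO.
  move=> S T g u v gb E; rewrite /phi (bij_eq_card gb); congr (_ / _).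
    by apply: eq_bigr => j _; congr (_ * _ *+ _); apply: homs_iso_inv gb E.
  exact: homs_iso_inv gb E.
split=> [|S T u v].
  rewrite /phi card_void big_ord1 bin1 mul1r mulr1n.
  have h0 (C : over X) : homs C (T := tempty G fam) (ginit X) = 1 by have [] := homs_mult fam C.
  by rewrite !h0 divr1.
have [n [o [nS od]]] := orbit_decomposition_all u.
have [m [o' [mT od']]] := orbit_decomposition_all v.
rewrite (phiE _ _ _ _ od nS) (phiE _ _ _ _ od' mT).
rewrite (phiE _ _ _ _ (orbit_decomposition_sum od od')); last by rewrite card_sum leq_add.
rewrite big_split_ord /=.
by congr (_ * _); apply: eq_bigr => i _; rewrite ?ltn_ord // ltnNge leq_addr /= addKn.
Qed.

(** ** Norms of rational ghosts *)

(** As T is an orbit, each orbit of the pullback has a point over x. *)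
Lemma pull_decomposition X Y (n : gmap Y X) T (t : gmap T X) x : transitive_at x ->
  exists m o, (m <= #|[pred y | n y == t x]|)%N /\
    orbit_decomposition (S := tpull t n) (gpull2 t n) m o.
Proof.
move=> tx.
have [|m [o [mD od]]] := @orbit_decomposition_ex _ _ fam Y (tpull t n) (gpull2 t n)
    (fun w => gpull1 t n w == x).
  move=> w; have [a Ga E] := transitive_any (gpull1 t n w) tx x.
  by exists a => //; rewrite gmapP // E.
exists m, o; split=> //; apply: leq_trans mD _.
rewrite -(card_in_imset (f := gpull2 t n)); last first.
  by move=> w w' /eqP wx /eqP wx' E; apply: gpull_inj; rewrite ?wx ?wx'.
apply: subset_leq_card; apply/subsetP => _ /imsetP[w /eqP wx ->].
by rewrite inE -gpullP wx.
Qed.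

(** If s phi = A - B on orbits, the norm of s phi is extrapolated from the norms of the
    G-sets A + jB and is therefore integral (b below).  It equals the norm of phi times
    the norm of the constant s (a below), whose values on orbits are powers of s with
    bounded exponent, so that a divides a power of s among the integral functions. *)
Lemma rational_ghN X Y (n : gmap Y X) (phi : ghost fam Y) : iso_inv phi -> gmultiplicative phi ->
  rational phi -> rational (ghN n phi).
Proof.
move=> phiI phiM [s [Ps [A [B phiE]]]]; have s0 := pnat_gt0 Ps.
pose N := #|Y|.
pose a : ghost fam X := homs (onm n (omuln (oone Y) s)).
pose b : ghost fam X := fun T t => \sum_(j < N.+1)
  (-1) ^+ j * homs (onm n (oadd A (omuln B j))) t *+ 'C(N.+1, j.+1).
have bI : integral b.
  apply: integral_sum => j; refine (integral_eq _ (integralM (integral_int X ((-1) ^+ j))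
    (integralM (integral_nat X 'C(N.+1, j.+1)) (integral_homs (onm n (oadd A (omuln B j))))))) => T t _.
  by rewrite -mulrnAr mulr_natl rmorphXn rmorphN1.
have abE T (t : gmap T X) : is_orbit T -> exists2 m, (m <= N)%N &
    a T t = s%:R ^+ m /\ a T t * ghN n phi t = b T t.
  move=> [x tx]; have [m [o [mN od]]] := pull_decomposition n t tx.
  have mN' : (m <= N)%N by apply: leq_trans mN (max_card _).
  exists m => //; rewrite /a homs_nm /ghN (homs_const s od); split=> //.
  under [RHS]eq_bigr do rewrite homs_nm /ghN.
  rewrite (homs_difference _ _ od mN') od.2 //.
  rewrite -[m in s%:R ^+ m]card_ord -prodr_const -big_split; apply: eq_bigr => i _ /=.
  by rewrite phiE //; exact: od.1.
exists (s ^ 'C(N.+1, 2))%N; split; first by rewrite pnatX Ps.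
apply: integral_eq (integralM (integral_power_quotient s N.+1 (integral_homs (onm n (omuln (oone Y) s)))) bI).
move=> T t tO; have [m mN [am <-]] := abE T t tO.
rewrite mulrCA mulrA; congr (_ * _); apply/esym/eqP.
rewrite -subr_eq0 -power_quotientE (bigD1 (Ordinal (mN : m < N.+1)%N)) //=.
by rewrite natrX -am subrr mul0r.
Qed.

Lemma wf_ghB X W (b : bispan X W) (phi : ghost fam X) : wf_ghost phi -> wf_ghost (ghB b phi).
Proof.
move=> [phiI phiM phiR]; rewrite /ghB.
have rI := ghR_iso_inv (bs_res b) phiI; have rM := ghR_mult (bs_res b) phiI phiM.
have rR := rational_ghR (bs_res b) phiR.
have nI := ghN_iso_inv (bs_nm b) rI; have nM := ghN_mult (bs_nm b) rI rM.
have nR := rational_ghN (bs_nm b) rI rM rR.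
by split; [exact: ghT_iso_inv | exact: ghT_mult | exact: rational_ghT].
Qed.
End Rational.

(** * The Tambara functor of rational ghosts *)

Section GhostTambara.
Variables (gT : finGroupType) (G : {group gT}) (fam : family gT) (P : nat_pred).
Implicit Types X Y Z U V W : gset G.
Implicit Types S T : tset G fam.

Definition rghost X := {phi : ghost fam X | wf_ghost P phi}.

Lemma rghost_iso X (x : rghost X) : iso_inv (sval x).
Proof. by case: x => phi []. Qed.

Lemma rghost_mult X (x : rghost X) : gmultiplicative (sval x).
Proof. by case: x => phi []. Qed.

Lemma rghost_rational X (x : rghost X) : rational P (sval x).
Proof. by case: x => phi []. Qed.

Lemma rghost_inj X (x y : rghost X) : sval x = sval y -> x = y.
Proof.
case: x y => phi p [psi q] /= E; case: _ / E q => q.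
by congr exist; exact: Prop_irrelevance.
Qed.

Lemma rghost_ext X (x y : rghost X) :
  (forall T t, is_orbit T -> sval x T t = sval y T t) -> x = y.
Proof.
by move=> E; apply: rghost_inj; apply: ghost_orbits E; (exact: rghost_iso) || exact: rghost_mult.
Qed.

Lemma rghost_ex X (f : ghost fam X) : rational P f ->
  exists x : rghost X, forall T t, is_orbit T -> sval x T t = f T t.
Proof. by move=> /ghost_extension[phi w E]; exists (exist _ phi w). Qed.

Fact rghost0_subproof X : exists x : rghost X, forall T t, is_orbit T -> sval x T t = 0.
Proof. exact: rghost_ex (integral_rational P (@integral_nat _ _ fam X 0)). Qed.
Definition rghost0 X : rghost X := sval (cid (rghost0_subproof X)).

(** An orbit lies in one of the two summands. *)
Lemma orbit_sum X Y T (t : gmap T (gsum X Y)) : is_orbit T ->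
  (exists u, t = gcomp (ginl X Y) u) \/ (exists u, t = gcomp (ginr X Y) u).
Proof.
move=> [x tx]; case tE : (t x) => [a|b]; [left | right].
  have [|y b b' -> []//|y b c Gc E|u uE] := @gmap_surj _ _ T X (fun y b => t y = inl b).
  - by move=> y; have [c Gc <-] := tx y; exists (gact X a c); rewrite gmapP // tE gsumE.
  - by rewrite gmapP // E gsumE.
  by exists u; apply: gmap_ext => y; rewrite uE.
have [|y b1 b' -> []//|y b1 c Gc E|u uE] := @gmap_surj _ _ T Y (fun y b => t y = inr b).
- by move=> y; have [c Gc <-] := tx y; exists (gact Y b c); rewrite gmapP // tE gsumE.
- by rewrite gmapP // E gsumE.
by exists u; apply: gmap_ext => y; rewrite uE.
Qed.

Lemma gcomp_inj X Y Z (i : gmap Y Z) (f g : gmap X Y) : injective i ->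
  gcomp i f = gcomp i g -> f = g.
Proof.
move=> iI E; apply: gmap_ext => x; apply: iI.
by rewrite -[LHS]/(gcomp i f x) E.
Qed.

Lemma ghT_inj X Y (i : gmap X Y) (phi : ghost fam X) T (t : gmap T X) : injective i ->
  ghT i phi (gcomp i t) = phi T t.
Proof.
move=> iI; rewrite /ghT (big_pred1 t) // => s /=.
by apply/eqP/eqP => [|->//]; exact: gcomp_inj.
Qed.

Lemma ghT_disjoint X Y Z (i : gmap X Z) (j : gmap Y Z) (phi : ghost fam X) T (t : gmap T Y) :
  (forall a b, i a <> j b) -> is_orbit T -> ghT i phi (gcomp j t) = 0.
Proof.
move=> ij [x _]; rewrite /ghT big1 // => s /eqP /(congr1 (fun h : gmap _ _ => h x)) /= E.
by case: (ij _ _ E).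
Qed.

Lemma inl_inj X Y : injective (ginl X Y).
Proof. by move=> a b []. Qed.
Lemma inr_inj X Y : injective (ginr X Y).
Proof. by move=> a b []. Qed.

(** On orbits the glued ghost is the sum of the transfers along the two inclusions,
    which is visibly rational; on other G-sets it is the product of the values on the
    two parts. *)
Lemma rghost_sum X Y (x : rghost X) (y : rghost Y) : exists z : rghost (gsum X Y),
  ghR (ginl X Y) (sval z) = sval x /\ ghR (ginr X Y) (sval z) = sval y.
Proof.
have [|z zE] := @rghost_ex (gsum X Y)
  (fun T t => ghT (ginl X Y) (sval x) t + ghT (ginr X Y) (sval y) t).
  by apply: rationalD; apply: rational_ghT; exact: rghost_rational.
have zI := rghost_iso z; have zM := rghost_mult z.
exists z; split; apply: ghost_orbits;
  try exact: ghR_iso_inv; try exact: ghR_mult;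
  try exact: rghost_iso; try exact: rghost_mult; move=> T t tO; rewrite /ghR zE //.
  rewrite ghT_inj; last exact: inl_inj.
  by rewrite ghT_disjoint ?addr0.
rewrite ghT_inj; last exact: inr_inj.
by rewrite ghT_disjoint ?add0r.
Qed.

Lemma rghost_sum_uniq X Y (z z' : rghost (gsum X Y)) :
  ghR (ginl X Y) (sval z) = ghR (ginl X Y) (sval z') ->
  ghR (ginr X Y) (sval z) = ghR (ginr X Y) (sval z') -> z = z'.
Proof.
move=> El Er; apply: rghost_ext => T t tO.
case: (orbit_sum t tO) => -[u ->].
  by have := congr1 (fun f : ghost fam X => f T u) El.
by have := congr1 (fun f : ghost fam Y => f T u) Er.
Qed.

Lemma ghT_fold X (z : ghost fam (gsum X X)) T (t : gmap T X) : is_orbit T ->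
  ghT (gfold X) z t = ghR (ginl X X) z t + ghR (ginr X X) z t.
Proof.
move=> tO; have [x _] := tO; rewrite /ghT /ghR.
rewrite (bigD1 (gcomp (ginl X X) t)) /=; last by apply/eqP/gmap_ext.
rewrite (bigD1 (gcomp (ginr X X) t)) /=; last first.
  apply/andP; split; first by apply/eqP/gmap_ext.
  by apply/eqP => /(congr1 (fun h : gmap _ _ => h x)).
rewrite big1 ?addr0 // => s /andP[/andP[/eqP st sl] sr].
have [] := orbit_sum s tO => -[u su]; [case/negP: sl | case/negP: sr];
  apply/eqP; rewrite su; congr gcomp; rewrite -st su; exact: gmap_ext.
Qed.

Lemma ghN_fold X (z : ghost fam (gsum X X)) T (t : gmap T X) :
  iso_inv z -> gmultiplicative z ->
  ghN (gfold X) z t = ghR (ginl X X) z t * ghR (ginr X X) z t.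
Proof.
move=> zI zM; rewrite /ghN /ghR -zM.2; symmetry.
have El y : t (gid T y) = gfold X (gcomp (ginl X X) t y) by [].
have Er y : t (gid T y) = gfold X (gcomp (ginr X X) t y) by [].
apply: (zI (tsum T T) (tpull t (gfold X)) (gcopair (gpull_lift El) (gpull_lift Er)));
  last by case.
apply: inj_surj_bij => [|u].
  case=> u [] v uv; move: (congr1 (gpull1 _ _) uv) (congr1 (gpull2 _ _) uv) => //=.
    by move=> ->.
  by move=> ->.
have := gpullP u; case E : (gpull2 _ _ u) => [a|b] /= e.
  by exists (inl (gpull1 _ _ u)); apply: (@gpull_inj _ _ _ _ _ t (gfold X)); [|rewrite E -e].
by exists (inr (gpull1 _ _ u)); apply: (@gpull_inj _ _ _ _ _ t (gfold X)); [|rewrite E -e].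
Qed.

Definition rghost_map X W (b : bispan X W) (x : rghost X) : rghost W :=
  exist _ (ghB b (sval x)) (wf_ghB b (svalP x)).

Lemma rghost_R X Y (r : gmap Y X) (x : rghost X) :
  sval (rghost_map (bispan_R r) x) = ghR r (sval x).
Proof. exact/ghB_R/rghost_iso. Qed.
Lemma rghost_N X Y (n : gmap X Y) (x : rghost X) :
  sval (rghost_map (bispan_N n) x) = ghN n (sval x).
Proof. exact/ghB_N/rghost_iso. Qed.
Lemma rghost_T X Y (t : gmap X Y) (x : rghost X) :
  sval (rghost_map (bispan_T t) x) = ghT t (sval x).
Proof. exact/ghB_T/rghost_iso. Qed.

Fact rghost_map_iso X W (b c : bispan X W) : bispan_iso b c -> rghost_map b =1 rghost_map c.
Proof. by move=> bc x; apply/rghost_inj/ghB_iso/bc/rghost_iso. Qed.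

Fact rghost_map_id X : rghost_map (bispan_id X) =1 id.
Proof. by move=> x; apply/rghost_inj/ghB_id/rghost_iso. Qed.

Fact rghost_map_comp X W V (b : bispan X W) (c : bispan W V) :
  rghost_map (bispan_comp b c) =1 rghost_map c \o rghost_map b.
Proof. by move=> x; apply/rghost_inj/ghB_comp/rghost_iso. Qed.

Fact rghost_terminal : exists z : rghost (gempty G), forall z', z' = z.
Proof.
exists (rghost0 (gempty G)) => z'; apply: rghost_ext => T t [x _].
by case: (t x).
Qed.

Fact rghost_product X Y (x : rghost X) (y : rghost Y) : exists! z : rghost (gsum X Y),
  rghost_map (bispan_R (ginl X Y)) z = x /\ rghost_map (bispan_R (ginr X Y)) z = y.
Proof.
have [z [zl zr]] := rghost_sum x y; exists z; split.
  by split; apply: rghost_inj; rewrite rghost_R.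
by move=> z' [Ex Ey]; apply: rghost_sum_uniq; rewrite ?zl ?zr -?Ex -?Ey rghost_R.
Qed.

(** Glue x with its opposite; on an orbit the transfer along the fold map adds the
    two, and an orbit has no lift to the empty G-set. *)
Fact rghost_opp X (x : rghost X) : exists (z : rghost (gsum X X)) (z0 : rghost (gempty G)),
  rghost_map (bispan_R (ginl X X)) z = x /\
  rghost_map (bispan_T (gfold X)) z = rghost_map (bispan_T (ginit X)) z0.
Proof.
have [y yE] := rghost_ex (rationalN (rghost_rational x)).
have [z [zl zr]] := rghost_sum x y; exists z, (rghost0 _); split.
  by apply: rghost_inj; rewrite rghost_R.
apply: rghost_ext => T t tO; rewrite !rghost_T ghT_fold // zl zr yE // subrr.
have [u _] := tO; rewrite /ghT big_pred0 // => s.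
by case: (s u).
Qed.

Definition ghost_tambara : tambara G :=
  Tambara rghost_map_iso rghost_map_id rghost_map_comp rghost_terminal rghost_product rghost_opp.

Lemma ghost_is_sum X (x y s : rghost X) :
  (forall T t, is_orbit T -> sval s T t = sval x T t + sval y T t) ->
  @tf_is_sum _ _ ghost_tambara X x y s.
Proof.
move=> E; have [z [zl zr]] := rghost_sum x y; exists z; split.
- by apply: rghost_inj; rewrite rghost_R.
- by apply: rghost_inj; rewrite rghost_R.
by apply: rghost_ext => T t tO; rewrite rghost_T ghT_fold // zl zr E.
Qed.

Lemma ghost_is_prod X (x y s : rghost X) :
  (forall T t, is_orbit T -> sval s T t = sval x T t * sval y T t) ->
  @tf_is_prod _ _ ghost_tambara X x y s.
Proof.
move=> E; have [z [zl zr]] := rghost_sum x y; exists z; split.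
- by apply: rghost_inj; rewrite rghost_R.
- by apply: rghost_inj; rewrite rghost_R.
apply: rghost_ext => T t tO; rewrite rghost_N ghN_fold ?zl ?zr ?E //.
  exact: rghost_iso.
exact: rghost_mult.
Qed.
End GhostTambara.

(** * Marks of Burnside rings *)

Section Marks.
Variables (gT : finGroupType) (H : {group gT}).
Implicit Types Q : {group gT}.

Definition gmark Q (x : gclasses H) : nat := gfix (gset_repr x) Q.

Section Fixed.
Variable Q : {group gT}.
Hypothesis sQH : Q \subset H.

Lemma gmark_cls (X : gset H) : gmark Q (gcls X) = gfix X Q.
Proof. exact/(gfix_iso sQH)/gclsK. Qed.

Lemma gmarkD x y : gmark Q (x + y) = (gmark Q x + gmark Q y)%N.
Proof. by rewrite -gfix_sum // -gmark_cls. Qed.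

Lemma gmarkM x y : gmark Q (x * y) = (gmark Q x * gmark Q y)%N.
Proof. by rewrite -gfix_prod // -gmark_cls. Qed.

Lemma gmark0 : gmark Q 0 = 0%N.
Proof. by rewrite gmark_cls gfix_empty. Qed.

Lemma gmark1 : gmark Q 1 = 1%N.
Proof. by rewrite gmark_cls gfix_point. Qed.

Lemma gmark_muln x n : gmark Q (x *+ n) = (gmark Q x * n)%N.
Proof. by elim: n => [|n IHn]; rewrite ?mulr0n ?gmark0 ?muln0 // mulrS gmarkD IHn mulnS. Qed.

Lemma bmarkE (u : burnside H) :
  bmark Q u = (gmark Q (repr u).1)%:Z - (gmark Q (repr u).2)%:Z.
Proof. by []. Qed.

Lemma bmark_diff a b : bmark Q (gdiff a b : burnside H) = (gmark Q a)%:Z - (gmark Q b)%:Z.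
Proof. by apply: groth_liftE => x y; rewrite -PoszD -gmarkD. Qed.

Lemma bmark_set (X : gset H) : bmark Q (bset X) = gfix X Q.
Proof. by rewrite bmark_diff gmark_cls gmark0 subr0. Qed.

Lemma bmarkD (u v : burnside H) : bmark Q (u + v) = bmark Q u + bmark Q v.
Proof.
elim/grothW: u => a b; elim/grothW: v => c d.
have -> : (gdiff a b : burnside H) + gdiff c d = gdiff (a + c) (b + d) by exact: groth_addE.
by rewrite !bmark_diff !gmarkD !PoszD; ring.
Qed.

Lemma bmarkM (u v : burnside H) : bmark Q (u * v) = bmark Q u * bmark Q v.
Proof.
elim/grothW: u => a b; elim/grothW: v => c d.
have -> : (gdiff a b : burnside H) * gdiff c d = gdiff (a * c + b * d) (a * d + b * c).
  exact: groth_mulE.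
by rewrite !bmark_diff !gmarkD !gmarkM !PoszD !PoszM; ring.
Qed.

Lemma bmark0 : bmark Q (0 : burnside H) = 0.
Proof. by rewrite -[0]/(gdiff 0 0) bmark_diff subrr. Qed.

Lemma bmark1 : bmark Q (1 : burnside H) = 1.
Proof. by rewrite -[1]/(gdiff 1 0) bmark_diff gmark0 gmark1 subr0. Qed.

Lemma bmarkN (u : burnside H) : bmark Q (- u) = - bmark Q u.
Proof. by apply/eqP; rewrite -subr_eq0 opprK -bmarkD addNr bmark0. Qed.

Lemma bmarkMn (u : burnside H) n : bmark Q (u *+ n) = bmark Q u *+ n.
Proof. by elim: n => [|n IHn]; rewrite ?mulr0n ?bmark0 // !mulrS bmarkD IHn. Qed.

Lemma bmark_nat n : bmark Q (n%:R : burnside H) = n%:R.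
Proof. by rewrite bmarkMn bmark1. Qed.

Lemma bmark_sum (I : Type) (r : seq I) (F : I -> burnside H) :
  bmark Q (\sum_(i <- r) F i) = \sum_(i <- r) bmark Q (F i).
Proof. exact: (big_morph (bmark Q) bmarkD bmark0). Qed.

Lemma bmark_prod (I : Type) (r : seq I) (F : I -> burnside H) :
  bmark Q (\prod_(i <- r) F i) = \prod_(i <- r) bmark Q (F i).
Proof. exact: (big_morph (bmark Q) bmarkM bmark1). Qed.

Lemma bmarkX (u : burnside H) n : bmark Q (u ^+ n) = bmark Q u ^+ n.
Proof. by elim: n => [|n IHn]; rewrite ?expr0 ?bmark1 // !exprS bmarkM IHn. Qed.
End Fixed.

(** Finite H-sets with equal marks are isomorphic. *)
Lemma bmark_inj (u v : burnside H) :
  (forall Q, Q \subset H -> bmark Q u = bmark Q v) -> u = v.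
Proof.
elim/grothW: u => a b; elim/grothW: v => c d E; apply/gdiffP; exists 0; rewrite !addr0.
rewrite -[a + d]gset_reprK -[c + b]gset_reprK; apply/gclsP/gset_marks => Q sQH.
have := E Q sQH; rewrite !bmark_diff // -!/(gmark Q _) !gmarkD //; lia.
Qed.

Section Localized.
Variable P : nat_pred.
Implicit Types w : burnsideP P H.

Lemma prime_to_neq0 (s : prime_to P) : ((val s)%:R : rat) != 0.
Proof. exact: pnat_gt0 (valP s). Qed.

(** Marks in the rationals instead of Z_(P), so that marks of different elements can
    be compared with values of ghosts. *)
Definition rmark Q w : rat := (bmark Q (numer w))%:~R / (val (denom w))%:R.

Section Fixed.
Variable Q : {group gT}.
Hypothesis sQH : Q \subset H.

Lemma rmark_frac a s : rmark Q (frac _ a s) = (bmark Q a)%:~R / (val s)%:R.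
Proof.
have [k /(congr1 (bmark Q))] := frac_repr_ex (Pden (burnside H) P) a s.
rewrite !bmarkM // !bmark_nat // => /(congr1 (fun z : int => z%:~R : rat)).
rewrite !intrM !mulrz_nat => /(mulfI (prime_to_neq0 k)) E.
by apply/eqP; rewrite eqr_div ?prime_to_neq0 // E.
Qed.

Lemma rmark_in a : rmark Q (loc_in _ a) = (bmark Q a)%:~R.
Proof. by rewrite rmark_frac divr1. Qed.

Lemma rmarkD w w' : rmark Q (w + w') = rmark Q w + rmark Q w'.
Proof.
elim/locW: w => a s; elim/locW: w' => b t; rewrite fracD !rmark_frac bmarkD // !bmarkM //.
rewrite !bmark_nat // intrD !intrM !mulrz_nat /= natrM.
by field; rewrite !prime_to_neq0.
Qed.

Lemma rmarkM w w' : rmark Q (w * w') = rmark Q w * rmark Q w'.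
Proof.
elim/locW: w => a s; elim/locW: w' => b t; rewrite fracM !rmark_frac bmarkM // intrM natrM.
by field; rewrite !prime_to_neq0.
Qed.

Lemma rmark1 : rmark Q 1 = 1.
Proof. by rewrite rmark_in bmark1. Qed.

Lemma rmark0 : rmark Q 0 = 0.
Proof. by rewrite rmark_in bmark0. Qed.

Lemma rmarkX w n : rmark Q (w ^+ n) = rmark Q w ^+ n.
Proof. by elim: n => [|n IHn]; rewrite ?expr0 ?rmark1 // !exprS rmarkM IHn. Qed.

Lemma bPmark_rmark w (b : bool) : bPmark Q w = (if b then 1 else 0) -> rmark Q w = b%:R.
Proof.
move=> E.
have : frac (Pden int P) (bmark Q (numer w)) (denom w) = frac _ b%:R (prime_to1 P).
  by case: b E.
case/fracP => k; rewrite /= mulr1.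
have k0 : ((val k)%:R : int) != 0 by have := prime_to_neq0 k; rewrite !pnatr_eq0.
move/(mulfI k0) => {}E; rewrite /rmark E intrM !mulrz_nat mulfK ?prime_to_neq0 //.
Qed.
End Fixed.

Lemma rmark_inj w w' : (forall Q, Q \subset H -> rmark Q w = rmark Q w') -> w = w'.
Proof.
elim/locW: w => a s; elim/locW: w' => b t E; apply/fracP; exists (prime_to1 P).
congr (_ * _); apply: bmark_inj => Q sQH; rewrite !bmarkM // !bmark_nat //.
have /eqP := E Q sQH; rewrite !rmark_frac // eqr_div ?prime_to_neq0 //.
have natE n : (n%:R : rat) = (n%:R : int)%:~R by rewrite mulrz_nat.
by rewrite !natE -!intrM eqr_int => /eqP.
Qed.
End Localized.
End Marks.

(** * Induction and co-induction as fibres *)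

Section InducedPoints.
Variables (gT : finGroupType) (K H : {group gT}) (sKH : K \subset H) (X : gset K).
Local Open Scope group_scope.

Let sgM (a b : subg_of H) : sgval (a * b) = sgval a * sgval b. Proof. by []. Qed.
Let sgV (a : subg_of H) : sgval a^-1 = (sgval a)^-1. Proof. by []. Qed.

Definition ind_pt (x : X) (h : gT) : gind H X :=
  Sub (ind_orbit (H := H) (x, subg H h)) (codom_f _ _).

Lemma ind_pt_surj (u : gind H X) : exists x, exists2 h, h \in H & u = ind_pt x h.
Proof.
have /codomP[[x h] E] := valP u; exists x, (sgval h); first exact: subgP.
by apply: val_inj; rewrite /= E sgvalK.
Qed.

Lemma ind_ptE x h x' h' : h \in H -> h' \in H ->
  ind_pt x h = ind_pt x' h' <-> exists2 k, k \in K & x' = gact X x k /\ h' = k^-1 * h.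
Proof.
move=> Hh Hh'; split=> [/(congr1 val) /= E | [k Kk [-> ->]]].
  have : (x', subg H h') \in ind_orbit (H := H) (x', subg H h').
    apply/imsetP; exists 1; first by rewrite inE group1.
    by rewrite /= gact1 invg1 mul1g.
  rewrite -E => /imsetP[k]; rewrite inE => Kk [-> /(congr1 sgval)].
  by rewrite sgM sgV !subgK // => ->; exists (sgval k).
apply: val_inj => /=; have Hk : k \in H := subsetP sKH k Kk.
apply/setP => q; apply/imsetP/imsetP => -[l]; rewrite inE => Kl ->.
  exists (subg H k^-1 * l).
    by rewrite inE sgM subgK ?groupV // groupM ?groupV.
  rewrite -[(_, _).1]/x -[(gact X x k, _).1]/(gact X x k) sgM subgK ?groupV //.
  rewrite -gactM ?groupM ?groupV // mulKVg.
  congr pair; apply: (can_inj (@sgvalK _ H)).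
  rewrite !(sgM, sgV) !subgK ?groupM ?groupV //.
  by rewrite invMg invgK -!mulgA mulKVg.
exists (subg H k * l); first by rewrite inE sgM subgK // groupM.
rewrite -[(_, _).1]/(gact X x k) -[(x, _).1]/x sgM subgK // gactM //.
congr pair; apply: (can_inj (@sgvalK _ H)).
rewrite !(sgM, sgV) !subgK ?groupM ?groupV //.
by rewrite invMg mulgA.
Qed.

Lemma ind_pt_inj x x' h : h \in H -> ind_pt x h = ind_pt x' h -> x = x'.
Proof.
move=> Hh /ind_ptE[] // k Kk [-> E].
have -> : k = 1 by apply/eqP; rewrite -eq_invg1; apply/eqP/(mulIg h); rewrite mul1g -E.
by rewrite gact1.
Qed.

Lemma ind_pt_slide x k h : k \in K -> h \in H -> ind_pt (gact X x k) h = ind_pt x (k * h).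
Proof.
move=> Kk Hh; have Hk := subsetP sKH k Kk; symmetry.
by apply/ind_ptE; rewrite ?groupM //; exists k; rewrite // mulKg.
Qed.

Lemma ind_pt_act x h a : h \in H -> a \in H ->
  gact (gind H X) (ind_pt x h) a = ind_pt x (h * a).
Proof.
move=> Hh Ha; apply: val_inj.
have -> : gact (gind H X) (ind_pt x h) a = gind_fun (ind_pt x h) a by exact: mkactE.
rewrite /= /gind_shift /ind_orbit -imset_comp; apply: eq_imset => k /=.
by rewrite morphM // mulgA.
Qed.
End InducedPoints.

Section Cosets.
Variables (gT : finGroupType) (G : {group gT}).
Implicit Types K H Q : {group gT}.
Local Open Scope group_scope.

Fact gbase_subproof H : (H : {set gT}) \in rcosets H G.
Proof. by apply/rcosetsP; exists 1; rewrite ?rcoset1. Qed.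
Definition gbase H : gcosets G H := Sub (H : {set gT}) (gbase_subproof H).

Lemma gbase_act H a : a \in G -> val (gact (gcosets G H) (gbase H) a) = H :* a.
Proof. exact: gcosetsE. Qed.

Lemma gcosets_pt H (C : gcosets G H) : exists2 a, a \in G & C = gact _ (gbase H) a.
Proof.
have /rcosetsP[a Ga E] := valP C; exists a => //.
by apply: val_inj; rewrite gbase_act.
Qed.

Lemma gbase_act_eq H a b : a \in G -> b \in G ->
  (gact (gcosets G H) (gbase H) a == gact _ (gbase H) b) = (a * b^-1 \in H).
Proof.
move=> Ga Gb; rewrite -mem_rcoset; apply/eqP/idP => [/(congr1 val)|ab].
  by rewrite !gbase_act // => <-; exact: rcoset_refl.
by apply: val_inj; rewrite !gbase_act //; exact: rcoset_eqP.
Qed.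

Lemma gbase_act_fix H a : a \in G -> (gact (gcosets G H) (gbase H) a == gbase H) = (a \in H).
Proof. by move=> Ga; have := gbase_act_eq H Ga (group1 G); rewrite gact1 invg1 mulg1. Qed.

Lemma gbase_transitive H : transitive_at (gbase H).
Proof. by move=> C; have [a Ga ->] := gcosets_pt C; exists a. Qed.

Lemma gbase_stab H : H \subset G -> gstab (gbase H) = H.
Proof.
move=> sHG; apply/setP => a; apply/gstabP/idP => [[Ga /eqP]|Ha].
  by rewrite gbase_act_fix.
have Ga := subsetP sHG a Ha.
by split=> //; apply/eqP; rewrite gbase_act_fix.
Qed.

Lemma gproj_base K H (sKH : K \subset H) : gproj G sKH (gbase K) = gbase H.
Proof. by apply: val_inj; rewrite /= mulGSid. Qed.

Lemma stab_over_base H (T : gset G) (t : gmap T (gcosets G H)) x :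
  t x = gbase H -> gstab x \subset H.
Proof.
move=> tx; apply/subsetP => a /gstabP[Ga xa].
by rewrite -gbase_act_fix // -tx -gmapP // xa.
Qed.

Lemma point_over_base H (T : gset G) (t : gmap T (gcosets G H)) : is_orbit T ->
  exists2 x, transitive_at x & t x = gbase H.
Proof.
move=> [y ty]; have [a Ga E] := gcosets_pt (t y).
exists (gact T y a^-1); last by rewrite gmapP ?groupV // E gactV.
exact: transitive_any ty.
Qed.

Lemma gproj_pt K H (sKH : K \subset H) h : h \in G ->
  (gproj G sKH (gact _ (gbase K) h) == gbase H) = (h \in H).
Proof. by move=> Gh; rewrite gmapP // gproj_base gbase_act_fix. Qed.

Lemma card_fibre_gproj K H (sKH : K \subset H) : H \subset G ->
  (#|[pred C | gproj G sKH C == gbase H]| <= #|H : K|)%N.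
Proof.
move=> sHG; rewrite -(card_image (f := val : gcosets G K -> _) val_inj).
apply: subset_leq_card; apply/subsetP => _ /imageP[C /eqP Cb ->].
have [a Ga E] := gcosets_pt C; move: Cb => /eqP; rewrite E gproj_pt // => Ha; rewrite gbase_act //.
by apply/rcosetsP; exists a.
Qed.

(** A subgroup Q of H acts in the same way on X and on the fibre of D that X is
    identified with by r. *)
Lemma fixed_fibre H (sHG : H \subset G) (X : gset H) (D : gset G) (p : pred D)
    (r : X -> D -> Prop) :
    (forall x, exists2 d, p d & r x d) -> (forall d, p d -> exists x, r x d) ->
    (forall x d d', r x d -> r x d' -> d = d') -> (forall x x' d, r x d -> r x' d -> x = x') ->
    (forall x d a, a \in H -> r x d -> r (gact X x a) (gact D d a)) ->
  forall Q, Q \subset H -> gfix X Q = #|[pred d | p d && (Q \subset gstab d)]|.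
Proof.
move=> rE rS rU rI rA Q sQH; apply: (card_correspondence (r := r)) => //.
  move=> x /gfixP xQ; have [d pd rxd] := rE x; exists d => //=; rewrite pd /=.
  apply/subsetP => a Qa; have Ha := subsetP sQH a Qa.
  apply/gstabP; split; first exact: subsetP sHG a Ha.
  by apply: (rU x) => //; rewrite -[x in r x _](xQ a Qa); exact: rA.
move=> d /andP[pd /subsetP dQ]; have [x rxd] := rS d pd; exists x => //.
apply/gfixP => a Qa; have /gstabP[_ da] := dQ a Qa.
by apply: (rI _ _ d) => //; rewrite -da; apply: rA => //; exact: subsetP sQH a Qa.
Qed.
End Cosets.

Section Fibres.
Variables (gT : finGroupType) (G : {group gT}).
Implicit Types K H Q : {group gT}.
Local Open Scope group_scope.

Section Projection.
Variables (K : {group gT}) (sKG : K \subset G) (X : gset K).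
Fact ind_proj_ex : exists f : gmap (gind G X) (gcosets G K),
  forall x h, h \in G -> f (ind_pt G x h) = gact _ (gbase G K) h.
Proof.
have [||u C a Ga [x [h [Gh -> ->]]]|f fP] := @gmap_surj _ _ (gind G X) (gcosets G K)
  (fun u C => exists x h, [/\ h \in G, u = ind_pt G x h & C = gact _ (gbase G K) h]).
- by move=> u; have [x [h Gh ->]] := ind_pt_surj u; exists (gact _ (gbase G K) h), x, h.
- move=> u C C' [x [h [Gh -> ->]]] [x' [h' [Gh' /ind_ptE[] // k Kk [_ ->] ->]]].
  have Gkh : k^-1 * h \in G by rewrite groupM ?groupV // (subsetP sKG).
  by apply/eqP; rewrite gbase_act_eq // invMg invgK mulKVg.
- by exists x, (h * a); rewrite groupM // ind_pt_act // gactM.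
exists f => x h Gh; have [x' [h' [Gh' /ind_ptE[] // k Kk [_ ->] ->]]] := fP (ind_pt G x h).
have Gkh : k^-1 * h \in G by rewrite groupM ?groupV // (subsetP sKG).
by apply/eqP; rewrite gbase_act_eq // -mulgA mulgV mulg1 groupV.
Qed.
Definition ind_proj := sval (cid ind_proj_ex).
Lemma ind_projE x h : h \in G -> ind_proj (ind_pt G x h) = gact _ (gbase G K) h.
Proof. exact: (svalP (cid ind_proj_ex)). Qed.

Definition oind : over (gcosets G K) := existT _ (gind G X) ind_proj.

Lemma ind_proj_base (u : gind G X) : ind_proj u = gbase G K -> exists x, u = ind_pt G x 1.
Proof.
have [x [h Gh ->]] := ind_pt_surj u; rewrite ind_projE // => /eqP.
rewrite gbase_act_fix // => Kh; exists (gact X x h).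
by rewrite ind_pt_slide ?mulg1.
Qed.
End Projection.

Variable fam : family gT.
Implicit Types T : tset G fam.

(** The count of fixed points at y becomes a mark: the stabilizer of y lies in H, and
    the fibre over the base coset is the H-set X. *)
Lemma homs_fibre H (sHG : H \subset G) (X : gset H) (C : over (gcosets G H)) T
    (t : gmap T (gcosets G H)) y (r : X -> projT1 C -> Prop) :
    transitive_at y -> t y = gbase G H ->
    (forall x, exists2 d, projT2 C d = gbase G H & r x d) ->
    (forall d, projT2 C d = gbase G H -> exists x, r x d) ->
    (forall x d d', r x d -> r x d' -> d = d') -> (forall x x' d, r x d -> r x' d -> x = x') ->
    (forall x d a, a \in H -> r x d -> r (gact X x a) (gact (projT1 C) d a)) ->
  homs C t = (gfix X (gstab_group y))%:R.
Proof.
move=> ty tb rE rS rU rI rA; rewrite (homs_orbit _ _ ty) tb; congr _%:R; symmetry.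
apply: (fixed_fibre sHG (p := fun d => projT2 C d == gbase G H) (r := r)) => //.
- by move=> x; have [d db rxd] := rE x; exists d => //; apply/eqP.
- by move=> d /eqP; exact: rS.
exact: stab_over_base tb.
Qed.

Lemma homs_oind H (sHG : H \subset G) (X : gset H) T (t : gmap T (gcosets G H)) y :
    transitive_at y -> t y = gbase G H ->
  homs (oind sHG X) t = (gfix X (gstab_group y))%:R.
Proof.
move=> ty tb; apply: (homs_fibre (C := oind sHG X) sHG (r := fun x d => d = ind_pt G x 1) ty tb).
- by move=> x; exists (ind_pt G x 1); rewrite //= ind_projE // gact1.
- by move=> d /ind_proj_base.
- by move=> x d d' -> ->.
- by move=> x x' d -> /ind_pt_inj; apply.
move=> x d a Ha ->; have Ga := subsetP sHG a Ha.
by rewrite ind_pt_act // mul1g ind_pt_slide // mulg1.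
Qed.

(** The part of G x_K X over the base coset of G/H is H x_K X. *)
Lemma homs_oind_tr K H (sKH : K \subset H) (sHG : H \subset G) (sKG : K \subset G) (X : gset K) T
    (t : gmap T (gcosets G H)) y : transitive_at y -> t y = gbase G H ->
  homs (otr (gproj G sKH) (oind sKG X)) t = (gfix (gind H X) (gstab_group y))%:R.
Proof.
move=> ty tb; have GH h : h \in H -> h \in G := subsetP sHG h.
apply: (homs_fibre (C := otr _ (oind sKG X)) sHG (r := fun u d => exists x, exists2 h, h \in H &
  u = ind_pt H x h /\ d = ind_pt G x h) ty tb).
- move=> u; have [x [h Hh ->]] := ind_pt_surj u.
  exists (ind_pt G x h); last by exists x, h.
  rewrite -[LHS]/(gproj G sKH (ind_proj sKG X _)) ind_projE ?GH //; apply/eqP.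
  by rewrite gproj_pt ?GH.
- move=> d; have [x [h Gh ->]] := ind_pt_surj d.
  rewrite -[X in X = _]/(gproj G sKH (ind_proj sKG X _)) ind_projE // => /eqP.
  rewrite gproj_pt // => Hh.
  by exists (ind_pt H x h), x, h.
- move=> u d d' [x [h Hh [-> ->]]] [x' [h' Hh' [/ind_ptE E ->]]].
  by apply/ind_ptE; rewrite ?GH //; apply: E.
- move=> u u' d [x [h Hh [-> ->]]] [x' [h' Hh' [-> /ind_ptE E]]].
  by apply/ind_ptE => //; apply: E; rewrite ?GH.
move=> u d a Ha [x [h Hh [-> ->]]]; exists x, (h * a); first exact: groupM.
by rewrite !ind_pt_act ?GH.
Qed.

(** A map f in Map_K(H, X) is the section over H/K that sends Kh to the class of
    (f(h^-1), h); replacing h by kh does not change this class. *)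
Lemma homs_oind_nm K H (sKH : K \subset H) (sHG : H \subset G) (sKG : K \subset G) (X : gset K) T
    (t : gmap T (gcosets G H)) y : transitive_at y -> t y = gbase G H ->
  homs (onm (gproj G sKH) (oind sKG X)) t = (gfix (gcoind H X) (gstab_group y))%:R.
Proof.
move=> ty tb; have GH h : h \in H -> h \in G := subsetP sHG h.
pose D := gdprod (ind_proj sKG X) (gproj G sKH).
pose pt h := gact (gcosets G K) (gbase G K) h.
pose r (f : gcoind H X) (d : D) := gdprod_base _ _ d = gbase G H /\
  forall h : subg_of H, (val d).2 (pt (sgval h)) = Some (ind_pt G (val f h^-1) (sgval h)).
have ptb h : h \in G -> (gproj G sKH (pt h) == gbase G H) = (h \in H).
  exact: gproj_pt.
have fK (f : gcoind H X) h k : sgval k \in K -> val f (h * k) = gact X (val f h) (sgval k).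
  move=> Kk; apply/eqP.
  by have /forallP/(_ h)/forallP/(_ k)/implyP := valP f; apply.
apply: (homs_fibre (C := onm _ (oind sKG X)) sHG (r := r) ty tb).
- move=> f.
  (* The class does not depend on the representative of the coset. *)
  pose s : gpfun (gind G X) (gcosets G K) := [ffun C => if gproj G sKH C == gbase G H then
    Some (ind_pt G (val f (subg H (fingroup.repr (val C))^-1)) (fingroup.repr (val C))) else None].
  have sP h : h \in H -> s (pt h) = Some (ind_pt G (val f (subg H h^-1)) h).
    move=> Hh; rewrite ffunE ptb ?GH // Hh gbase_act ?GH //; congr Some.
    have /rcosetP[k Kk ->] := mem_repr_rcoset K h.
    have Hk := subsetP sKH k Kk.
    rewrite -ind_pt_slide ?GH //; congr ind_pt.
    have -> : subg H (k * h)^-1 = subg H h^-1 * subg H k^-1.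
      by rewrite invMg morphM ?inE ?groupV.
    by rewrite fK subgK ?groupV // gactVK.
  have dP : is_section (ind_proj sKG X) (gproj G sKH) (gbase G H, s).
    apply/forallP => C; have [h Gh E] := gcosets_pt C; rewrite E -/(pt h) /=.
    case Hh: (h \in H); first by rewrite sP // ptb // Hh ind_projE // eqxx.
    by rewrite ffunE !ptb // Hh.
  exists (Sub (gbase G H, s) dP : D) => //; split=> // h.
  by rewrite SubK /= sP ?subgP // -[h^-1]sgvalK.
- move=> d db.
  have dE h : h \in H -> exists x, (val d).2 (pt h) = Some (ind_pt G x h).
    move=> Hh; have [|u du uE] := @gdprod_some _ _ _ _ _ _ _ d (pt h).
      by rewrite db; apply/eqP; rewrite ptb ?GH.
    have [x [g Gg E]] := ind_pt_surj u; move: uE; rewrite E ind_projE // => /eqP.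
    have Gh := GH h Hh; rewrite gbase_act_eq // => Kgh; exists (gact X x (g * h^-1)).
    by rewrite ind_pt_slide // mulgKV du E.
  have [f fE] := choice (fun h : subg_of H => dE (sgval h)^-1 (groupVr (subgP h))).
  have fP : is_Kmap [ffun h => f h].
    apply/forallP => h; apply/forallP => k; apply/implyP => Kk; rewrite !ffunE; apply/eqP.
    have := fE (h * k).
    have -> : pt (sgval (h * k))^-1 = pt (sgval h)^-1.
      apply/eqP; rewrite gbase_act_eq ?groupV ?GH ?subgP //.
      by rewrite -[sgval (h * k)]/(sgval h * sgval k) invMg invgK mulgKV groupV.
    rewrite fE => /Some_inj E; apply/esym/(ind_pt_inj (h := (sgval (h * k))^-1) (H := G) sKG).
      by rewrite groupV GH ?subgP.
    rewrite -E ind_pt_slide ?groupV ?GH ?subgP //.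
    by rewrite -[sgval (h * k)]/(sgval h * sgval k) invMg mulKVg.
  exists (Sub [ffun h => f h] fP : gcoind H X); split=> // h.
  by rewrite SubK ffunE; have := fE h^-1; rewrite -[sgval h^-1]/((sgval h)^-1) invgK.
- move=> f d d' [db dE] [db' dE']; apply: gdprod_inj; first by rewrite db db'.
  move=> C; have [h Gh ->] := gcosets_pt C; rewrite db => /eqP; rewrite ptb // => Hh.
  by have := dE (subg H h); have := dE' (subg H h); rewrite subgK // => -> ->.
- move=> f f' d [_ dE] [_ dE']; apply: val_inj; apply/ffunP => h.
  have := dE h^-1; rewrite dE' invgK => /Some_inj E.
  by apply/esym/(ind_pt_inj (h := sgval h^-1) (H := G) sKG); rewrite ?GH ?subgP.
move=> f d a Ha [db dE]; have Ga := GH a Ha; split.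
  by rewrite gmapP // db; apply/eqP; rewrite gbase_act_fix.
move=> h; rewrite gdprod_act_val //.
have -> : gact (gcosets G K) (pt (sgval h)) a^-1 = pt (sgval (h * subg H a^-1)).
  by rewrite -[sgval (h * _)]/(sgval h * sgval (subg H a^-1)) subgK ?groupV //
    /pt gactM ?groupV ?GH ?subgP.
rewrite dE -[LHS]/(Some (gact (gind G X) _ a)); congr Some.
have -> : gact (gcoind H X) f a = gcoind_fun f a by exact: mkactE.
rewrite ind_pt_act ?GH ?subgP //.
rewrite -[sgval (h * _)]/(sgval h * sgval (subg H a^-1)) subgK ?groupV // mulgKV.
congr ind_pt; rewrite /= ffunE invMg; congr (val f (_ * _)).
by apply: (can_inj (@sgvalK _ H)); rewrite -[sgval _^-1]/((sgval _)^-1) !subgK ?groupV // invgK.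
Qed.
End Fibres.

(** * Marks of norms *)

Section NormMarks.
Variables (gT : finGroupType).
Implicit Types G H K Q : {group gT}.

(** Norms of integers are inverted in A(H)_(P) itself, where marks at all subgroups
    count. *)
Definition all_family : family gT := @Family gT xpredT (fun _ _ _ _ => isT).

(** The double coset formula for the marks of a norm.  Its index set is the set of orbits
    of T x_(G/H) G/K, with T an orbit over G/H of stabilizer Q, and z i is the stabilizer
    of a point of the i-th orbit over the base coset of G/K.  For K-sets it holds
    by [homs_oind_nm] and because numbers of maps are multiplicative; for formal
    differences both sides are given by the same extrapolation. *)
Lemma bmark_norm G (fam : family gT) K H (sKH : K \subset H) (sHG : H \subset G)
    (T : tset G fam) (t : gmap T (gcosets G H)) y :
    transitive_at y -> t y = gbase G H ->
  exists m o (z : nat -> {group gT}), [/\ (m <= #|H : K|%g)%N,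
    orbit_decomposition (S := tpull t (gproj G sKH)) (gpull2 t (gproj G sKH)) m o,
    forall i, (i < m)%N -> exists x : projT1 (o i),
      [/\ transitive_at x, projT2 (o i) x = gbase G K & gstab_group x = z i]
  & forall u : burnside K, bmark (gstab_group y) (bnorm H u) = \prod_(i < m) bmark (z i) u].
Proof.
move=> ty tb; have sKG := subset_trans sKH sHG; have syH := stab_over_base tb.
have [m [o [mN od]]] := pull_decomposition (gproj G sKH) t ty.
rewrite tb in mN; have {}mN := leq_trans mN (card_fibre_gproj sKH sHG).
have zP i : exists Q : {group gT}, (i < m)%N -> exists x : projT1 (o i),
    [/\ transitive_at x, projT2 (o i) x = gbase G K & gstab_group x = Q].
  case im : (i < m)%N; last by exists 1%G.
  by have [x tx xb] := point_over_base (projT2 (o i)) (od.1 i im); exists (gstab_group x), x.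
have [z zE] := choice zP.
exists m, o, z; split=> // u; apply: (@intr_inj rat).
pose C a := oind sKG (gset_repr a : gset K).
have CE a (T' : tset G fam) (t' : gmap T' (gcosets G K)) x : transitive_at x -> t' x = gbase G K ->
    homs (fam := fam) (C a) t' = (gmark (gstab_group x) a)%:R.
  by move=> tx xb; exact: homs_oind.
have zK i x : projT2 (o i) x = gbase G K -> gstab_group x \subset K by exact: stab_over_base.
transitivity (\prod_(i < m) (homs (C (repr u).1) (projT2 (o i)) - homs (C (repr u).2) (projT2 (o i)))).
  rewrite -(@homs_extrapolate _ _ _ _ _ _ (fun j => C ((repr u).1 + (repr u).2 *+ j))
    _ _ _ _ _ _ od mN); last first.
    move=> j T' t' T'O; have [x tx xb] := point_over_base t' T'O.
    have sxK := stab_over_base xb.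
    by rewrite !(CE _ _ _ _ tx xb) gmarkD // gmark_muln // natrD natrM mulr_natr.
  rewrite /bnorm; case: (repr u) => a b /=.
  rewrite bmark_sum // rmorph_sum; apply: eq_bigr => j _ /=.
  rewrite bmarkMn // bmarkM // bmarkX // bmarkN // bmark1 // bmark_set //.
  rewrite rmorphMn rmorphM rmorphXn rmorphN1 /= -pmulrn.
  by rewrite -(homs_oind_nm sKH sHG sKG _ ty tb) homs_nm.
rewrite rmorph_prod; apply: eq_bigr => i _ /=.
have [x [tx xb <-]] := zE i (ltn_ord i).
by rewrite !(CE _ _ _ _ tx xb) bmarkE rmorphB /= -!pmulrn.
Qed.

(** By the double coset formula the marks of N(s) are powers of s with exponent at
    most the index of K in H. *)
Lemma bnorm_nat_divides K H (sKH : K \subset H) (s : nat) :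
  exists q M, bnorm H (s%:R : burnside K) * q = (s ^ M)%:R.
Proof.
set a := bnorm H _; set n := #|H : K|%g.
have aE Q : Q \subset H -> exists2 m, (m <= n)%N & bmark Q a = (s ^ m)%:R.
  move=> sQH; have goodT (x : gcosets H Q) : all_family (gstab_group x) by [].
  pose T := TSet goodT.
  have [m [o [z [mn od zP E]]]] := @bmark_norm H all_family K H sKH (subxx H) T
    (gproj H sQH) (gbase H Q) (@gbase_transitive _ H Q) (gproj_base H sQH).
  exists m => //; have -> : Q = gstab_group (gbase H Q) by apply: val_inj; rewrite /= gbase_stab.
  rewrite E natrX -[m in RHS]card_ord -prodr_const; apply: eq_bigr => i _.
  have [x [_ xb <-]] := zP i (ltn_ord i).
  by rewrite bmark_nat //; exact: stab_over_base xb.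
have a0 : \prod_(i < n.+1) ((s ^ i)%:R - a) = 0.
  apply: bmark_inj => Q sQH; have [m mn am] := aE Q sQH.
  rewrite bmark_prod // bmark0 // (bigD1 (Ordinal (mn : m < n.+1)%N)) //=.
  by rewrite bmarkD // bmarkN // bmark_nat // am subrr mul0r.
exists (power_quotient s a n.+1), 'C(n.+1, 2); apply/eqP.
by rewrite eq_sym -subr_eq0 -power_quotientE a0.
Qed.

Variable P : nat_pred.

Lemma bPnormP K H (sKH : K \subset H) (w : burnsideP P K) :
  bPnorm H w * loc_in _ (bnorm H ((val (denom w))%:R : burnside K)) = loc_in _ (bnorm H (numer w)).
Proof.
rewrite /bPnorm; set s := denom w.
have [q [M qE]] := bnorm_nat_divides sKH (val s).
have sM : P^'.-nat (val s ^ M)%N by rewrite pnatX (valP s).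
apply: (@classical_sets.xgetPex _ 0 (fun v : burnsideP P H =>
  v * loc_in _ (bnorm H ((val s)%:R : burnside K)) = loc_in _ (bnorm H (numer w)))).
exists (frac _ (bnorm H (numer w) * q) (Sub (val s ^ M)%N sM : prime_to P)).
rewrite fracM; apply/fracP; exists (prime_to1 P).
by congr (_ * _); rewrite /= muln1 mulr1 -mulrA [q * _]mulrC qE.
Qed.

(** Orbits suffice, as they determine a multiplicative ghost; and the stabilizer of a
    point over the base coset is a subgroup of K, so that w has a mark there. *)
Definition has_marks G (fam : family gT) K (w : burnsideP P K)
    (phi : ghost fam (gcosets G K)) :=
  forall (T : tset G fam) (t : gmap T (gcosets G K)) x, transitive_at x -> t x = gbase G K ->
    phi T t = rmark (gstab_group x) w.

Lemma rmark_norm G (fam : family gT) K H (sKH : K \subset H) (sHG : H \subset G)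
    (w : burnsideP P K) (phi : ghost fam (gcosets G K)) :
    iso_inv phi -> gmultiplicative phi -> has_marks w phi ->
  has_marks (bPnorm H w) (ghN (gproj G sKH) phi).
Proof.
move=> phiI phiM phiw T t y ty tb.
have [m [o [z [mn od zP E]]]] := bmark_norm sKH sHG ty tb.
rewrite /ghN od.2 //; have sy := stab_over_base tb.
have zK i : (i < m)%N -> z i \subset K.
  by move=> /zP[x [_ xb <-]]; exact: stab_over_base xb.
have := congr1 (rmark (gstab_group y)) (bPnormP sKH w).
rewrite rmarkM // !rmark_in // !E.
have -> : ((\prod_(i < m) bmark (z i) ((val (denom w))%:R : burnside K))%:~R : rat)
    = (val (denom w))%:R ^+ m.
  rewrite -[m in RHS]card_ord -prodr_const rmorph_prod; apply: eq_bigr => i _ /=.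
  by rewrite bmark_nat ?zK // mulrz_nat.
move=> /(canRL (mulfK (expf_neq0 _ (prime_to_neq0 _)))) ->.
rewrite -[m in _ ^+ m]card_ord -prodr_const rmorph_prod -prodf_div; apply: eq_bigr => i _ /=.
by have [x [tx xb <-]] := zP i (ltn_ord i); rewrite (phiw _ _ _ tx xb).
Qed.
End NormMarks.

(** * Ghosts with given marks *)

Section MarkedGhosts.
Variables (gT : finGroupType) (P : nat_pred).
Implicit Types G H K Q : {group gT}.

Lemma has_marks_homs G (fam : family gT) H (sHG : H \subset G) (w : burnsideP P H)
    (phi : ghost fam (gcosets G H)) (u := repr (numer w)) : has_marks w phi ->
  forall (T : tset G fam) (t : gmap T (gcosets G H)), is_orbit T ->
    (val (denom w))%:R * phi T t =
    homs (oind sHG (gset_repr u.1 : gset H)) t - homs (oind sHG (gset_repr u.2 : gset H)) t.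
Proof.
move=> phiw T t tO; have [x tx xb] := point_over_base t tO.
rewrite (phiw _ _ _ tx xb) !(homs_oind sHG _ tx xb) /rmark mulrC divfK ?prime_to_neq0 //.
by rewrite bmarkE rmorphB /= -!pmulrn.
Qed.

Lemma has_marks_ex G (fam : family gT) H (sHG : H \subset G) (w : burnsideP P H) :
  exists x : rghost fam P (gcosets G H), has_marks w (sval x).
Proof.
set u := repr (numer w); set s := denom w.
pose f : ghost fam (gcosets G H) := fun T t => (homs (oind sHG (gset_repr u.1 : gset H)) t -
  homs (oind sHG (gset_repr u.2 : gset H)) t) / (val s)%:R.
have [|x xE] := @rghost_ex _ _ _ P _ f.
  exists (val s); split; first exact: valP.
  exists (oind sHG (gset_repr u.1 : gset H)), (oind sHG (gset_repr u.2 : gset H)) => T t tO.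
  by rewrite mulrC divfK ?prime_to_neq0.
exists x => T t y ty tb; rewrite xE; last by exists y.
by rewrite /f !(homs_oind sHG _ ty tb) /rmark bmarkE rmorphB /= -!pmulrn.
Qed.

Lemma has_marks_uniq G (fam : family gT) H (x y : rghost fam P (gcosets G H))
    (w w' : burnsideP P H) : has_marks w (sval x) -> has_marks w' (sval y) ->
  (forall Q, Q \subset H -> fam Q -> rmark Q w = rmark Q w') -> x = y.
Proof.
move=> xw yw' E; apply: rghost_ext => T t tO; have [a ta ab] := point_over_base t tO.
rewrite (xw _ _ _ ta ab) (yw' _ _ _ ta ab); apply: E; first exact: stab_over_base ab.
exact: tsetP.
Qed.

(** G-sets over G/H are H-sets: the inverse of induction takes the fibre over the base
    coset. *)
Section Fibre.
Variables (G H : {group gT}) (sHG : H \subset G) (C : over (gcosets G H)).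
Fact ofibre_subproof (u : gres H (projT1 C)) a : a \in H ->
  projT2 C u == gbase G H -> projT2 C (gact _ u a) == gbase G H.
Proof.
move=> Ha /eqP ub; have Ga := subsetP sHG a Ha.
by rewrite gresE // gmapP // ub gbase_act_fix.
Qed.
Definition ofibre : gset H := gsub ofibre_subproof.

Lemma homs_ofibre (fam : family gT) (T : tset G fam) (t : gmap T (gcosets G H)) y :
  transitive_at y -> t y = gbase G H -> homs C t = (gfix ofibre (gstab_group y))%:R.
Proof.
move=> ty tb; apply: (homs_fibre sHG (r := fun (x : ofibre) d => d = val x) ty tb).
- by move=> x; exists (val x) => //; exact/eqP/(valP x).
- by move=> d /eqP db; exists (Sub d db).
- by move=> x d d' -> ->.
- by move=> x x' d -> /val_inj.
by move=> x d a Ha ->; rewrite gsubE // gresE.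
Qed.
End Fibre.

Lemma has_marks_surj G (fam : family gT) H (sHG : H \subset G)
    (x : rghost fam P (gcosets G H)) :
  exists w : burnsideP P H, has_marks w (sval x).
Proof.
have [s [Ps [A [B E]]]] := rghost_rational x.
exists (frac _ (bset (ofibre sHG A) - bset (ofibre sHG B)) (Sub s Ps : prime_to P)) => T t y ty tb.
have sy := stab_over_base tb; have s0 := pnat_gt0 Ps.
apply: (mulfI s0); rewrite E; last by exists y.
rewrite rmark_frac // mulrC divfK // bmarkD // bmarkN // !bmark_set // rmorphB /= -!pmulrn.
by rewrite !(homs_ofibre sHG _ ty tb).
Qed.

(** ** Marks of restrictions, transfers and conjugates *)

Lemma bmark_map H K Q (Phi : gset H -> gset K) (u : burnside H) : Q \subset K ->
  bmark Q (burnside_map Phi u) =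
  (gfix (Phi (gset_repr (repr u).1)) Q)%:Z - (gfix (Phi (gset_repr (repr u).2)) Q)%:Z.
Proof. by move=> sQK; rewrite /burnside_map /groth_lift bmarkD // bmarkN // !bmark_set. Qed.

Lemma gfix_res K H Q (X : gset H) : K \subset H -> Q \subset K -> gfix (gres K X) Q = gfix X Q.
Proof.
move=> sKH sQK; apply: eq_card => x; apply/gfixP/gfixP => xQ a Qa.
  by rewrite -[in RHS](xQ a Qa) gresE // (subsetP sQK).
by rewrite gresE ?(subsetP sQK) // xQ.
Qed.

Lemma gfix_conj H Q (X : gset H) g : Q \subset H -> gfix (gconj g X) (Q :^ g)%G = gfix X Q.
Proof.
move=> sQH; have E (x : X) a : a \in Q -> gact (gconj g X) x (a ^ g)%g = gact X x a.
  move=> Qa; transitivity (gconj_fun g (x : X) (a ^ g)%g); last by rewrite /gconj_fun conjgK.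
  by apply: mkactE; rewrite memJ_conjg (subsetP sQH).
apply: eq_card => x; apply/gfixP/gfixP => xQ a.
  by move=> Qa; rewrite -E // xQ // memJ_conjg.
by case/imsetP => b Qb ->; rewrite E // xQ.
Qed.

Lemma rmark_res K H Q (w : burnsideP P H) : K \subset H -> Q \subset K ->
  rmark Q (bPres K w) = rmark Q w.
Proof.
move=> sKH sQK; have sQH := subset_trans sQK sKH.
by rewrite rmark_frac // bmark_map // !gfix_res.
Qed.

Lemma rmark_conj H Q (w : burnsideP P H) g : Q \subset H ->
  rmark (Q :^ g)%G (bPconj g w) = rmark Q w.
Proof.
by move=> sQH; rewrite rmark_frac ?conjSg // bmark_map ?conjSg // !gfix_conj.
Qed.

(** Summing over the lifts of T to G/K turns maps into G x_K X over G/K into maps over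
    G/H, and over the base coset these see H x_K X. *)
Lemma has_marks_tr G (fam : family gT) K H (sKH : K \subset H) (sHG : H \subset G)
    (w : burnsideP P K) (phi : ghost fam (gcosets G K)) : has_marks w phi ->
  has_marks (bPtr H w) (ghT (gproj G sKH) phi).
Proof.
move=> phiw T t y ty tb; have sy := stab_over_base tb.
have sKG := subset_trans sKH sHG.
rewrite rmark_frac // bmark_map // rmorphB /= -!pmulrn.
rewrite -!(homs_oind_tr sKH sHG sKG _ ty tb) !homs_tr /ghT -sumrB.
apply: (mulfI (prime_to_neq0 (denom w))); rewrite mulrC [RHS]mulrC divfK ?prime_to_neq0 //.
rewrite mulr_suml; apply: eq_bigr => s _; rewrite mulrC (has_marks_homs sKG phiw) //.
by exists y.
Qed.

Lemma has_marks_res G (fam : family gT) K H (sKH : K \subset H)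
    (w : burnsideP P H) (phi : ghost fam (gcosets G H)) : has_marks w phi ->
  has_marks (bPres K w) (ghR (gproj G sKH) phi).
Proof.
move=> phiw T t y ty tb; rewrite /ghR (phiw _ _ y) //; last first.
  by rewrite -[LHS]/(gproj G sKH (t y)) tb gproj_base.
by rewrite rmark_res //; exact: stab_over_base tb.
Qed.

(** The shift moves the point y over the base coset of G/H to a point over g^-1 H; its
    translate by g lies over the base coset of G/H^g and has stabilizer conjugated
    by g. *)
Lemma has_marks_shift G (fam : family gT) H (w : burnsideP P H) g (Gg : g \in G)
    (phi : ghost fam (gcosets G (H :^ g)%G)) : has_marks (bPconj g w) phi ->
  has_marks w (ghR (gshift H Gg) phi).
Proof.
move=> phiw T t y ty tb; rewrite /ghR (phiw _ _ (gact T y g)).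
- have -> : gstab_group (gact T y g) = (gstab_group y :^ g)%G.
    apply/val_inj/setP => a /=; rewrite mem_conjg; apply/gstabP/gstabP => -[Ga E]; split.
    + by rewrite groupJ ?groupV.
    + have := congr1 (fun z => gact T z g^-1%g) E; rewrite gactV // -!gactM ?groupM ?groupV //.
      by rewrite conjgE invgK mulgA.
    + by rewrite -(groupJr _ (groupVr Gg)).
    + have Ga' : a \in G by rewrite -(groupJr _ (groupVr Gg)).
      rewrite -{2}E -!gactM ?groupJ ?groupV //.
      by rewrite conjgE invgK -!mulgA mulVg mulg1.
  by rewrite rmark_conj //; exact: stab_over_base tb.
- exact: transitive_any ty.
rewrite gmapP //; apply: val_inj; rewrite gcosetsE //.
rewrite -[val _]/(g^-1 *: val (t y))%g tb /=.
by rewrite conjsgE mulgA.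
Qed.
End MarkedGhosts.

(** * The localization at the idempotent of the trivial subgroup *)

Section SolvableFamily.
Variables (gT : finGroupType) (P : nat_pred).
Implicit Types G H K Q R : {group gT}.
Local Open Scope group_scope.

Lemma Presidual_trivial Q : (Presidual P Q :==: 1) = solvable Q && P.-group Q.
Proof.
have E : solvable_P_quotient P Q 1%G = solvable Q && P.-group Q.
  rewrite /solvable_P_quotient normal1 /= -(isog_sol (quotient1_isog Q)).
  by rewrite /pgroup -(card_isog (quotient1_isog Q)).
have [resQ minQ] := PresidualP P Q; apply/eqP/idP => [Q1|]; last first.
  by rewrite -E => /minQ sQ1; apply/trivgP.
by rewrite -E; have <- : Presidual P Q = 1%G by exact: val_inj.
Qed.

Fact solvable_familyS Q R : Q \subset R -> Presidual P R :==: 1 -> Presidual P Q :==: 1.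
Proof.
rewrite !Presidual_trivial => sQR /andP[sR pR].
by rewrite (solvableS sQR sR) (pgroupS sQR pR).
Qed.
Definition solvable_family : family gT :=
  Family (in_family := fun Q => Presidual P Q :==: 1) solvable_familyS.

Lemma solvable_familyJ Q g : solvable_family Q -> solvable_family (Q :^ g)%G.
Proof.
by rewrite /= !Presidual_trivial -(isog_sol (conj_isog Q g)) pgroupJ.
Qed.

Lemma gcosets_solvable G Q : solvable_family Q ->
  forall C : gcosets G Q, solvable_family (gstab_group C).
Proof.
move=> solQ C; have [a Ga ->] := gcosets_pt C.
apply: familyS (solvable_familyJ a solQ); apply/subsetP => b /gstabP[Gb].
have Gab : a * b \in G by rewrite groupM.
rewrite -gactM // => /eqP; rewrite gbase_act_eq // => Qab.
by rewrite mem_conjg conjgE invgK mulgA.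
Qed.

Lemma dress_rmark G L (e : burnsideP P G) Q : is_dress_idempotent L e -> Q \subset G ->
  rmark Q e = ((Presidual P Q : {set gT}) \in L :^: G)%:R.
Proof. by move=> eL sQG; apply: bPmark_rmark => //; exact: eL. Qed.

Lemma mem_conjugates1 G (A : {group gT}) : ((A : {set gT}) \in [1 gT]%G :^: G) = (A :==: 1).
Proof.
apply/imsetP/eqP => [[x _ ->]|->]; first exact: conjs1g.
by exists 1; rewrite ?group1 // conjs1g.
Qed.
End SolvableFamily.

Section Theta.
Variables (gT : finGroupType) (P : nat_pred) (G : {group gT}) (e : burnsideP P G).
Implicit Types H K Q : {group gT}.
Notation fam := (solvable_family gT P).
Hypothesis eE : forall Q, Q \subset G -> rmark Q e = (fam Q)%:R.

Lemma rmark_powers H Q i : H \subset G -> Q \subset H ->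
  rmark Q (eden e H i) = (fam Q)%:R ^+ i.
Proof.
by move=> sHG sQH; rewrite /= rmarkX // rmark_res // eE // (subset_trans sQH).
Qed.

(** At the subgroups of the family e has mark 1, so denominators do not affect marks. *)
Lemma rmark_numer H Q a i : H \subset G -> Q \subset H -> fam Q ->
  rmark Q (numer (frac (eden e H) a i)) = rmark Q a.
Proof.
move=> sHG sQH famQ.
have [k /(congr1 (rmark Q))] := frac_repr_ex (eden e H) a i.
by rewrite !rmarkM // !rmark_powers // famQ !expr1n !mul1r !mulr1.
Qed.

(** Multiplication by e kills the marks outside the family and keeps the others. *)
Lemma loc_marks_inj H (x y : burnsideP_loc e H) : H \subset G ->
  (forall Q, Q \subset H -> fam Q -> rmark Q (numer x) = rmark Q (numer y)) -> x = y.
Proof.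
move=> sHG E; rewrite -[x]frac_repr -[y]frac_repr; apply/fracP; exists 1%N.
apply: rmark_inj => Q sQH; rewrite !rmarkM // !rmark_powers //.
case famQ : (fam Q); last by rewrite expr1 !mul0r.
by rewrite !expr1n E.
Qed.

Lemma loc_numerK H (x : burnsideP_loc e H) : H \subset G -> loc_in (eden e H) (numer x) = x.
Proof. by move=> sHG; apply: loc_marks_inj => // Q sQH famQ; rewrite rmark_numer. Qed.

Fact theta_ex H (x : burnsideP_loc e H) : exists phi : rghost fam P (gcosets G H),
  H \subset G -> has_marks (numer x) (sval phi).
Proof.
case sHG : (H \subset G); last by exists (rghost0 fam P _).
by have [phi phix] := has_marks_ex fam sHG (numer x); exists phi.
Qed.
Definition theta H (x : burnsideP_loc e H) : rghost fam P (gcosets G H) := sval (cid (theta_ex x)).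

Section Subgroup.
Variable H : {group gT}.
Hypothesis sHG : H \subset G.

Lemma theta_marks (x : burnsideP_loc e H) : has_marks (numer x) (sval (theta x)).
Proof. exact: (svalP (cid (theta_ex x))). Qed.

Lemma theta_has_marks (x : burnsideP_loc e H) (w : burnsideP P H)
    (phi : rghost fam P (gcosets G H)) :
    (forall Q, Q \subset H -> fam Q -> rmark Q (numer x) = rmark Q w) ->
  has_marks w (sval phi) -> theta x = phi.
Proof. by move=> E phiw; exact: has_marks_uniq (theta_marks x) phiw E. Qed.

(** Every mark is a value of the ghost, at the orbit G/Q. *)
Lemma theta_orbit Q (famQ : fam Q) (sQH : Q \subset H) (w : burnsideP P H)
    (phi : ghost fam (gcosets G H)) : has_marks w phi ->
  rmark Q w = phi (TSet (gcosets_solvable (G := G) famQ)) (gproj G sQH).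
Proof.
move=> phiw; rewrite (phiw (TSet (gcosets_solvable (G := G) famQ)) _ (gbase G Q)); last 2 first.
- exact: gbase_transitive.
- exact: gproj_base.
congr (rmark _ _); apply: val_inj; rewrite /= gbase_stab //; exact: subset_trans sQH sHG.
Qed.

Lemma theta_inj : injective (@theta H).
Proof.
move=> x y E; apply: loc_marks_inj => // Q sQH famQ.
by rewrite (theta_orbit famQ sQH (theta_marks x)) (theta_orbit famQ sQH (theta_marks y)) E.
Qed.

Lemma theta_surj phi : exists x, @theta H x = phi.
Proof.
have [w phiw] := has_marks_surj sHG phi; exists (loc_in _ w).
by apply: theta_has_marks phiw => Q sQH famQ; rewrite rmark_numer.
Qed.

Lemma theta_bij : bijective (@theta H).
Proof.
have [g gK] := choice theta_surj; exists g => // x; apply: theta_inj; exact: gK.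
Qed.

Lemma thetaD (x y : burnsideP_loc e H) (T : tset G fam) (t : gmap T (gcosets G H)) : is_orbit T ->
  sval (theta (x + y)) T t = sval (theta x) T t + sval (theta y) T t.
Proof.
move=> tO; have [a ta ab] := point_over_base t tO; have sa := stab_over_base ab.
rewrite !(theta_marks _ ta ab) -rmarkD // rmark_numer //; last exact: tsetP.
rewrite !rmarkD // !rmarkM // !rmark_powers //.
by rewrite (tsetP a : fam (gstab_group a) = true) !expr1n !mulr1.
Qed.

Lemma thetaM (x y : burnsideP_loc e H) (T : tset G fam) (t : gmap T (gcosets G H)) : is_orbit T ->
  sval (theta (x * y)) T t = sval (theta x) T t * sval (theta y) T t.
Proof.
move=> tO; have [a ta ab] := point_over_base t tO; have sa := stab_over_base ab.
by rewrite !(theta_marks _ ta ab) rmark_numer ?rmarkM //; exact: tsetP.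
Qed.

(** Needed beyond orbits because norms evaluate at pullbacks. *)
Lemma thetaM_all (x y : burnsideP_loc e H) (T : tset G fam) (t : gmap T (gcosets G H)) :
  sval (theta (x * y)) T t = sval (theta x) T t * sval (theta y) T t.
Proof.
have xI := rghost_iso (theta x); have yI := rghost_iso (theta y).
have [x0 xM] := rghost_mult (theta x); have [y0 yM] := rghost_mult (theta y).
pose phi : ghost fam (gcosets G H) := fun T t => sval (theta x) T t * sval (theta y) T t.
rewrite -[RHS]/(phi T t); congr (_ T t); apply: ghost_orbits.
- exact: rghost_iso.
- exact: rghost_mult.
- by move=> S U f s u fb E; rewrite /phi (xI _ _ _ _ _ fb E) (yI _ _ _ _ _ fb E).
- split=> [|S U s u]; first by rewrite /phi x0 y0 mulr1.
  by rewrite /phi xM yM mulrACA.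
by move=> S s; exact: thetaM.
Qed.

Lemma theta1 (T : tset G fam) (t : gmap T (gcosets G H)) : sval (theta (1 : burnsideP_loc e H)) T t = 1.
Proof.
rewrite -(homs_one t); congr (_ T t); apply: ghost_orbits.
- exact: rghost_iso.
- exact: rghost_mult.
- exact: homs_iso_inv.
- exact: homs_mult.
move=> S s sO; have [a sa ab] := point_over_base s sO.
rewrite homs_one (theta_marks _ sa ab) rmark_numer ?rmark1 //; try exact: tsetP;
  exact: stab_over_base ab.
Qed.
End Subgroup.

Lemma theta_norm K H (sKH : K \subset H) (sHG : H \subset G) (w : burnsideP P K) :
  has_marks (bPnorm H w) (ghN (gproj G sKH) (sval (theta (loc_in (eden e K) w)))).
Proof.
have sKG := subset_trans sKH sHG.
apply: rmark_norm => //; [exact: rghost_iso | exact: rghost_mult |].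
move=> T t y ty tb; rewrite (theta_marks sKG _ ty tb) rmark_numer //.
  exact: stab_over_base tb.
exact: tsetP.
Qed.

(** The norm of ghosts, transported along theta. *)
Lemma inherited_norm_ex K H : K \subset H -> H \subset G ->
  exists Nt : burnsideP_loc e K -> burnsideP_loc e H, inherited_norm Nt.
Proof.
move=> sKH sHG; have sKG := subset_trans sKH sHG.
have [g _ gK] := theta_bij sHG.
pose n (x : burnsideP_loc e K) : rghost fam P (gcosets G H) :=
  rghost_map (bispan_N (gproj G sKH)) (theta x).
have nE x : sval (n x) = ghN (gproj G sKH) (sval (theta x)) by exact: rghost_N.
exists (g \o n); split.
- apply: (theta_inj sHG); rewrite gK; apply: rghost_ext => T t tO.
  by rewrite nE /ghN !theta1.
- move=> x y; apply: (theta_inj sHG); rewrite gK; apply: rghost_ext => T t tO.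
  by rewrite thetaM // !gK !nE /ghN thetaM_all.
move=> w; apply: (theta_inj sHG); rewrite gK; symmetry.
apply: (theta_has_marks sHG (w := bPnorm H w)); last by rewrite nE; exact: theta_norm.
by move=> Q sQH famQ; rewrite rmark_numer.
Qed.

Lemma theta_tambara (Nt : forall K H : {group gT}, burnsideP_loc e K -> burnsideP_loc e H) :
    (forall K H : {group gT}, K \subset H -> H \subset G -> inherited_norm (Nt K H)) ->
  is_tambara G Nt.
Proof.
move=> NtP; exists (ghost_tambara G fam P), theta; split.
- move=> H sHG; split; first exact: theta_bij.
    by move=> x y; apply: ghost_is_sum => T t; exact: thetaD.
  by move=> x y; apply: ghost_is_prod => T t; exact: thetaM.
- move=> K H sKH sHG; have sKG := subset_trans sKH sHG; split=> x; symmetry.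
  + apply: (theta_has_marks sKG (w := bPres K (numer x))).
      by move=> Q sQK famQ; rewrite rmark_numer.
    by rewrite rghost_R; apply: has_marks_res; exact: (theta_marks sHG).
  + apply: (theta_has_marks sHG (w := bPtr H (numer x))).
      by move=> Q sQH famQ; rewrite rmark_numer.
    by rewrite rghost_T; exact: (has_marks_tr sKH sHG (theta_marks sKG x)).
  have [_ _ NtE] := NtP K H sKH sHG.
  rewrite -[x in Nt _ _ x](loc_numerK x sKG) NtE.
  apply: (theta_has_marks sHG (w := bPnorm H (numer x))).
    by move=> Q sQH famQ; rewrite rmark_numer.
  by rewrite rghost_N; have := theta_norm sKH sHG (numer x); rewrite loc_numerK.
move=> H g Gg sHG x; have sHgG : (H :^ g)%g \subset G by rewrite conj_subG.
symmetry; apply: (theta_has_marks sHG (w := numer x)) => //.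
rewrite rghost_R; apply: has_marks_shift => T t y ty tb.
rewrite (theta_marks (H := (H :^ g)%G) sHgG _ ty tb) rmark_numer //.
  exact: stab_over_base tb.
exact: tsetP.
Qed.
End Theta.

(** * Norms force the subgroup to be trivial *)

Section Necessity.
Variables (gT : finGroupType) (P : nat_pred).
Implicit Types G H K L Q : {group gT}.

Lemma orbit_decomposition_gt0 G (fam : family gT) X (S : tset G fam) (s : gmap S X) m
    (o : nat -> {T : tset G fam & gmap T X}) (x : S) :
  orbit_decomposition s m o -> (0 < m)%N.
Proof.
case: m => // -[_ /(_ (homs (ozero X)) (homs_iso_inv _) (homs_mult _ _))].
rewrite big_ord0 homsE eq_card0 => [/eqP|f]; first by rewrite eq_sym oner_eq0.
by case: (f x).
Qed.

(** The pullback on which the norm evaluates the ghost of 0 is not empty, and that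
    ghost vanishes on orbits. *)
Lemma rmark_norm0 K H : K \subset H -> rmark H (bPnorm H (0 : burnsideP P K)) = 0.
Proof.
move=> sKH; have allT (x : gcosets H H) : all_family gT (gstab_group x) by [].
pose T := TSet allT.
have [phi phi0] := has_marks_ex (all_family gT) sKH (0 : burnsideP P K).
have tb := gproj_base H (subxx H).
have ty := @gbase_transitive _ H H.
have := rmark_norm sKH (subxx H) (rghost_iso phi) (rghost_mult phi) phi0.
move=> /(_ T (gproj H (subxx H)) _ ty tb).
have -> : gstab_group (gbase H H : T) = H by apply: val_inj; rewrite /= gbase_stab.
move=> <-; have [m [o [z [mn od zP _]]]] := bmark_norm sKH (subxx H) (T := T) ty tb.
have m0 : (0 < m)%N.
  apply: orbit_decomposition_gt0 od.
  by apply: (@gpull_pt _ _ _ _ _ _ _ (gbase H H : T) (gbase H K)); rewrite tb gproj_base.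
rewrite /ghN od.2; [|exact: rghost_iso|exact: rghost_mult].
rewrite (bigD1 (Ordinal m0)) //=; have [x [tx xb _]] := zP 0%N m0.
by rewrite (phi0 _ _ _ tx xb) rmark0 ?mul0r //; exact: stab_over_base xb.
Qed.

(** The contradiction is 0 = 1 in the localization of A(1)_(P), carried to A(L)_(P). *)
Lemma inherited_norm_trivial G L (sLG : L \subset G) (L_perfect : P_perfect P L)
    (e : burnsideP P G) (eL : is_dress_idempotent L e)
    (Nt : burnsideP_loc e 1%G -> burnsideP_loc e L) :
  inherited_norm Nt -> L = 1%G.
Proof.
move=> [Nt1 _ NtE]; apply/eqP/negPn/negP => L1.
have e0 : bPres 1%G e = 0.
  apply: rmark_inj => Q sQ1; rewrite rmark_res ?sub1G // rmark0 //.
  rewrite (dress_rmark eL) ?(subset_trans sQ1) ?sub1G //.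
  have -> : Q = 1%G by apply/val_inj/trivgP.
  case: imsetP => // -[x _ E]; case/negP: L1; apply/eqP/val_inj/trivgP.
  have P1 : (Presidual P 1%G : {set gT}) = 1%g.
    by apply/eqP; rewrite (Presidual_trivial P 1%G) solvable1 pgroup1.
  by rewrite -(conjSg _ _ x) -E P1 conjs1g.
have loc0 : loc_in (eden e 1%G) 0 = 1.
  by apply/fracP; exists 1%N; rewrite /= expr1 e0 !mul0r.
have := NtE 0; rewrite loc0 Nt1 => /esym/fracP[k /(congr1 (rmark L))].
rewrite /= !rmarkM // !rmarkX // rmark_res // (dress_rmark eL) // L_perfect.
have -> : (L : {set gT}) \in (L :^: G)%g by apply/imsetP; exists 1%g; rewrite ?group1 // conjsg1.
by rewrite !expr1n rmark_norm0 ?sub1G // mul0r mulr0 !mulr1 => /eqP.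
Qed.
End Necessity.

Theorem corollary4p3 (gT : finGroupType) (G : {group gT}) (P : nat_pred)
    (P_primes : forall p : nat, p \in P -> prime p)
    (L : {group gT}) (sLG : L \subset G) (L_perfect : P_perfect P L)
    (e : burnsideP P G) (eL : is_dress_idempotent L e) :
  ((forall K H : {group gT}, K \subset H -> H \subset G ->
      exists Nt : burnsideP_loc e K -> burnsideP_loc e H, inherited_norm Nt)
   <-> L = 1%G) /\
  (L = 1%G ->
   forall Nt : (forall K H : {group gT}, burnsideP_loc e K -> burnsideP_loc e H),
     (forall K H : {group gT}, K \subset H -> H \subset G ->
        inherited_norm (Nt K H)) ->
     is_tambara G Nt).
Proof.
have eE (Q : {group gT}) : L = 1%G -> Q \subset G -> rmark Q e = (solvable_family gT P Q)%:R.
  by move=> L1 sQG; rewrite (dress_rmark eL) // L1 mem_conjugates1.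
split=> [|L1 Nt]; last by apply: theta_tambara => Q; exact: eE.
split=> [norms | L1 K H sKH sHG]; last by apply: inherited_norm_ex => // Q; exact: eE.
have [Nt NtP] := norms 1%G L (sub1G L) sLG.
exact: inherited_norm_trivial NtP.
Qed.
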